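(* Fix $R>0$. There exist $\varepsilon_R>0$ and a smooth family $\{\Sigma_c\}_{0\le c<\varepsilon_R}$ of embedded rotational free boundary $f_c$-minimal annuli in $\overline{\mathbb B}_R^3$, where $f_c(x)=\frac c2|x|^2$, such that: (i) $\Sigma_0$ is the unweighted critical catenoid in $\overline{\mathbb B}_R^3$. (ii) If $0<c<\varepsilon_R$, then $\Sigma_c$ is non-flat. (iii) Every $\Sigma_c$ satisfies $$|A_{x^\perp}|^2\le 1+\bigl(1-c|x^\perp|^2\bigr)^2,$$ and equality holds exactly on the minimum circle of $\Sigma_c$. (iv) The corresponding neck radius $a(c)$ of $\Sigma_c$ is the unique shooting root in a neighborhood of the critical-catenoid neck radius $a_0$: there is a neighborhood $U\subset(0,R)$ of $a_0$ such that for every $c\in[0,\varepsilon_R)$, $a(c)$ is the only $a\in U\cap\mathcal A_c$ with $\widehat{\mathcal Q}(c,a)=0$.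
   Context: $\mathbb B_R^3$ is the open ball of radius $R$ centered at the origin, $\overline{\mathbb B}_R^3$ its closure. $x$ is the position vector, $v^\perp$ the normal projection of $v$, $A$ the second fundamental form, $\vec H=\sum_iA(e_i,e_i)$; a surface is $f_c$-minimal if $\vec H=-c\,x^\perp$. A compact surface $\Sigma\subset\overline{\mathbb B}_R^3$ with nonempty boundary is free boundary if $\Sigma\cap\partial\mathbb B_R^3=\partial\Sigma$ and $\Sigma$ meets the sphere orthogonally along $\partial\Sigma$. $A_{x^\perp}(X,Y)=\langle x^\perp,A(X,Y)\rangle$ and $|A_{x^\perp}|^2=\sum_{i,j}\langle x^\perp,A(e_i,e_j)\rangle^2$. Non-flat means $A\not\equiv0$. The minimum circle of $\Sigma_c$ is the set where $|x|^2$ attains its minimum on $\Sigma_c$. Rotational profile. For $c\ge0$ and $a\in(0,R)$ let $(\rho_{c,a},z_{c,a},\theta_{c,a})$ be the maximal solution with $\rho>0$, on $[0,s^+_{c,a})$, of $$\rho'=\cos\theta,\quad z'=\sin\theta,\quad \theta'=c(\rho\sin\theta-z\cos\theta)-\frac{\sin\theta}{\rho},$$ $$\rho(0)=a,\quad z(0)=0,\quad\theta(0)=\tfrac\pi2.$$ Let $S(c,a)=\inf\{s\in[0,s^+_{c,a}):\rho_{c,a}(s)^2+z_{c,a}(s)^2=R^2\}\in(0,+\infty]$, let $\mathcal A_c$ (the shooting domain) be the set of $a\in(0,R)$ with $S(c,a)<\infty$ and $\frac{d}{ds}(\rho_{c,a}^2+z_{c,a}^2)(S(c,a))>0$, and for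 $a\in\mathcal A_c$ let $$\widehat{\mathcal Q}(c,a)=\bigl(\rho_{c,a}\sin\theta_{c,a}-z_{c,a}\cos\theta_{c,a}\bigr)(S(c,a)).$$ A shooting root (for $c$) is an $a\in\mathcal A_c$ with $\widehat{\mathcal Q}(c,a)=0$. The rotational annulus with neck radius $a$ is obtained by rotating once about the $z$-axis the curve $s\mapsto(\rho_{c,a}(s),0,z_{c,a}(s))$, $0\le s\le S(c,a)$, together with its reflection across $\{z=0\}$. Each $\Sigma_c$ is of this form, with neck radius $a(c)$; smoothness of the family means that these surfaces (with their profiles and neck radii) depend smoothly on $c\in[0,\varepsilon_R)$. Critical catenoid. Let $t_*>0$ be the unique solution of $t_*\tanh t_*=1$ and $a_0=R/\sqrt{\cosh^2t_*+t_*^2}$. The critical catenoid in $\overline{\mathbb B}_R^3$ is the surface obtained by rotating $t\mapsto(a_0\cosh t,0,a_0t)$, $|t|\le t_*$, about the $z$-axis; its neck radius is $a_0$. *)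

(* Defs.v *)
From Stdlib Require Export Reals.
From Stdlib Require Import Lra ClassicalEpsilon.
From Coquelicot Require Export Coquelicot.

Open Scope R_scope.

(** * Smoothness *)

(* [f] is C^infinity on a set [D] that need not be open: it is the restriction
   of a C^infinity function defined near [D]. *)
Definition smooth_on (D : R -> Prop) (f : R -> R) : Prop :=
  exists (U : R -> Prop) (g : R -> R),
    open U /\
    (forall x, D x -> U x /\ g x = f x) /\
    (forall x, U x -> forall n, ex_derive_n g n x).

Definition smooth2_near (D : R -> R -> Prop) (g : R -> R -> R) : Prop :=
  exists U : R -> R -> Prop,
    (forall x y, U x y -> locally_2d U x y) /\
    (forall x y, D x y -> U x y) /\
    (forall x y, U x y -> forall n, ex_diff_n g n x y).

Definition smooth2_on (D : R -> R -> Prop) (f : R -> R -> R) : Prop :=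
  exists g : R -> R -> R,
    smooth2_near D g /\ (forall x y, D x y -> g x y = f x y).

(** * Euclidean three-space *)

Definition E3 : Type := (R * R * R)%type.

Definition mkE3 (x y z : R) : E3 := (x, y, z).
Definition cx (p : E3) : R := fst (fst p).
Definition cy (p : E3) : R := snd (fst p).
Definition cz (p : E3) : R := snd p.

Definition addv (p q : E3) : E3 := mkE3 (cx p + cx q) (cy p + cy q) (cz p + cz q).
Definition mulv (k : R) (p : E3) : E3 := mkE3 (k * cx p) (k * cy p) (k * cz p).
Definition zerov : E3 := mkE3 0 0 0.
Definition dot (p q : E3) : R := cx p * cx q + cy p * cy q + cz p * cz q.
Definition cross (p q : E3) : E3 :=
  mkE3 (cy p * cz q - cz p * cy q)
       (cz p * cx q - cx p * cz q)
       (cx p * cy q - cy p * cx q).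

Definition Derive3 (f : R -> E3) (t : R) : E3 :=
  mkE3 (Derive (fun r => cx (f r)) t)
       (Derive (fun r => cy (f r)) t)
       (Derive (fun r => cz (f r)) t).

(** * Local geometry of a parametrized surface [X : R -> R -> E3]

    A tangent vector at [X u v] is given by its coordinates [e : R * R] in the
    frame [(d_u X, d_v X)]. *)

Definition Du (X : R -> R -> E3) (u v : R) : E3 := Derive3 (fun t => X t v) u.
Definition Dv (X : R -> R -> E3) (u v : R) : E3 := Derive3 (fun t => X u t) v.

Definition tangent (X : R -> R -> E3) (u v : R) (e : R * R) : E3 :=
  addv (mulv (fst e) (Du X u v)) (mulv (snd e) (Dv X u v)).

Definition unit_normal (X : R -> R -> E3) (u v : R) : E3 :=
  let n := cross (Du X u v) (Dv X u v) in mulv (/ sqrt (dot n n)) n.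

Definition normal_proj (X : R -> R -> E3) (u v : R) (w : E3) : E3 :=
  mulv (dot w (unit_normal X u v)) (unit_normal X u v).

Definition hessian (X : R -> R -> E3) (u v : R) (e f : R * R) : E3 :=
  addv
    (addv (mulv (fst e * fst f) (Du (Du X) u v))
          (mulv (fst e * snd f) (Du (Dv X) u v)))
    (addv (mulv (snd e * fst f) (Dv (Du X) u v))
          (mulv (snd e * snd f) (Dv (Dv X) u v))).

(* A(e, f) is the normal part of the ambient derivative along [e] of a tangent
   field extending [f]; for the extension with constant coordinates this
   derivative is the Hessian of [X] applied to [(e, f)]. *)
Definition second_form (X : R -> R -> E3) (u v : R) (e f : R * R) : E3 :=
  normal_proj X u v (hessian X u v e f).

Definition orthonormal_frame (X : R -> R -> E3) (u v : R) (e1 e2 : R * R) : Prop :=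
  dot (tangent X u v e1) (tangent X u v e1) = 1 /\
  dot (tangent X u v e2) (tangent X u v e2) = 1 /\
  dot (tangent X u v e1) (tangent X u v e2) = 0.

Definition mean_curvature (X : R -> R -> E3) (u v : R) (e1 e2 : R * R) : E3 :=
  addv (second_form X u v e1 e1) (second_form X u v e2 e2).

Definition xperp (X : R -> R -> E3) (u v : R) : E3 := normal_proj X u v (X u v).

Definition A_xperp (X : R -> R -> E3) (u v : R) (e f : R * R) : R :=
  dot (xperp X u v) (second_form X u v e f).

Definition normsq_A_xperp (X : R -> R -> E3) (u v : R) (e1 e2 : R * R) : R :=
  A_xperp X u v e1 e1 ^ 2 + A_xperp X u v e1 e2 ^ 2 +
  A_xperp X u v e2 e1 ^ 2 + A_xperp X u v e2 e2 ^ 2.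

(** * Annuli *)

(* The image of [-halflen, halflen] x R, where the second variable is an angle.
   The chart is a function on the whole plane, so that the derivatives at
   [u = halflen] and [u = - halflen] are two-sided. *)
Record annulus := Annulus { chart : R -> R -> E3; halflen : R }.

Definition strip (S : annulus) (u v : R) : Prop := Rabs u <= halflen S.

Definition on_surface (S : annulus) (p : E3) : Prop :=
  exists u v, strip S u v /\ chart S u v = p.

Definition on_boundary (S : annulus) (p : E3) : Prop :=
  exists u v, Rabs u = halflen S /\ chart S u v = p.

(* By compactness, an injective immersion of [-halflen, halflen] x (R / 2 PI Z)
   is an embedding. *)
Definition embedded (S : annulus) : Prop :=
  0 < halflen S /\
  (forall u v, chart S u (v + 2 * PI) = chart S u v) /\
  smooth2_near (strip S) (fun u v => cx (chart S u v)) /\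
  smooth2_near (strip S) (fun u v => cy (chart S u v)) /\
  smooth2_near (strip S) (fun u v => cz (chart S u v)) /\
  (forall u v, strip S u v ->
     cross (Du (chart S) u v) (Dv (chart S) u v) <> zerov) /\
  (forall u v u' v', strip S u v -> strip S u' v' ->
     chart S u v = chart S u' v' ->
     u = u' /\ exists k : Z, v' = v + 2 * IZR k * PI).

Definition f_minimal (c : R) (S : annulus) : Prop :=
  forall u v e1 e2, strip S u v -> orthonormal_frame (chart S) u v e1 e2 ->
    mean_curvature (chart S) u v e1 e2 = mulv (- c) (xperp (chart S) u v).

(* Two surfaces meet orthogonally when their normals do; the normal of the
   sphere at [p] is [p] up to scaling. *)
Definition free_boundary (Rad : R) (S : annulus) : Prop :=
  (forall p, on_surface S p -> dot p p <= Rad ^ 2) /\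
  (forall p, on_surface S p /\ dot p p = Rad ^ 2 <-> on_boundary S p) /\
  (forall u v, Rabs u = halflen S ->
     dot (unit_normal (chart S) u v) (chart S u v) = 0).

Definition non_flat (S : annulus) : Prop :=
  exists u v e f, strip S u v /\ second_form (chart S) u v e f <> zerov.

Definition minimum_circle (S : annulus) (p : E3) : Prop :=
  on_surface S p /\ forall q, on_surface S q -> dot p p <= dot q q.

Definition revolve (r h : R -> R) (L : R) : annulus :=
  Annulus (fun u v => mkE3 (r u * cos v) (r u * sin v) (h u)) L.

(** * The rotational profile *)

Record profile := Profile {
  pend : Rbar;
  rho : R -> R;
  zed : R -> R;
  theta : R -> R
}.

(* Derivative relative to [0, +oo): one-sided at 0. *)
Definition is_derive_ge0 (f : R -> R) (s l : R) : Prop :=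
  filterdiff f (within (fun t => 0 <= t) (locally s)) (fun h => scal h l).

Definition profile_solution (c a : R) (P : profile) : Prop :=
  rho P 0 = a /\ zed P 0 = 0 /\ theta P 0 = PI / 2 /\
  forall s, 0 <= s -> Rbar_lt s (pend P) ->
    0 < rho P s /\
    is_derive_ge0 (rho P) s (cos (theta P s)) /\
    is_derive_ge0 (zed P) s (sin (theta P s)) /\
    is_derive_ge0 (theta P) s
      (c * (rho P s * sin (theta P s) - zed P s * cos (theta P s))
       - sin (theta P s) / rho P s).

Definition maximal_profile (c a : R) (P : profile) : Prop :=
  Rbar_lt 0 (pend P) /\ profile_solution c a P /\
  forall P', profile_solution c a P' -> Rbar_le (pend P') (pend P).

(* The maximal solution for the parameters [c], [a]; its components are
   determined on [0, pend) and carry no meaning elsewhere. *)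
Definition the_profile (c a : R) : profile :=
  epsilon (inhabits (Profile 0 (fun _ => 0) (fun _ => 0) (fun _ => 0)))
          (maximal_profile c a).

(** * Shooting *)

Definition sqdist (c a s : R) : R :=
  rho (the_profile c a) s ^ 2 + zed (the_profile c a) s ^ 2.

Definition shooting_time (Rad c a : R) : Rbar :=
  Glb_Rbar (fun s => 0 <= s /\ Rbar_lt s (pend (the_profile c a)) /\
                     sqdist c a s = Rad ^ 2).

Definition shooting_length (Rad c a : R) : R := real (shooting_time Rad c a).

Definition shooting_domain (Rad c a : R) : Prop :=
  0 < a < Rad /\
  Rbar_lt (shooting_time Rad c a) p_infty /\
  0 < Derive (sqdist c a) (shooting_length Rad c a).

Definition Qhat (Rad c a : R) : R :=
  let P := the_profile c a in
  let s := shooting_length Rad c a in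
  rho P s * sin (theta P s) - zed P s * cos (theta P s).

Definition shooting_root (Rad c a : R) : Prop :=
  shooting_domain Rad c a /\ Qhat Rad c a = 0.

(* The profile on [0, pend) together with its reflection across z = 0. *)
Definition refl_rho (c a s : R) : R := rho (the_profile c a) (Rabs s).
Definition refl_zed (c a s : R) : R := sign s * zed (the_profile c a) (Rabs s).

Definition rotational_annulus (Rad c a : R) : annulus :=
  revolve (refl_rho c a) (refl_zed c a) (shooting_length Rad c a).

(* Smooth dependence on [c] of the rotational annuli with neck radii [a c]: of
   the neck radius, of the length of the profile, and, jointly in [c] and the
   arclength, of the profile and of the reflected curve that generates the
   surface. *)
Definition smooth_family (Rad eps : R) (a : R -> R) : Prop :=
  let len c := shooting_length Rad c (a c) in
  smooth_on (fun c => 0 <= c < eps) a /\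
  smooth_on (fun c => 0 <= c < eps) len /\
  smooth2_on (fun c s => 0 <= c < eps /\ Rabs s <= len c)
    (fun c s => refl_rho c (a c) s) /\
  smooth2_on (fun c s => 0 <= c < eps /\ Rabs s <= len c)
    (fun c s => refl_zed c (a c) s) /\
  smooth2_on (fun c s => 0 <= c < eps /\ 0 <= s <= len c)
    (fun c s => theta (the_profile c (a c)) s).

(** * The critical catenoid *)

Lemma exp_sq (t : R) : exp (2 * t) = exp t * exp t.
Proof. rewrite <- exp_plus; f_equal; ring. Qed.

Lemma tanh_exp (t : R) : tanh t = 1 - 2 / (exp (2 * t) + 1).
Proof.
  assert (H := exp_pos t).
  unfold tanh, sinh, cosh; rewrite exp_Ropp, exp_sq.
  field; repeat split; nra.
Qed.

Lemma t_star_sig : {t : R | 0 < t /\ t * tanh t = 1}.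
Proof.
  destruct (IVT (fun t => t * tanh t - 1) 0 2) as [t [[H0 H2] Ht]].
  - intros x; apply continuity_pt_filterlim.
    apply (ex_derive_continuous (fun t => t * tanh t - 1)).
    apply (ex_derive_ext (fun t => t * (1 - 2 / (exp (2 * t) + 1)) - 1)).
    + intros u; now rewrite tanh_exp.
    + auto_derive; assert (H := exp_pos (2 * x)); lra.
  - lra.
  - lra.
  - rewrite tanh_exp.
    assert (H : 1 + 2 * 2 < exp (2 * 2)) by (apply exp_ineq1; lra).
    assert (H' : 2 / (exp (2 * 2) + 1) < 2 / 4).
    { apply Rmult_lt_compat_l; [lra|]. apply Rinv_lt_contravar; nra. }
    lra.
  - exists t; split; [|lra].
    destruct H0 as [H0|H0]; [exact H0|].
    exfalso; rewrite <- H0 in Ht; lra.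
Qed.

Definition t_star : R := proj1_sig t_star_sig.

Lemma t_star_spec (t : R) : 0 < t /\ t * tanh t = 1 <-> t = t_star.
Proof.
  assert (mono : forall x y, 0 < x -> x < y -> x * tanh x < y * tanh y).
  { intros x y Hx Hxy; rewrite !tanh_exp.
    assert (E1 : 1 + 2 * x < exp (2 * x)) by (apply exp_ineq1; lra).
    assert (E2 : exp (2 * x) < exp (2 * y)) by (apply exp_increasing; lra).
    assert (I1 : 2 / (exp (2 * x) + 1) < 2 / 2).
    { apply Rmult_lt_compat_l; [lra|]. apply Rinv_lt_contravar; nra. }
    assert (I2 : 2 / (exp (2 * y) + 1) < 2 / (exp (2 * x) + 1)).
    { apply Rmult_lt_compat_l; [lra|]. apply Rinv_lt_contravar; nra. }
    nra. }
  assert (Hs := proj2_sig t_star_sig); fold t_star in Hs; cbv beta in Hs.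
  split; [|now intros ->].
  intros [H0 H1].
  destruct (Rtotal_order t t_star) as [H|[H|H]]; [|exact H|].
  - generalize (mono t t_star); lra.
  - generalize (mono t_star t); lra.
Qed.

Definition catenoid_neck (Rad : R) : R := Rad / sqrt (cosh t_star ^ 2 + t_star ^ 2).

Definition critical_catenoid (Rad : R) : annulus :=
  revolve (fun t => catenoid_neck Rad * cosh t)
          (fun t => catenoid_neck Rad * t) t_star.

(* Main.v *)
(** The profile equation is invariant under scaling: the profile for [(c, a)] is
    [a] times the profile with neck radius 1 for [m = c a^2].  So only the
    one-parameter family of unit profiles near the catenoid [m = 0] matters.
    With [cos theta], [sin theta] and [1 / rho] as extra unknowns the system is
    polynomial; the derivative in [m] of a family of solutions of a polynomial
    system solves, together with the family, a polynomial system again, so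
    Gronwall estimates for difference quotients give smoothness by induction.

    Along a unit profile close to the catenoid [theta' < 0], hence [|x|^2]
    increases and [Q = rho sin theta - z cos theta] decreases from 1.  The unique
    zero [sigma m] of [Q] and the size [M m = |x|^2] there depend smoothly on [m], and
    [a] is a shooting root iff [a^2 M (c a^2) = R^2], which the implicit function
    theorem solves near the catenoid neck [c = 0], [a = a_0].

    The principal curvatures are [theta'] and [sin theta / rho], with sum [c Q].
    For [k = Q sin theta / rho] the difference of the two sides of the pinching
    inequality is [2 (k - 1) (k + 1 - c Q^2)], and [0 <= k <= 1] with [k = 1]
    only at the neck, because [k = sin^2 theta - z sin theta cos theta / rho]. *)

Require Import Defs.
From Stdlib Require Import Reals Lra Lia List ClassicalEpsilon.
From Coquelicot Require Import Coquelicot.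
Open Scope R_scope.

(** * C^k functions on open sets of the plane *)

(** The profile of the statement is an [epsilon]-choice among maximal solutions, with a one-sided
    derivative at 0. Nothing can be computed from it directly: it is reached only through
    uniqueness, so every shooting fact is proved for constructed unit profiles on a fixed window
    [|t| < T] and then transferred. The window has to contain the exit from the ball. In arclength
    the unit catenoid is [(cosh t, t)] at [sinh t], so its orthogonal exit is at [sinh t_star], and
    [T = sinh t_star + 2] leaves a margin. Unit profiles are built for [m] of both signs, because
    smoothness of the family at [c = 0] asks for an extension past 0. Uniqueness in (iv) concerns
    all roots near [a_0], whatever their exit time; it rests on an a priori bound for that time. For
    polynomial fields the difference of two values is exactly linear in the difference of the
    arguments ([slope]), so Lipschitz and second-order constants come from recursion on the syntax.
    Besides [theta' < 0] on the window, smallness of [m] has a second use: [|m| < 1/2] gives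
    [c Q^2 < 1], which makes the factor [k + 1 - c Q^2] positive. *)

Ltac split4 := split; [|split; [|split]].

Lemma is_derive_Rplus (f g : R -> R) (x a b : R) :
  is_derive f x a -> is_derive g x b -> is_derive (fun t => f t + g t) x (a + b).
Proof. exact (is_derive_plus f g x a b). Qed.

Lemma is_derive_Rmult (f g : R -> R) (x a b : R) :
  is_derive f x a -> is_derive g x b ->
  is_derive (fun t => f t * g t) x (a * g x + f x * b).
Proof. intros Hf Hg; exact (is_derive_mult f g x a b Hf Hg Rmult_comm). Qed.

Lemma is_derive_Rcomp (f g : R -> R) (x a b : R) :
  is_derive f (g x) a -> is_derive g x b -> is_derive (fun t => f (g t)) x (a * b).
Proof.
  intros Hf Hg; rewrite Rmult_comm; exact (is_derive_comp f g x a b Hf Hg).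
Qed.

Lemma is_derive_reflect (f : R -> R) (x l : R) :
  is_derive f (- x) l -> is_derive (fun t => f (- t)) x (- l).
Proof.
  intros H; replace (- l) with (l * -1) by ring.
  apply (is_derive_Rcomp f (fun t => - t)); trivial; auto_derive; trivial; ring.
Qed.

Lemma is_derive_eq (f : R -> R) (x a b : R) : is_derive f x a -> a = b -> is_derive f x b.
Proof. now intros H <-. Qed.

Definition open2 (U : R -> R -> Prop) : Prop := forall x y, U x y -> locally_2d U x y.

(** Partial derivatives are existential witnesses rather than [Derive], so that each closure lemma
    exhibits a formula for them. Continuity is demanded at every order, which is what combines the
    partials into a total derivative. *)
Fixpoint Ck (k : nat) (U : R -> R -> Prop) (f : R -> R -> R) : Prop :=
  (forall x y, U x y -> continuity_2d_pt f x y) /\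
  match k with
  | O => True
  | S k => exists fx fy,
      (forall x y, U x y -> is_derive (fun t => f t y) x (fx x y)) /\
      (forall x y, U x y -> is_derive (fun t => f x t) y (fy x y)) /\
      Ck k U fx /\ Ck k U fy
  end.

Definition smooth2 (U : R -> R -> Prop) (f : R -> R -> R) : Prop := forall k, Ck k U f.

Lemma Ck_cont k U f x y : Ck k U f -> U x y -> continuity_2d_pt f x y.
Proof. destruct k; intros [H _]; apply H. Qed.

Lemma Ck_pred k : forall U f, Ck (S k) U f -> Ck k U f.
Proof.
  induction k as [|k IH]; intros U f [Hc [fx [fy [H1 [H2 [H3 H4]]]]]]; split; trivial.
  exists fx, fy; auto.
Qed.

Lemma Ck_subset k : forall (U V : R -> R -> Prop) f,
  (forall x y, V x y -> U x y) -> Ck k U f -> Ck k V f.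
Proof.
  induction k as [|k IH]; intros U V f HV [Hc Hd]; split; auto.
  destruct Hd as [fx [fy [H1 [H2 [H3 H4]]]]].
  exists fx, fy; split4; eauto.
Qed.

Lemma Ck_ext k (U : R -> R -> Prop) f g : open2 U ->
  (forall x y, U x y -> f x y = g x y) -> Ck k U f -> Ck k U g.
Proof.
  intros HU E Hf.
  assert (EL : forall x y, U x y -> locally_2d (fun u v => f u v = g u v) x y).
  { intros x y H; generalize (HU x y H); apply locally_2d_impl.
    apply locally_2d_forall; intros u v; apply E. }
  destruct k as [|k]; destruct Hf as [Hc Hd]; split; trivial.
  1,2: intros x y H; eapply continuity_2d_pt_ext_loc; [now apply EL | now apply Hc].
  destruct Hd as [fx [fy [H1 [H2 [H3 H4]]]]].
  exists fx, fy; split4; trivial; intros x y H.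
  - apply (is_derive_ext_loc (fun t => f t y)); auto.
    exact (locally_2d_1d_const_y _ _ _ (EL x y H)).
  - apply (is_derive_ext_loc (fun t => f x t)); auto.
    exact (locally_2d_1d_const_x _ _ _ (EL x y H)).
Qed.

Lemma Ck_const k U (c : R) : Ck k U (fun _ _ => c).
Proof.
  revert c; induction k as [|k IH]; intros c; split; trivial;
    try (intros x y _; apply continuity_2d_pt_const).
  exists (fun _ _ => 0), (fun _ _ => 0); split4; trivial; intros x y _;
    apply (is_derive_const (V := R_NormedModule)).
Qed.

Lemma Ck_fst k U : Ck k U (fun x _ => x).
Proof.
  destruct k as [|k]; split; trivial; try (intros x y _; apply continuity_2d_pt_id1).
  exists (fun _ _ => 1), (fun _ _ => 0); split4; try apply Ck_const; intros x y _.
  - apply (is_derive_id (K := R_AbsRing)).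
  - apply (is_derive_const (V := R_NormedModule)).
Qed.

Lemma Ck_snd k U : Ck k U (fun _ y => y).
Proof.
  destruct k as [|k]; split; trivial; try (intros x y _; apply continuity_2d_pt_id2).
  exists (fun _ _ => 0), (fun _ _ => 1); split4; try apply Ck_const; intros x y _.
  - apply (is_derive_const (V := R_NormedModule)).
  - apply (is_derive_id (K := R_AbsRing)).
Qed.

Lemma Ck_plus k : forall U f g, Ck k U f -> Ck k U g -> Ck k U (fun x y => f x y + g x y).
Proof.
  induction k as [|k IH]; intros U f g [Hc Hd] [Hc' Hd']; split; trivial;
    try (intros x y H; apply continuity_2d_pt_plus; auto).
  destruct Hd as [fx [fy [H1 [H2 [H3 H4]]]]].
  destruct Hd' as [gx [gy [I1 [I2 [I3 I4]]]]].
  exists (fun x y => fx x y + gx x y), (fun x y => fy x y + gy x y).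
  split4; auto; intros x y H.
  - apply (is_derive_Rplus (fun t => f t y) (fun t => g t y)); auto.
  - apply (is_derive_Rplus (fun t => f x t) (fun t => g x t)); auto.
Qed.

Lemma Ck_mult k : forall U f g, Ck k U f -> Ck k U g -> Ck k U (fun x y => f x y * g x y).
Proof.
  induction k as [|k IH]; intros U f g Hf Hg;
    (split; [intros x y H; apply continuity_2d_pt_mult; eapply Ck_cont; eauto|]); trivial.
  assert (Hf' := Ck_pred _ _ _ Hf); assert (Hg' := Ck_pred _ _ _ Hg).
  destruct Hf as [_ [fx [fy [H1 [H2 [H3 H4]]]]]].
  destruct Hg as [_ [gx [gy [I1 [I2 [I3 I4]]]]]].
  exists (fun x y => fx x y * g x y + f x y * gx x y),
         (fun x y => fy x y * g x y + f x y * gy x y).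
  split; [|split; [|split; apply Ck_plus; apply IH; assumption]]; intros x y H.
  - apply (is_derive_Rmult (fun t => f t y) (fun t => g t y)); auto.
  - apply (is_derive_Rmult (fun t => f x t) (fun t => g x t)); auto.
Qed.

Lemma Ck_pow k U f n : Ck k U f -> Ck k U (fun x y => f x y ^ n).
Proof.
  intros Hf; induction n as [|n IH]; simpl; [apply Ck_const|now apply Ck_mult].
Qed.

Lemma Ck_opp k U f : Ck k U f -> Ck k U (fun x y => - f x y).
Proof.
  destruct k as [|k]; intros [Hc Hd]; (split; [intros x y H; apply continuity_2d_pt_opp; auto|]); trivial.
  destruct Hd as [fx [fy [H1 [H2 [H3 H4]]]]].
  exists (fun x y => -1 * fx x y), (fun x y => -1 * fy x y).
  split; [|split; [|split; apply Ck_mult; trivial; apply Ck_const]]; intros x y H.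
  - eapply is_derive_eq; [apply (is_derive_opp (fun t => f t y)); auto|].
    unfold opp; simpl; ring.
  - eapply is_derive_eq; [apply (is_derive_opp (fun t => f x t)); auto|].
    unfold opp; simpl; ring.
Qed.

Lemma Ck_minus k U f g : Ck k U f -> Ck k U g -> Ck k U (fun x y => f x y - g x y).
Proof. intros Hf Hg; apply Ck_plus; [|apply Ck_opp]; assumption. Qed.

Lemma Ck_inv k : forall (U : R -> R -> Prop) f, (forall x y, U x y -> f x y <> 0) ->
  Ck k U f -> Ck k U (fun x y => / f x y).
Proof.
  induction k as [|k IH]; intros U f N Hf;
    (split; [intros x y H; apply continuity_2d_pt_inv; auto; eapply Ck_cont; eauto|]); trivial.
  assert (Hi := IH U f N (Ck_pred _ _ _ Hf)).
  destruct Hf as [_ [fx [fy [H1 [H2 [H3 H4]]]]]].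
  exists (fun x y => - fx x y * (/ f x y * / f x y)),
         (fun x y => - fy x y * (/ f x y * / f x y)).
  split; [|split; [|split; apply Ck_mult; try apply Ck_opp; try apply Ck_mult; assumption]];
    intros x y H.
  - eapply is_derive_eq; [apply (is_derive_inv (fun t => f t y)); auto|].
    field; auto.
  - eapply is_derive_eq; [apply (is_derive_inv (fun t => f x t)); auto|].
    field; auto.
Qed.

(** Total differentiability holds as soon as one partial derivative exists near the point and is
    continuous there, while the other exists at the point; hence only [fx] is assumed regular. *)
Lemma Ck_differentiable k U f x y fx fy : open2 U -> U x y ->
  (forall x y, U x y -> is_derive (fun t => f t y) x (fx x y)) ->
  (forall x y, U x y -> is_derive (fun t => f x t) y (fy x y)) ->
  Ck k U fx -> differentiable_pt_lim f x y (fx x y) (fy x y).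
Proof.
  intros HU H H1 H2 H3.
  apply filterdiff_differentiable_pt_lim.
  apply (is_derive_filterdiff f x y fx (fy x y)).
  - apply (locally_2d_locally (fun u v => is_derive (fun z => f z v) u (fx u v))).
    generalize (HU x y H); apply locally_2d_impl, locally_2d_forall; auto.
  - auto.
  - apply continuity_2d_pt_filterlim; eapply Ck_cont; eauto.
Qed.

Lemma continuity_2d_pt_comp (f g1 g2 : R -> R -> R) (x y : R) :
  continuity_2d_pt f (g1 x y) (g2 x y) ->
  continuity_2d_pt g1 x y -> continuity_2d_pt g2 x y ->
  continuity_2d_pt (fun u v => f (g1 u v) (g2 u v)) x y.
Proof.
  intros Hf H1 H2; apply continuity_2d_pt_filterlim.
  apply (continuous_comp_2 (fun z : R * R => g1 (fst z) (snd z))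
           (fun z : R * R => g2 (fst z) (snd z)) f (x, y)).
  - now apply continuity_2d_pt_filterlim.
  - now apply continuity_2d_pt_filterlim.
  - now apply continuity_2d_pt_filterlim.
Qed.

Lemma Ck_comp k : forall (U V : R -> R -> Prop) f g1 g2, open2 U ->
  (forall x y, V x y -> U (g1 x y) (g2 x y)) ->
  Ck k U f -> Ck k V g1 -> Ck k V g2 -> Ck k V (fun x y => f (g1 x y) (g2 x y)).
Proof.
  induction k as [|k IH]; intros U V f g1 g2 HU HV Hf Hg1 Hg2;
    (split; [intros x y H; apply continuity_2d_pt_comp; eapply Ck_cont; eauto|]); trivial.
  assert (Hg1' := Ck_pred _ _ _ Hg1); assert (Hg2' := Ck_pred _ _ _ Hg2).
  destruct Hf as [_ [fx [fy [H1 [H2 [H3 H4]]]]]].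
  destruct Hg1 as [_ [g1x [g1y [I1 [I2 [I3 I4]]]]]].
  destruct Hg2 as [_ [g2x [g2y [J1 [J2 [J3 J4]]]]]].
  exists (fun x y => fx (g1 x y) (g2 x y) * g1x x y + fy (g1 x y) (g2 x y) * g2x x y),
         (fun x y => fx (g1 x y) (g2 x y) * g1y x y + fy (g1 x y) (g2 x y) * g2y x y).
  split; [|split; [|split; apply Ck_plus; apply Ck_mult; trivial; apply (IH U); assumption]];
    intros x y H; apply is_derive_Reals;
    apply (derivable_pt_lim_comp_2d f); try (apply is_derive_Reals; auto);
    eapply Ck_differentiable; eauto.
Qed.

(** A function of one variable is carried as a function of two that ignores one of them, so that
    [Ck_comp] serves as the chain rule throughout. The two claims go together because each
    derivative is, up to sign, the other function. *)
Lemma Ck_cos_sin k U : Ck k U (fun _ y => cos y) /\ Ck k U (fun _ y => sin y).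
Proof.
  assert (C : forall (f : R -> R) x y, (forall t, continuity_pt f t) -> continuity_2d_pt (fun _ v => f v) x y).
  { intros f x y Hf; apply (continuity_1d_2d_pt_comp f (fun _ v => v)); auto.
    apply continuity_2d_pt_id2. }
  induction k as [|k [IH1 IH2]]; (split; (split; [intros x y _; apply C; intros t|]); trivial);
    try apply continuity_cos; try apply continuity_sin.
  - exists (fun _ _ => 0), (fun _ y => - sin y).
    split4; try apply Ck_const; try now apply Ck_opp.
    + intros x y _; apply (is_derive_const (V := R_NormedModule)).
    + intros x y _; apply is_derive_cos.
  - exists (fun _ _ => 0), (fun _ y => cos y).
    split4; try apply Ck_const; trivial.
    + intros x y _; apply (is_derive_const (V := R_NormedModule)).
    + intros x y _; apply is_derive_sin.
Qed.

Lemma Ck_ex_diff_n k : forall U f x y, open2 U -> Ck k U f -> U x y -> ex_diff_n f k x y.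
Proof.
  induction k as [|k IH]; intros U f x y HU [Hc Hd] H; (split; [auto|]); trivial.
  destruct Hd as [fx [fy [H1 [H2 [H3 H4]]]]].
  split4.
  - eexists; eauto.
  - eexists; eauto.
  - apply ex_diff_n_ext_loc with fx; [|eauto].
    generalize (HU x y H); apply locally_2d_impl, locally_2d_forall; intros u v Huv.
    symmetry; apply is_derive_unique; auto.
  - apply ex_diff_n_ext_loc with fy; [|eauto].
    generalize (HU x y H); apply locally_2d_impl, locally_2d_forall; intros u v Huv.
    symmetry; apply is_derive_unique; auto.
Qed.

(** The witness for the derivative may formally depend on the ignored variable; freezing that
    variable at 0 returns a function of one variable, to which the induction applies. Order 0 asks
    for nothing, so the induction starts at order 1. *)
Lemma Ck_ex_derive_n (J : R -> Prop) k : forall f x, open J ->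
  Ck k (fun u _ => J u) (fun u _ => f u) -> J x -> ex_derive_n f k x.
Proof.
  destruct k as [|k]; [easy|]; intros f x HJ; revert f.
  induction k as [|k IH]; intros f [Hc [fx [fy [H1 [H2 [H3 H4]]]]]] Hx.
  - exists (fx x 0); auto.
  - assert (Hf' : ex_derive_n (fun u => fx u 0) (S k) x).
    { apply IH; trivial.
      apply Ck_comp with (U := fun u _ => J u) (g1 := fun u _ => u) (g2 := fun _ _ => 0); auto.
      - intros u v Hu; apply locally_2d_locally; generalize (HJ u Hu).
        intros [d Hd]; exists d; intros z [Hz _]; now apply Hd.
      - apply Ck_fst.
      - apply Ck_const. }
    simpl in Hf' |- *.
    apply ex_derive_ext_loc with (Derive_n (fun u => fx u 0) k); trivial.
    assert (HJx := HJ x Hx); apply locally_locally in HJx.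
    revert HJx; apply filter_imp; intros t Ht.
    rewrite (Derive_n_ext_loc (fun u => fx u 0) (Derive f)).
    + change (Derive f) with (Derive_n f 1); rewrite Derive_n_comp, Nat.add_comm; reflexivity.
    + revert Ht; apply filter_imp; intros u Hu; symmetry; apply is_derive_unique.
      exact (H1 u 0 Hu).
Qed.

Lemma open2_fst (J : R -> Prop) : open J -> open2 (fun x _ => J x).
Proof.
  intros HJ u v Hu; destruct (HJ u Hu) as [d Hd]; exists d; intros; now apply Hd.
Qed.

(** * The implicit function theorem for one unknown *)

Lemma is_derive_implicit (F : R -> R -> R) (g : R -> R) (x lx ly : R) :
  differentiable_pt_lim F x (g x) lx ly -> ly <> 0 ->
  continuous g x -> locally x (fun u => F u (g u) = 0) ->
  is_derive g x (- lx / ly).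
Proof.
  intros HF Hly Hg HZ.
  assert (H0 : F x (g x) = 0) by (apply (locally_singleton _ _ HZ)).
  assert (Pl : 0 < Rabs ly) by now apply Rabs_pos_lt.
  set (m := Rabs (lx / ly)).
  assert (Pm : 0 <= m) by apply Rabs_pos.
  apply is_derive_Reals; intros e He.
  (* With [D] the increment of [g], the linearization error is at most [k |ly| max(|h|, |D|)]. The
     bound [k <= 1/2] absorbs [|D|] and gives [|D| <= (2 m + 1) |h|]; the second bound on [k] makes
     the resulting error [k (2 m + 2) |h|] smaller than [e |h|]. *)
  set (k := Rmin (/ 2) (e / (2 * (m + 2)))).
  assert (Pk : 0 < k).
  { apply Rmin_pos; [lra|]; apply Rdiv_lt_0_compat; lra. }
  assert (Pe : 0 < k * Rabs ly) by nra.
  destruct (HF (mkposreal _ Pe)) as [d Hd]; simpl in Hd.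
  destruct HZ as [d1 Hd1].
  apply (filterlim_locally g (g x)) with (eps := d) in Hg.
  destruct Hg as [d2 Hd2].
  assert (P : 0 < Rmin d (Rmin d1 d2)).
  { repeat apply Rmin_pos; apply cond_pos. }
  exists (mkposreal _ P); intros h Hh0 Hh; simpl in Hh.
  assert (A1 : Rabs h < d) by (eapply Rlt_le_trans; [exact Hh|apply Rmin_l]).
  assert (A2 : Rabs h < d1).
  { eapply Rlt_le_trans; [exact Hh|]; eapply Rle_trans; [apply Rmin_r|apply Rmin_l]. }
  assert (A3 : Rabs h < d2).
  { eapply Rlt_le_trans; [exact Hh|]; eapply Rle_trans; [apply Rmin_r|apply Rmin_r]. }
  assert (B : forall r : R, Rabs h < r -> ball x r (x + h)).
  { intros r Hr; unfold ball; simpl; unfold AbsRing_ball, abs, minus, plus, opp; simpl.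
    now replace (x + h + - x) with h by ring. }
  specialize (Hd (x + h) (g (x + h))).
  replace (x + h - x) with h in Hd by ring.
  specialize (Hd A1 (Hd2 _ (B _ A3))).
  rewrite (Hd1 _ (B _ A2)), H0 in Hd.
  set (D := g (x + h) - g x) in *.
  assert (E1 : Rabs (D + lx / ly * h) <= k * Rmax (Rabs h) (Rabs D)).
  { apply Rmult_le_reg_r with (Rabs ly); trivial.
    rewrite <- Rabs_mult.
    replace ((D + lx / ly * h) * ly) with (- (0 - 0 - (lx * h + ly * D))) by (field; trivial).
    rewrite Rabs_Ropp; eapply Rle_trans; [exact Hd|]; right; ring. }
  assert (E2 : Rmax (Rabs h) (Rabs D) <= Rabs h + Rabs D).
  { apply Rmax_lub; generalize (Rabs_pos h) (Rabs_pos D); lra. }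
  assert (K1 : k <= / 2) by apply Rmin_l.
  assert (K2 : k <= e / (2 * (m + 2))) by apply Rmin_r.
  assert (Ph : 0 < Rabs h) by now apply Rabs_pos_lt.
  assert (E3 : Rabs D <= Rabs (D + lx / ly * h) + m * Rabs h).
  { unfold m; rewrite <- Rabs_mult.
    replace D with ((D + lx / ly * h) + - (lx / ly * h)) at 1 by ring.
    eapply Rle_trans; [apply Rabs_triang|]; rewrite Rabs_Ropp; lra. }
  assert (E4 : Rabs D <= (2 * m + 1) * Rabs h).
  { generalize (Rabs_pos D); nra. }
  assert (E5 : Rabs (D + lx / ly * h) <= k * ((2 * m + 2) * Rabs h)).
  { eapply Rle_trans; [exact E1|]; apply Rmult_le_compat_l; lra. }
  replace (D / h - - lx / ly) with ((D + lx / ly * h) * / h)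
    by (field; auto).
  rewrite Rabs_mult, Rabs_inv.
  apply Rmult_lt_reg_r with (Rabs h); trivial.
  rewrite Rmult_assoc, Rinv_l, Rmult_1_r by lra.
  eapply Rle_lt_trans; [exact E5|].
  assert (k * (2 * (m + 2)) <= e).
  { apply Rmult_le_reg_r with (/ (2 * (m + 2))); [apply Rinv_0_lt_compat; lra|].
    rewrite Rmult_assoc, Rinv_r, Rmult_1_r by lra; exact K2. }
  nra.
Qed.

(** Bootstrap: the derivative of [g] is [- fx / fy] along its graph, an expression as regular as [g]
    itself, so each order of regularity yields the next; continuity starts the induction. *)
Lemma Ck_implicit (J : R -> Prop) (U : R -> R -> Prop) (F : R -> R -> R) (g : R -> R) :
  open J -> open2 U -> smooth2 U F ->
  (forall x, J x -> U x (g x) /\ F x (g x) = 0 /\ continuous g x /\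
     exists d, d <> 0 /\ is_derive (F x) (g x) d) ->
  smooth2 (fun x _ => J x) (fun x _ => g x).
Proof.
  intros HJ HU HF Hg.
  assert (C : forall x y, J x -> continuity_2d_pt (fun u _ => g u) x y).
  { intros x y Hx; apply (continuity_1d_2d_pt_comp g (fun u _ => u)).
    - apply continuity_pt_filterlim; now apply Hg.
    - apply continuity_2d_pt_id1. }
  intros k; induction k as [|k IH]; [now split|].
  destruct (HF (S k)) as [_ [fx [fy [H1 [H2 [H3 H4]]]]]].
  assert (N : forall x, J x -> fy x (g x) <> 0).
  { intros x Hx; destruct (Hg x Hx) as [Ux [_ [_ [d [Hd Dd]]]]].
    rewrite <- (is_derive_unique (F x) _ _ (H2 _ _ Ux)).
    now rewrite (is_derive_unique (F x) _ _ Dd). }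
  split; [now auto|].
  exists (fun x _ => - fx x (g x) * / fy x (g x)), (fun _ _ => 0).
  split4.
  - intros x _ Hx; destruct (Hg x Hx) as [Ux [_ [Cx _]]].
    apply (is_derive_implicit F); auto.
    + eapply Ck_differentiable; eauto.
    + generalize (HJ x Hx); apply filter_imp; intros u Hu; now apply Hg.
  - intros; apply (is_derive_const (V := R_NormedModule)).
  - assert (B : forall f, Ck k U f -> Ck k (fun x _ => J x) (fun x _ => f x (g x))).
    { intros f Hf; apply (Ck_comp k U _ f (fun x _ => x) (fun x _ => g x)); trivial.
      - intros x _ Hx; now apply Hg.
      - apply Ck_fst. }
    apply Ck_mult; [apply Ck_opp; auto|].
    apply Ck_inv; auto.
  - apply Ck_const.
Qed.

(** * Polynomial vector fields *)

(** A syntax for polynomials makes differentials and divided differences structural recursions. The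
    index type stays arbitrary because the variational system of a system over [I] has unknowns
    [I + I], and this doubling is iterated. *)
Inductive expr (I : Type) : Type :=
| Cst (r : R)
| Var (i : I)
| Add (a b : expr I)
| Mul (a b : expr I).
Arguments Cst {I} r.
Arguments Var {I} i.
Arguments Add {I} a b.
Arguments Mul {I} a b.

Fixpoint eval {I : Type} (e : expr I) (y : I -> R) : R :=
  match e with
  | Cst r => r
  | Var i => y i
  | Add a b => eval a y + eval b y
  | Mul a b => eval a y * eval b y
  end.

(* Linear in [w], with [eval e y' - eval e y = slope e y y' (y' - y)]; on the
   diagonal [y' = y] it is the differential of [e] at [y] applied to [w]. *)
Fixpoint slope {I : Type} (e : expr I) (y y' w : I -> R) : R :=
  match e with
  | Cst _ => 0
  | Var i => w i
  | Add a b => slope a y y' w + slope b y y' w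
  | Mul a b => slope a y y' w * eval b y' + eval a y * slope b y y' w
  end.

Fixpoint lift {I : Type} (e : expr I) : expr (I + I) :=
  match e with
  | Cst r => Cst r
  | Var i => Var (inl i)
  | Add a b => Add (lift a) (lift b)
  | Mul a b => Mul (lift a) (lift b)
  end.

Fixpoint diff {I : Type} (e : expr I) : expr (I + I) :=
  match e with
  | Cst _ => Cst 0
  | Var i => Var (inr i)
  | Add a b => Add (diff a) (diff b)
  | Mul a b => Add (Mul (diff a) (lift b)) (Mul (lift a) (diff b))
  end.

Definition join {I : Type} (y v : I -> R) (k : I + I) : R :=
  match k with inl i => y i | inr i => v i end.

Section Expr.
Context {I : Type}.
Implicit Types (e : expr I) (y w : I -> R).

Lemma eval_lift e y v : eval (lift e) (join y v) = eval e y.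
Proof. induction e; simpl; congruence. Qed.

Lemma eval_diff e y v : eval (diff e) (join y v) = slope e y y v.
Proof. induction e; simpl; rewrite ?eval_lift; congruence. Qed.

Lemma eval_slope e y y' : eval e y' - eval e y = slope e y y' (fun i => y' i - y i).
Proof. induction e; simpl; rewrite <- ?IHe1, <- ?IHe2; ring. Qed.

Lemma slope_lin e y y' w w' (a b : R) :
  slope e y y' (fun i => a * w i + b * w' i) = a * slope e y y' w + b * slope e y y' w'.
Proof. induction e; simpl; rewrite ?IHe1, ?IHe2; ring. Qed.

Lemma eval_bound e (K : R) :
  exists B, 0 <= B /\ forall y, (forall i, Rabs (y i) <= K) -> Rabs (eval e y) <= B.
Proof.
  induction e as [r|i|a [A [PA HA]] b [B [PB HB]]|a [A [PA HA]] b [B [PB HB]]]; simpl.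
  - exists (Rabs r); split; [apply Rabs_pos|intros; lra].
  - exists (Rmax 0 K); split; [apply Rmax_l|].
    intros y Hy; eapply Rle_trans; [apply Hy|apply Rmax_r].
  - exists (A + B); split; [lra|]; intros y Hy.
    eapply Rle_trans; [apply Rabs_triang|]; generalize (HA y Hy) (HB y Hy); lra.
  - exists (A * B); split; [nra|]; intros y Hy; rewrite Rabs_mult.
    apply Rmult_le_compat; try apply Rabs_pos; auto.
Qed.

Lemma slope_bound e (K : R) :
  exists L, 0 <= L /\ forall y y' w W, (forall i, Rabs (y i) <= K) ->
    (forall i, Rabs (y' i) <= K) -> (forall i, Rabs (w i) <= W) -> 0 <= W ->
    Rabs (slope e y y' w) <= L * W.
Proof.
  induction e as [r|i|a [A [PA HA]] b [B [PB HB]]|a [A [PA HA]] b [B [PB HB]]]; simpl.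
  - exists 0; split; [lra|]; intros; rewrite Rabs_R0; lra.
  - exists 1; split; [lra|]; intros; rewrite Rmult_1_l; auto.
  - exists (A + B); split; [lra|]; intros y y' w W Hy Hy' Hw HW.
    eapply Rle_trans; [apply Rabs_triang|].
    generalize (HA y y' w W Hy Hy' Hw HW) (HB y y' w W Hy Hy' Hw HW); lra.
  - destruct (eval_bound a K) as [A' [PA' HA']]; destruct (eval_bound b K) as [B' [PB' HB']].
    exists (A * B' + A' * B); split; [nra|]; intros y y' w W Hy Hy' Hw HW.
    eapply Rle_trans; [apply Rabs_triang|]; rewrite !Rabs_mult.
    assert (H1 := Rmult_le_compat _ _ _ _ (Rabs_pos _) (Rabs_pos _)
                    (HA y y' w W Hy Hy' Hw HW) (HB' y' Hy')).
    assert (H2 := Rmult_le_compat _ _ _ _ (Rabs_pos _) (Rabs_pos _)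
                    (HA' y Hy) (HB y y' w W Hy Hy' Hw HW)).
    lra.
Qed.

(** Second-order estimate. With [w] a difference quotient and [D] the size of the increment, it
    bounds the defect between the equation of the quotient and the variational equation. *)
Lemma slope_cont e (K : R) :
  exists C, 0 <= C /\ forall y y' w D W, (forall i, Rabs (y i) <= K) ->
    (forall i, Rabs (y' i) <= K) -> (forall i, Rabs (y' i - y i) <= D) -> 0 <= D ->
    (forall i, Rabs (w i) <= W) -> 0 <= W ->
    Rabs (slope e y y' w - slope e y y w) <= C * (D * W).
Proof.
  induction e as [r|i|a [A [PA HA]] b [B [PB HB]]|a [A [PA HA]] b [B [PB HB]]]; simpl.
  - exists 0; split; [lra|]; intros; rewrite Rminus_diag, Rabs_R0; lra.
  - exists 0; split; [lra|]; intros; rewrite Rminus_diag, Rabs_R0; lra.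
  - exists (A + B); split; [lra|]; intros y y' w D W Hy Hy' HD PD HW PW.
    replace (_ - _) with ((slope a y y' w - slope a y y w) + (slope b y y' w - slope b y y w))
      by ring.
    eapply Rle_trans; [apply Rabs_triang|].
    generalize (HA y y' w D W Hy Hy' HD PD HW PW) (HB y y' w D W Hy Hy' HD PD HW PW); lra.
  - destruct (eval_bound a K) as [A' [PA' HA']]; destruct (eval_bound b K) as [B' [PB' HB']].
    destruct (slope_bound a K) as [A'' [PA'' HA'']].
    destruct (slope_bound b K) as [B'' [PB'' HB'']].
    exists (A * B' + A'' * B'' + A' * B); split; [nra|]; intros y y' w D W Hy Hy' HD PD HW PW.
    replace (_ - _) with ((slope a y y' w - slope a y y w) * eval b y' +
      slope a y y w * (eval b y' - eval b y) +
      eval a y * (slope b y y' w - slope b y y w)) by ring.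
    eapply Rle_trans; [apply Rabs_triang|].
    eapply Rle_trans; [apply Rplus_le_compat_r, Rabs_triang|]; rewrite !Rabs_mult.
    assert (H1 := Rmult_le_compat _ _ _ _ (Rabs_pos _) (Rabs_pos _)
                    (HA y y' w D W Hy Hy' HD PD HW PW) (HB' y' Hy')).
    assert (H2 := Rmult_le_compat _ _ _ _ (Rabs_pos _) (Rabs_pos _)
                    (HA' y Hy) (HB y y' w D W Hy Hy' HD PD HW PW)).
    assert (H3 : Rabs (eval b y' - eval b y) <= B'' * D)
      by (rewrite eval_slope; now apply HB'').
    assert (H4 := Rmult_le_compat _ _ _ _ (Rabs_pos _) (Rabs_pos _)
                    (HA'' y y w W Hy Hy HW PW) H3).
    lra.
Qed.

Lemma continuous_eval e (Y : R -> I -> R) (t : R) :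
  (forall i, continuous (fun s => Y s i) t) -> continuous (fun s => eval e (Y s)) t.
Proof.
  intros HY; induction e; simpl.
  - apply continuous_const.
  - apply HY.
  - now apply (continuous_plus (fun s => eval e1 (Y s)) (fun s => eval e2 (Y s))).
  - now apply (continuous_mult (fun s => eval e1 (Y s)) (fun s => eval e2 (Y s))).
Qed.

Lemma continuous_slope e (Y V : R -> I -> R) (t : R) :
  (forall i, continuous (fun s => Y s i) t) -> (forall i, continuous (fun s => V s i) t) ->
  continuous (fun s => slope e (Y s) (Y s) (V s)) t.
Proof.
  intros HY HV; apply (continuous_ext (fun s => eval (diff e) (join (Y s) (V s)))).
  - intros s; apply eval_diff.
    generalize (diff e); intros d; induction d as [r|[i|i]|d1 IH1 d2 IH2|d1 IH1 d2 IH2]; simpl; auto.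
    + apply continuous_const.
    + now apply (continuous_plus (fun s => eval d1 (join (Y s) (V s)))
                   (fun s => eval d2 (join (Y s) (V s)))).
    + now apply (continuous_mult (fun s => eval d1 (join (Y s) (V s)))
                   (fun s => eval d2 (join (Y s) (V s)))).
Qed.

Lemma Ck_eval e k U (Y : R -> R -> I -> R) :
  (forall i, Ck k U (fun m t => Y m t i)) -> Ck k U (fun m t => eval e (Y m t)).
Proof.
  intros HY; induction e; simpl; auto using Ck_const, Ck_plus, Ck_mult.
Qed.

End Expr.

Lemma list_uniform {I : Type} (l : list I) (P : I -> R -> Prop) :
  (forall i a b, P i a -> a <= b -> P i b) -> (forall i, exists a, 0 <= a /\ P i a) ->
  exists a, 0 <= a /\ forall i, In i l -> P i a.
Proof.
  intros M H; induction l as [|i l [a [Pa Ha]]].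
  - exists 0; split; [lra|easy].
  - destruct (H i) as [b [Pb Hb]]; exists (a + b); split; [lra|].
    intros j [<-|Hj]; [apply M with b|apply M with a]; auto; lra.
Qed.

(** * Gronwall estimates for finite systems *)

Section Gronwall.
Context {I : Type} (l : list I).
Hypothesis Hl : forall i, In i l.

Definition lsum (f : I -> R) : R := fold_right (fun i s => f i + s) 0 l.

Lemma is_derive_lsum (f df : R -> I -> R) (t : R) :
  (forall i, is_derive (fun s => f s i) t (df t i)) ->
  is_derive (fun s => lsum (f s)) t (lsum (df t)).
Proof.
  intros H; unfold lsum; clear Hl; induction l as [|i l' IH]; simpl.
  - apply (is_derive_const (V := R_NormedModule)).
  - apply (is_derive_Rplus (fun s => f s i)); auto.
Qed.

Lemma lsum_le (f : I -> R) (B : R) :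
  (forall i, f i <= B) -> lsum f <= INR (length l) * B.
Proof.
  intros H; unfold lsum; clear Hl; induction l as [|i l' IH]; simpl; [lra|].
  specialize (H i); destruct l' as [|]; simpl in *; lra.
Qed.

Lemma le_lsum (f : I -> R) (i : I) : (forall j, 0 <= f j) -> f i <= lsum f.
Proof.
  intros H; unfold lsum; generalize (Hl i); clear Hl.
  assert (P : forall l', 0 <= fold_right (fun i s => f i + s) 0 l').
  { induction l' as [|j l' IH]; simpl; [lra|]; generalize (H j); lra. }
  induction l as [|j l' IH]; simpl; [easy|].
  intros [<-|Hi]; [generalize (P l')|generalize (H j) (IH Hi)]; lra.
Qed.

Lemma nonincreasing (h dh : R -> R) (t : R) : 0 <= t ->
  (forall s, 0 <= s <= t -> is_derive h s (dh s) /\ dh s <= 0) -> h t <= h 0.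
Proof.
  intros Ht H.
  destruct (MVT_gen h 0 t dh) as [c [Hc E]]; rewrite ?Rmin_left, ?Rmax_right in * by lra.
  - intros x Hx; apply H; lra.
  - intros x Hx; apply continuity_pt_filterlim.
    apply (ex_derive_continuous (V := R_NormedModule) h); exists (dh x); apply H; lra.
  - destruct (H c Hc) as [_ Hd]; nra.
Qed.

(** The sum of squares [E] is differentiable, unlike the maximum of the components. With
    [q = sqrt E] one has [2 q (L q + eps) <= (2 L + 1) (q^2 + eps^2)], so [E + eps^2] grows at most
    like [exp (C t)]; adding [eps^2] makes the differential inequality homogeneous. *)
Lemma gronwall_energy (L t A eps : R) (u du : R -> I -> R) :
  0 <= L -> 0 <= t -> 0 <= eps ->
  (forall s i, 0 <= s <= t -> is_derive (fun s => u s i) s (du s i)) ->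
  (forall s D, 0 <= s <= t -> (forall i, Rabs (u s i) <= D) ->
     forall i, Rabs (du s i) <= L * D + eps) ->
  (forall i, Rabs (u 0 i) <= A) -> 0 <= A ->
  let n := INR (length l) in
  forall i, u t i ^ 2 <= (n * A ^ 2 + eps ^ 2) * exp (n * (2 * L + 1) * t).
Proof.
  intros PL Pt Pe Hd HL H0 PA n i.
  set (E s := lsum (fun i => u s i ^ 2)).
  set (C := n * (2 * L + 1)).
  assert (Pn : 0 <= n) by apply pos_INR.
  assert (PE : forall s i, u s i ^ 2 <= E s).
  { intros s j; apply (le_lsum (fun j => u s j ^ 2)); intros; apply pow2_ge_0. }
  assert (PE0 : forall s, 0 <= E s).
  { intros s; eapply Rle_trans; [|apply (PE s i)]; apply pow2_ge_0. }
  assert (Hu : forall s j, Rabs (u s j) <= sqrt (E s)).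
  { intros s j; rewrite <- sqrt_Rsqr_abs; apply sqrt_le_1_alt.
    unfold Rsqr; generalize (PE s j); simpl; lra. }
  set (dE s := lsum (fun i => 2 * u s i * du s i)).
  assert (DE : forall s, 0 <= s <= t -> is_derive E s (dE s)).
  { intros s Hs; apply is_derive_lsum with (df := fun s i => 2 * u s i * du s i); intros j.
    eapply is_derive_eq; [apply (is_derive_pow (fun s => u s j) 2); now apply Hd|].
    simpl; ring. }
  assert (BE : forall s, 0 <= s <= t -> dE s <= C * (E s + eps ^ 2)).
  { intros s Hs; eapply Rle_trans.
    - apply (lsum_le _ (2 * (sqrt (E s) * (L * sqrt (E s) + eps)))); intros j.
      assert (H1 := Rmult_le_compat _ _ _ _ (Rabs_pos _) (Rabs_pos _) (Hu s j)
                      (HL s _ Hs (Hu s) j)).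
      rewrite <- Rabs_mult in H1; generalize (Rle_abs (u s j * du s j)); lra.
    - assert (Sq := sqrt_sqrt (E s) (PE0 s)).
      assert (Ps := sqrt_pos (E s)).
      unfold C; fold n; rewrite Rmult_assoc; apply Rmult_le_compat_l; trivial.
      assert (K1 : 0 <= (sqrt (E s) - eps) ^ 2) by apply pow2_ge_0.
      assert (K2 : 0 <= L * eps ^ 2) by (apply Rmult_le_pos; trivial; apply pow2_ge_0).
      set (q := sqrt (E s)) in *; rewrite <- Sq; clearbody q; clear - K1 K2; nra. }
  assert (M : (E t + eps ^ 2) * exp (- C * t) <= (E 0 + eps ^ 2) * exp (- C * 0)).
  { apply (nonincreasing (fun s => (E s + eps ^ 2) * exp (- C * s))
             (fun s => (dE s - C * (E s + eps ^ 2)) * exp (- C * s))); trivial.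
    intros s Hs; split.
    - eapply is_derive_eq.
      + apply (is_derive_Rmult (fun s => E s + eps ^ 2) (fun s => exp (- C * s)) s (dE s + 0)
                 (- C * exp (- C * s))).
        * apply is_derive_Rplus; auto; apply (is_derive_const (V := R_NormedModule)).
        * auto_derive; trivial; ring.
      + ring.
    - assert (Hx := exp_pos (- C * s)); specialize (BE s Hs); nra. }
  rewrite Rmult_0_r, exp_0, Rmult_1_r in M.
  assert (E0 : E 0 <= n * A ^ 2).
  { apply lsum_le; intros j; rewrite <- (pow2_abs (u 0 j)).
    apply pow_incr; split; [apply Rabs_pos|auto]. }
  assert (Ex : exp (- C * t) * exp (C * t) = 1).
  { rewrite <- exp_plus; replace (- C * t + C * t) with 0 by ring; apply exp_0. }
  assert (Px := exp_pos (C * t)).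
  assert (M' : E t + eps ^ 2 <= (E 0 + eps ^ 2) * exp (C * t)).
  { apply Rmult_le_compat_r with (r := exp (C * t)) in M; [|lra].
    rewrite Rmult_assoc, Ex in M; lra. }
  generalize (PE t i) (pow2_ge_0 eps); nra.
Qed.

(** [G] is chosen before [u]: it depends on [T], [L] and the number of unknowns, so one constant
    serves all parameters and all increments. Negative times follow by reflection. *)
Lemma gronwall (T L : R) : 0 <= L -> 0 < T ->
  exists G, 1 <= G /\ forall (u du : R -> I -> R) A eps, 0 <= A -> 0 <= eps ->
  (forall s i, Rabs s < T -> is_derive (fun s => u s i) s (du s i)) ->
  (forall s D, Rabs s < T -> (forall i, Rabs (u s i) <= D) ->
     forall i, Rabs (du s i) <= L * D + eps) ->
  (forall i, Rabs (u 0 i) <= A) ->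
  forall t i, Rabs t < T -> Rabs (u t i) <= G * (A + eps).
Proof.
  intros PL PT; set (n := INR (length l)).
  assert (Pn : 0 <= n) by apply pos_INR.
  set (C := n * (2 * L + 1)).
  assert (PC : 0 <= C) by (unfold C; nra).
  (* The energy estimate bounds the square by [(n + 1) exp (C T) (A + eps)^2]; as this factor is at
     least 1, its square root may be replaced by the factor itself. *)
  exists ((n + 1) * exp (C * T)).
  assert (Px : 1 <= exp (C * T)).
  { rewrite <- exp_0; destruct (Rle_lt_or_eq_dec 0 (C * T)) as [H|H]; [nra| |].
    - left; now apply exp_increasing.
    - rewrite <- H; lra. }
  split; [nra|].
  assert (Pos : forall (u du : R -> I -> R) A eps, 0 <= A -> 0 <= eps ->
    (forall s i, Rabs s < T -> is_derive (fun s => u s i) s (du s i)) ->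
    (forall s D, Rabs s < T -> (forall i, Rabs (u s i) <= D) ->
       forall i, Rabs (du s i) <= L * D + eps) ->
    (forall i, Rabs (u 0 i) <= A) ->
    forall t i, 0 <= t < T -> Rabs (u t i) <= (n + 1) * exp (C * T) * (A + eps)).
  { intros u du A eps PA Pe Hd HL H0 t i Ht.
    assert (Hs : forall s, 0 <= s <= t -> Rabs s < T).
    { intros s Hs; rewrite Rabs_pos_eq; lra. }
    assert (B := gronwall_energy L t A eps u du PL (proj1 Ht) Pe
      (fun s i H => Hd s i (Hs s H)) (fun s D H => HL s D (Hs s H)) H0 PA i).
    cbv zeta in B; fold n C in B.
    assert (X : exp (C * t) <= exp (C * T)).
    { destruct (Rle_lt_or_eq_dec (C * t) (C * T)) as [H|H]; [nra| |].
      - left; now apply exp_increasing.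
      - rewrite H; lra. }
    apply Rsqr_incr_0_var; [|apply Rmult_le_pos; nra].
    rewrite <- Rsqr_abs; unfold Rsqr.
    assert (0 < exp (C * t)) by apply exp_pos.
    set (x := exp (C * T)) in *.
    assert (H1 : n * A ^ 2 + eps ^ 2 <= (n + 1) * (A + eps) ^ 2).
    { assert (0 <= A * eps) by nra.
      assert (0 <= n * (A * eps)) by nra.
      assert (0 <= eps ^ 2) by apply pow2_ge_0; assert (0 <= A ^ 2) by apply pow2_ge_0.
      assert (0 <= n * eps ^ 2) by nra; nra. }
    assert (H2 : 0 <= (A + eps) ^ 2) by apply pow2_ge_0.
    assert (H3 : u t i ^ 2 <= (n + 1) * (A + eps) ^ 2 * x).
    { eapply Rle_trans; [exact B|].
      assert (0 <= n * A ^ 2 + eps ^ 2).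
      { assert (0 <= eps ^ 2) by apply pow2_ge_0; assert (0 <= A ^ 2) by apply pow2_ge_0; nra. }
      apply Rmult_le_compat; lra. }
    assert (H4 : (n + 1) * (A + eps) ^ 2 * x <= (n + 1) * (A + eps) ^ 2 * x * ((n + 1) * x)).
    { rewrite <- (Rmult_1_r ((n + 1) * (A + eps) ^ 2 * x)) at 1.
      apply Rmult_le_compat_l; [repeat apply Rmult_le_pos; lra|nra]. }
    simpl in H3, H4; lra. }
  intros u du A eps PA Pe Hd HL H0 t i Ht.
  destruct (Rle_dec 0 t) as [P|P].
  - rewrite Rabs_pos_eq in Ht by lra; now apply (Pos u du).
  - rewrite Rabs_left in Ht by lra.
    replace t with (- - t) by ring.
    apply (Pos (fun s => u (- s)) (fun s i => - du (- s) i)); try lra.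
    + intros s j Hs.
      apply is_derive_reflect with (f := fun s => u s j); apply Hd; now rewrite Rabs_Ropp.
    + intros s D Hs HD j; rewrite Rabs_Ropp; apply HL; trivial; now rewrite Rabs_Ropp.
    + now rewrite Ropp_0.
Qed.

End Gronwall.

(** * Picard iteration *)

(** Both [G] and [- G] are compared with [B exp (K s)], a primitive of the bound on [g]. *)
Lemma deriv_compare (G g : R -> R) (B K t : R) :
  (forall s, Rabs s <= Rabs t -> is_derive G s (g s) /\ Rabs (g s) <= B * K * exp (K * Rabs s)) ->
  Rabs (G t - G 0) <= B * (exp (K * Rabs t) - 1).
Proof.
  assert (Pos : forall (G g : R -> R) t, 0 <= t ->
    (forall s, 0 <= s <= t -> is_derive G s (g s) /\ Rabs (g s) <= B * K * exp (K * s)) ->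
    Rabs (G t - G 0) <= B * (exp (K * t) - 1)).
  { clear; intros G g t Pt H.
    assert (D : forall s, is_derive (fun s => B * exp (K * s)) s (B * K * exp (K * s))).
    { intros s; auto_derive; trivial; ring. }
    assert (N : forall c : R, c = 1 \/ c = -1 -> c * (G t - G 0) <= B * (exp (K * t) - 1)).
    { intros c Hc.
      assert (M : c * G t + - (1) * (B * exp (K * t)) <= c * G 0 + - (1) * (B * exp (K * 0))).
      { apply (nonincreasing (fun s => c * G s + - (1) * (B * exp (K * s)))
                 (fun s => c * g s + - (1) * (B * K * exp (K * s)))); trivial.
        intros s Hs; destruct (H s Hs) as [H1 H2]; split.
        - apply (is_derive_Rplus (fun s => c * G s) (fun s => -(1) * (B * exp (K * s))));
            [apply (is_derive_scal G); trivial
            |apply (is_derive_scal (fun s => B * exp (K * s))); trivial].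
        - generalize (Rle_abs (g s)) (Rle_abs (- g s)); rewrite Rabs_Ropp.
          destruct Hc; subst c; lra. }
      rewrite Rmult_0_r, exp_0 in M; lra. }
    apply Rabs_le; generalize (N 1 (or_introl eq_refl)) (N (-1) (or_intror eq_refl)); lra. }
  intros H; destruct (Rle_dec 0 t) as [P|P].
  - rewrite (Rabs_pos_eq t) in * by lra; apply (Pos G g); trivial.
    intros s Hs; specialize (H s); rewrite (Rabs_pos_eq s) in H by lra; apply H; lra.
  - rewrite (Rabs_left t) in * by lra.
    replace (G t) with (G (- - t)) by (f_equal; ring).
    replace (G 0) with (G (- 0)) by (f_equal; ring).
    apply (Pos (fun s => G (- s)) (fun s => - g (- s))); [lra|]; intros s Hs.
    destruct (H (- s)) as [H1 H2]; [rewrite Rabs_Ropp, Rabs_pos_eq; lra|].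
    rewrite Rabs_Ropp, (Rabs_pos_eq s) in H2 by lra.
    split; [now apply is_derive_reflect|now rewrite Rabs_Ropp].
Qed.

Lemma geometric_limit (u : nat -> R) (C : R) :
  (forall n, Rabs (u (S n) - u n) <= C / 2 ^ n) ->
  exists l, forall n, Rabs (u n - l) <= 2 * C / 2 ^ n.
Proof.
  intros H.
  assert (P2 : forall n, 0 < 2 ^ n) by (intros; apply pow_lt; lra).
  assert (PC : 0 <= C).
  { specialize (H 0%nat); simpl in H; generalize (Rabs_pos (u 1%nat - u 0%nat)); lra. }
  (* Keeping the subtracted tail makes the induction on [m] telescope. *)
  assert (D : forall n m, Rabs (u (n + m)%nat - u n) <= 2 * C / 2 ^ n - 2 * C / 2 ^ (n + m)).
  { intros n m; induction m as [|m IH].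
    - rewrite Nat.add_0_r, !Rminus_diag, Rabs_R0; lra.
    - rewrite Nat.add_succ_r; specialize (H (n + m)%nat).
      replace (u (S (n + m)) - u n) with
        ((u (S (n + m)) - u (n + m)%nat) + (u (n + m)%nat - u n)) by ring.
      eapply Rle_trans; [apply Rabs_triang|].
      replace (2 * C / 2 ^ S (n + m)) with (C / 2 ^ (n + m))
        by (simpl; field; apply Rgt_not_eq, P2).
      unfold Rdiv in *; lra. }
  assert (D' : forall n m, Rabs (u (n + m)%nat - u n) <= 2 * C / 2 ^ n).
  { intros n m; eapply Rle_trans; [apply D|].
    assert (0 <= 2 * C / 2 ^ (n + m)) by (apply Rdiv_le_0_compat; [lra|apply P2]); lra. }
  assert (X : ex_finite_lim_seq u).
  { apply ex_lim_seq_cauchy_corr; intros e.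
    assert (L : is_lim_seq (fun n => 2 * C * (/ 2) ^ n) (2 * C * 0)).
    { apply (is_lim_seq_scal_l _ (2 * C) 0); apply is_lim_seq_geom.
      rewrite Rabs_pos_eq; lra. }
    apply is_lim_seq_spec in L; destruct (L (mkposreal _ (is_pos_div_2 e))) as [N HN].
    simpl in HN; specialize (HN N (le_n N)).
    rewrite Rmult_0_r, Rminus_0_r, pow_inv in HN.
    assert (HN' := Rle_lt_trans _ _ _ (Rle_abs _) HN).
    exists N; intros n m Hn Hm.
    replace n with (N + (n - N))%nat by lia; replace m with (N + (m - N))%nat by lia.
    replace (_ - _) with ((u (N + (n - N))%nat - u N) + - (u (N + (m - N))%nat - u N)) by ring.
    eapply Rle_lt_trans; [apply Rabs_triang|]; rewrite Rabs_Ropp.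
    generalize (D' N (n - N)%nat) (D' N (m - N)%nat); unfold Rdiv in *; lra. }
  destruct X as [l Hl]; exists l; intros n.
  rewrite Rabs_minus_sym.
  apply (is_lim_seq_le (fun m => Rabs (u (n + m)%nat - u n)) (fun _ => 2 * C / 2 ^ n)
           (Rabs (l - u n)) (2 * C / 2 ^ n)).
  - intros m; apply D'.
  - apply (is_lim_seq_abs (fun m => u (n + m)%nat - u n) (l - u n)).
    apply (is_lim_seq_minus' _ _ l (u n)); [|apply is_lim_seq_const].
    apply (is_lim_seq_ext (fun m => u (m + n)%nat)); [intros; f_equal; lia|].
    now apply is_lim_seq_incr_n.
  - apply is_lim_seq_const.
Qed.

Section Picard.
Context {I : Type} (T L M : R) (f : R -> (I -> R) -> I -> R) (y0 : I -> R).
Hypothesis PT : 0 < T.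
Hypothesis PL : 0 < L.
Hypothesis Lip : forall t y y' D, Rabs t < T -> (forall i, Rabs (y i - y' i) <= D) ->
  forall i, Rabs (f t y i - f t y' i) <= L * D.
Hypothesis Cont : forall Y : R -> I -> R,
  (forall t i, Rabs t < T -> continuous (fun t => Y t i) t) ->
  forall t i, Rabs t < T -> continuous (fun t => f t (Y t) i) t.
Hypothesis Bound : forall t i, Rabs t < T -> Rabs (f t y0 i) <= M.

Fixpoint picard_iter (n : nat) (t : R) (i : I) : R :=
  match n with
  | O => y0 i
  | S n => y0 i + RInt (fun s => f s (picard_iter n s) i) 0 t
  end.

Lemma between_lt (t s : R) : Rabs t < T -> Rmin 0 t <= s <= Rmax 0 t -> Rabs s < T.
Proof.
  intros Ht; unfold Rmin, Rmax; destruct (Rle_dec 0 t); intros Hs;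
    apply Rabs_def2 in Ht; apply Rabs_def1; lra.
Qed.

Lemma locally_Rabs_lt (t : R) : Rabs t < T -> locally t (fun s => Rabs s < T).
Proof.
  intros Ht; assert (P : 0 < T - Rabs t) by lra; exists (mkposreal _ P); intros s Hs.
  unfold ball in Hs; simpl in Hs; unfold AbsRing_ball, abs, minus, plus, opp in Hs; simpl in Hs.
  replace s with ((s + - t) + t) by ring.
  eapply Rle_lt_trans; [apply Rabs_triang|]; lra.
Qed.

Lemma is_derive_RInt_0 (g : R -> R) (c t : R) :
  (forall s, Rabs s < T -> continuous g s) -> Rabs t < T ->
  is_derive (fun s => c + RInt g 0 s) t (g t).
Proof.
  intros Hg Ht; rewrite <- (Rplus_0_l (g t)).
  apply is_derive_Rplus; [apply (is_derive_const (V := R_NormedModule))|].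
  apply (is_derive_RInt g (RInt g 0) 0 t); [|now apply Hg].
  generalize (locally_Rabs_lt t Ht); apply filter_imp; intros s Hs.
  apply (RInt_correct (V := R_CompleteNormedModule)).
  apply (ex_RInt_continuous (V := R_CompleteNormedModule)); intros r Hr; apply Hg.
  now apply (between_lt s).
Qed.

Lemma is_derive_continuous (g : R -> R) (t l : R) : is_derive g t l -> continuous g t.
Proof. intros H; apply (ex_derive_continuous (V := R_NormedModule)); now exists l. Qed.

Lemma picard_iter_cont n t i : Rabs t < T -> continuous (fun s => picard_iter n s i) t.
Proof.
  revert t i; induction n as [|n IH]; intros t i Ht; simpl; [apply continuous_const|].
  eapply is_derive_continuous, is_derive_RInt_0; eauto.
Qed.

Lemma picard_iter_derive n t i : Rabs t < T ->
  is_derive (fun s => picard_iter (S n) s i) t (f t (picard_iter n t) i).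
Proof.
  intros Ht; apply (is_derive_RInt_0 (fun s => f s (picard_iter n s) i)); trivial.
  intros s Hs; apply Cont; trivial; intros; now apply picard_iter_cont.
Qed.

Lemma picard_iter_0 n i : picard_iter n 0 i = y0 i.
Proof.
  destruct n; simpl; trivial; rewrite RInt_point; unfold zero; simpl; ring.
Qed.

(** This is contraction in Bielecki's weighted norm: integration against [exp (2 L |t|)] gains a
    factor [1 / (2 L)], which halves the distance at each step. The iteration thus converges on the
    whole interval at once, without cutting it into short pieces. *)
Lemma picard_iter_step n t i : Rabs t < T -> 0 <= M ->
  Rabs (picard_iter (S n) t i - picard_iter n t i) <= M / L / 2 ^ n * exp (2 * L * Rabs t).
Proof.
  intros Ht PM; revert t i Ht.
  assert (Mono : forall (G g : R -> R) B t, 0 <= B -> G 0 = 0 ->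
    (forall s, Rabs s <= Rabs t -> is_derive G s (g s) /\
       Rabs (g s) <= B * (2 * L) * exp (2 * L * Rabs s)) ->
    Rabs (G t) <= B * exp (2 * L * Rabs t)).
  { intros G g B t PB H0 H; replace (G t) with (G t - G 0) by (rewrite H0; ring).
    eapply Rle_trans; [apply (deriv_compare G g B (2 * L) t H)|]; lra. }
  induction n as [|n IH]; intros t i Ht.
  - apply (Mono (fun t => picard_iter 1 t i - picard_iter 0 t i) (fun s => f s y0 i - 0)).
    + simpl; repeat apply Rdiv_le_0_compat; lra.
    + rewrite !picard_iter_0; ring.
    + intros s Hs; split.
      * apply (is_derive_minus (fun t => picard_iter 1 t i) (fun _ => y0 i)).
        -- apply picard_iter_derive; lra.
        -- apply (is_derive_const (V := R_NormedModule)).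
      * rewrite Rminus_0_r; eapply Rle_trans; [apply Bound; lra|].
        replace (M / L / 2 ^ 0 * (2 * L)) with (2 * M) by (simpl; field; lra).
        assert (1 <= exp (2 * L * Rabs s)).
        { generalize (exp_ineq1_le (2 * L * Rabs s)) (Rabs_pos s); intros; nra. }
        nra.
  - assert (P2 : 0 < 2 ^ n) by (apply pow_lt; lra).
    apply (Mono (fun t => picard_iter (S (S n)) t i - picard_iter (S n) t i)
             (fun s => f s (picard_iter (S n) s) i - f s (picard_iter n s) i)).
    + repeat apply Rdiv_le_0_compat; trivial; simpl; lra.
    + rewrite !picard_iter_0; ring.
    + intros s Hs; split.
      * apply (is_derive_minus (fun t => picard_iter (S (S n)) t i)
                 (fun t => picard_iter (S n) t i)); apply picard_iter_derive; lra.
      * eapply Rle_trans.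
        -- apply Lip with (D := M / L / 2 ^ n * exp (2 * L * Rabs s)); [lra|].
           intros j; apply IH; lra.
        -- right; simpl; field; lra.
Qed.

(** The iterates converge at the rate [C / 2 ^ n], uniformly in [t] and [i], so the limit is
    continuous and satisfies the integral equation. Continuity of the field is expressed along
    continuous curves ([Cont]), which avoids a topology on [I -> R]. *)
Lemma picard : exists Y : R -> I -> R, (forall i, Y 0 i = y0 i) /\
  forall t i, Rabs t < T -> is_derive (fun s => Y s i) t (f t (Y t) i).
Proof.
  (* An index is what shows [M] to be nonnegative; over an empty index type every claim is
     vacuous. *)
  destruct (excluded_middle_informative (inhabited I)) as [[i0]|NI].
  2: { exists (fun _ _ => 0); split; intros; exfalso; apply NI; now constructor. }
  assert (PM : 0 <= M).
  { eapply Rle_trans; [apply Rabs_pos|apply (Bound 0 i0)]; now rewrite Rabs_R0. }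
  set (C := M / L * exp (2 * L * T)).
  assert (St : forall t i, Rabs t < T -> forall n,
    Rabs (picard_iter (S n) t i - picard_iter n t i) <= C / 2 ^ n).
  { intros t i Ht n; eapply Rle_trans; [now apply picard_iter_step|].
    unfold C; replace (M / L * exp (2 * L * T) / 2 ^ n) with (M / L / 2 ^ n * exp (2 * L * T))
      by (unfold Rdiv; ring).
    apply Rmult_le_compat_l.
    - repeat apply Rdiv_le_0_compat; try lra; apply pow_lt; lra.
    - left; apply exp_increasing; nra. }
  assert (Ch : forall t i, exists l, Rabs t < T -> forall n,
    Rabs (picard_iter n t i - l) <= 2 * C / 2 ^ n).
  { intros t i; destruct (Rlt_dec (Rabs t) T) as [Ht|Ht]; [|now exists 0].
    destruct (geometric_limit _ C (St t i Ht)) as [l Hl]; now exists l. }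
  set (Z t i := proj1_sig (constructive_indefinite_description _ (Ch t i))).
  assert (HZ : forall t i n, Rabs t < T -> Rabs (picard_iter n t i - Z t i) <= 2 * C / 2 ^ n).
  { intros t i n Ht; unfold Z; destruct (constructive_indefinite_description _ _); simpl; auto. }
  assert (Small : forall B e : R, 0 < e -> exists n, B / 2 ^ n < e).
  { intros B e He.
    assert (Lm : is_lim_seq (fun n => B * (/ 2) ^ n) (B * 0)).
    { apply (is_lim_seq_scal_l _ B 0); apply is_lim_seq_geom; rewrite Rabs_pos_eq; lra. }
    apply is_lim_seq_spec in Lm; destruct (Lm (mkposreal _ He)) as [N HN]; simpl in HN.
    exists N; specialize (HN N (le_n N)); rewrite Rmult_0_r, Rminus_0_r, pow_inv in HN.
    eapply Rle_lt_trans; [apply Rle_abs|exact HN]. }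
  assert (CZ : forall t i, Rabs t < T -> continuous (fun s => Z s i) t).
  { intros t i Ht; apply filterlim_locally; intros e.
    destruct (Small (2 * C) (e / 3)) as [n Hn]; [generalize (cond_pos e); lra|].
    assert (Cn := picard_iter_cont n t i Ht).
    assert (P3 : 0 < e / 3) by (generalize (cond_pos e); lra).
    apply filterlim_locally with (eps := mkposreal _ P3) in Cn.
    generalize (filter_and _ _ Cn (locally_Rabs_lt t Ht)); apply filter_imp.
    intros s [H1 H2]; unfold ball in *; simpl in *; unfold AbsRing_ball, abs, minus, plus, opp in *;
      simpl in *.
    replace (Z s i + - Z t i) with (- (picard_iter n s i - Z s i) +
      (picard_iter n s i + - picard_iter n t i) + (picard_iter n t i - Z t i)) by ring.
    eapply Rle_lt_trans; [apply Rabs_triang|].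
    eapply Rle_lt_trans; [apply Rplus_le_compat_r, Rabs_triang|]; rewrite Rabs_Ropp.
    generalize (HZ s i n H2) (HZ t i n Ht); lra. }
  assert (CF := Cont Z CZ).
  (* If the two sides differed by [d], the next iterate would lie within a multiple of [1 / 2 ^ n]
     of each of them, and for large [n] these distances add up to less than [d]. *)
  assert (EZ : forall t i, Rabs t < T -> Z t i = y0 i + RInt (fun s => f s (Z s) i) 0 t).
  { intros t i Ht; apply Rminus_diag_uniq.
    destruct (Req_dec (Z t i - (y0 i + RInt (fun s => f s (Z s) i) 0 t)) 0) as [E|E]; trivial.
    exfalso; apply Rabs_pos_lt in E.
    set (d := Rabs _) in E.
    destruct (Small (2 * C + L * (2 * C) * T) d E) as [n Hn].
    assert (B1 : Rabs (picard_iter (S n) t i - (y0 i + RInt (fun s => f s (Z s) i) 0 t))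
                 <= L * (2 * C / 2 ^ n) * T).
    { set (G s := picard_iter (S n) s i - (y0 i + RInt (fun r => f r (Z r) i) 0 s)).
      change (Rabs (G t) <= L * (2 * C / 2 ^ n) * T).
      assert (G0 : G 0 = 0).
      { unfold G; rewrite picard_iter_0, RInt_point; unfold zero; simpl; ring. }
      replace (G t) with (G t - G 0) by (rewrite G0; ring).
      assert (P2 : 0 < 2 ^ n) by (apply pow_lt; lra).
      assert (PC : 0 <= C).
      { apply Rmult_le_pos; [apply Rdiv_le_0_compat; lra|left; apply exp_pos]. }
      assert (PD : 0 <= L * (2 * C / 2 ^ n)).
      { apply Rmult_le_pos; [lra|]; apply Rdiv_le_0_compat; lra. }
      eapply Rle_trans; [apply (bounded_variation G (fun s => f s (picard_iter n s) i - f s (Z s) i) (L * (2 * C / 2 ^ n)) 0 t)|].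
      - intros s Hs; rewrite !Rminus_0_r in Hs.
        assert (Hs' : Rabs s < T) by lra.
        assert (DG : is_derive G s (f s (picard_iter n s) i - f s (Z s) i)).
        { apply (is_derive_minus (fun s => picard_iter (S n) s i)
                   (fun s => y0 i + RInt (fun r => f r (Z r) i) 0 s)).
          - now apply picard_iter_derive.
          - apply (is_derive_RInt_0 (fun s => f s (Z s) i)); auto. }
        split; [exact DG|].
        apply Lip; trivial; intros j; now apply HZ.
      - rewrite Rminus_0_r; apply Rmult_le_compat_l; lra. }
    assert (B2 := HZ t i (S n) Ht).
    assert (B3 : d <= 2 * C / 2 ^ S n + L * (2 * C / 2 ^ n) * T).
    { unfold d; replace (_ - _) with (- (picard_iter (S n) t i - Z t i) +
        (picard_iter (S n) t i - (y0 i + RInt (fun s => f s (Z s) i) 0 t))) by ring.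
      eapply Rle_trans; [apply Rabs_triang|]; rewrite Rabs_Ropp; lra. }
    assert (P2 : 0 < 2 ^ n) by (apply pow_lt; lra).
    replace ((2 * C + L * (2 * C) * T) / 2 ^ n) with
      (2 * (2 * C / 2 ^ S n) + L * (2 * C / 2 ^ n) * T) in Hn by (simpl; field; lra).
    assert (0 <= 2 * C / 2 ^ S n).
    { generalize (Rabs_pos (picard_iter (S n) t i - Z t i)); lra. }
    lra. }
  exists Z; split.
  - intros i; rewrite EZ, RInt_point by (now rewrite Rabs_R0); unfold zero; simpl; ring.
  - intros t i Ht; apply (is_derive_ext_loc (fun s => y0 i + RInt (fun r => f r (Z r) i) 0 s)).
    + generalize (locally_Rabs_lt t Ht); apply filter_imp; intros s Hs; symmetry; now apply EZ.
    + apply (is_derive_RInt_0 (fun s => f s (Z s) i)); auto.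
Qed.

End Picard.

(** * Smooth dependence on a parameter *)

Definition rect (d T m t : R) : Prop := Rabs m < d /\ Rabs t < T.

Lemma open2_rect d T : open2 (rect d T).
Proof.
  intros m t [Hm Ht]; apply locally_2d_and.
  - exact (open2_fst (fun x => Rabs x < d) (locally_Rabs_lt d) m t Hm).
  - destruct (locally_Rabs_lt T t Ht) as [e He]; exists e; intros; now apply He.
Qed.

(** The parameter enters through the initial data alone, and affinely; a parameter of the vector
    field becomes an unknown with zero derivative. The variational system inherits this form, with
    data [al + be m] for the solution and the constant [be] for its derivative. *)
Record flow {I : Type} (F : I -> expr I) (d T : R) (al be : I -> R) (Y : R -> R -> I -> R) : Prop := {
  flow_init : forall m i, Rabs m < d -> Y m 0 i = al i + be i * m;
  flow_ode : forall m t i, rect d T m t ->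
    is_derive (fun s => Y m s i) t (eval (F i) (Y m t));
  flow_bound : exists K, forall m t i, rect d T m t -> Rabs (Y m t i) <= K
}.

Definition variation {I : Type} (F : I -> expr I) (k : I + I) : expr (I + I) :=
  match k with inl i => lift (F i) | inr i => diff (F i) end.

(** The variational equation is linear in [v], so [picard] solves it on the entire interval.
    Gronwall then serves three times with the same [G]: for Lipschitz dependence on [m], for the
    bound on [V], and for the distance between [V] and the difference quotient. *)
Lemma flow_variation {I : Type} (l : list I) (F : I -> expr I) d T al be Y :
  (forall i, In i l) -> 0 < T -> flow F d T al be Y ->
  exists V N,
    flow (variation F) d T (join al be) (join be (fun _ => 0)) (fun m t => join (Y m t) (V m t)) /\
    (forall m t i, rect d T m t -> is_derive (fun x => Y x t i) m (V m t i)) /\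
    (forall m m' t i, Rabs m < d -> rect d T m' t ->
       Rabs (Y m' t i - Y m t i) <= N * Rabs (m' - m)).
Proof.
  intros Hl PT [Hi Ho [K HK]].
  destruct (list_uniform l (fun i L => forall y y' w W, (forall i, Rabs (y i) <= K) ->
    (forall i, Rabs (y' i) <= K) -> (forall i, Rabs (w i) <= W) -> 0 <= W ->
    Rabs (slope (F i) y y' w) <= L * W)) as [L0 [PL0 HL0]].
  { intros i a b H Hab y y' w W H1 H2 H3 H4; eapply Rle_trans; [now apply H|].
    now apply Rmult_le_compat_r. }
  { intros i; apply slope_bound. }
  destruct (list_uniform l (fun i C => forall y y' w D W, (forall i, Rabs (y i) <= K) ->
    (forall i, Rabs (y' i) <= K) -> (forall i, Rabs (y' i - y i) <= D) -> 0 <= D ->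
    (forall i, Rabs (w i) <= W) -> 0 <= W ->
    Rabs (slope (F i) y y' w - slope (F i) y y w) <= C * (D * W))) as [C [PC HC]].
  { intros i a b H Hab y y' w D W H1 H2 H3 H4 H5 H6; eapply Rle_trans; [now apply H|].
    apply Rmult_le_compat_r; trivial; now apply Rmult_le_pos. }
  { intros i; apply slope_cont. }
  destruct (list_uniform l (fun i B => Rabs (be i) <= B)) as [B [PB HB]].
  { intros; lra. }
  { intros i; exists (Rabs (be i)); split; [apply Rabs_pos|lra]. }
  set (L := L0 + 1).
  assert (PL : 0 < L) by (unfold L; lra).
  assert (HL : forall i y y' w W, (forall i, Rabs (y i) <= K) ->
    (forall i, Rabs (y' i) <= K) -> (forall i, Rabs (w i) <= W) ->
    Rabs (slope (F i) y y' w) <= L * W).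
  { intros i y y' w W H1 H2 H3.
    assert (PW : 0 <= W) by (eapply Rle_trans; [apply Rabs_pos|apply (H3 i)]).
    eapply Rle_trans; [now apply (HL0 i (Hl i) y y' w W)|].
    apply Rmult_le_compat_r; unfold L; lra. }
  clear HL0.
  assert (Yc : forall m t i, rect d T m t -> continuous (fun s => Y m s i) t).
  { intros m t i H; eapply is_derive_continuous; now apply Ho. }
  assert (R0 : forall m t, Rabs m < d -> Rabs t < T -> rect d T m t) by now split.
  assert (Ch : forall m, exists v : R -> I -> R, Rabs m < d ->
    (forall i, v 0 i = be i) /\
    forall t i, Rabs t < T -> is_derive (fun s => v s i) t (slope (F i) (Y m t) (Y m t) (v t))).
  { intros m; destruct (Rlt_dec (Rabs m) d) as [Hm|Hm]; [|now exists (fun _ _ => 0)].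
    destruct (picard T L (L * B) (fun t v i => slope (F i) (Y m t) (Y m t) v) be) as [v Hv];
      trivial.
    - intros t y y' D Ht H i.
      replace (_ - _) with (slope (F i) (Y m t) (Y m t) (fun i => 1 * y i + (-1) * y' i))
        by (rewrite slope_lin; ring).
      apply HL; auto; intros j; replace (_ + _) with (y j - y' j) by ring; auto.
    - intros v Hv t i Ht; apply continuous_slope; auto.
    - intros t i Ht; apply HL; auto.
    - now exists v. }
  set (V m := proj1_sig (constructive_indefinite_description _ (Ch m))).
  assert (HV : forall m, Rabs m < d -> (forall i, V m 0 i = be i) /\
    forall t i, Rabs t < T ->
      is_derive (fun s => V m s i) t (slope (F i) (Y m t) (Y m t) (V m t))).
  { intros m Hm; unfold V; destruct (constructive_indefinite_description _ _); simpl; auto. }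
  destruct (gronwall l Hl T L (Rlt_le _ _ PL) PT) as [G [PG HG]].
  assert (LipY : forall m m' t i, Rabs m < d -> rect d T m' t ->
    Rabs (Y m' t i - Y m t i) <= G * B * Rabs (m' - m)).
  { intros m m' t i Hm [Hm' Ht].
    replace (G * B * Rabs (m' - m)) with (G * (B * Rabs (m' - m) + 0)) by ring.
    apply (HG (fun t i => Y m' t i - Y m t i)
              (fun t i => slope (F i) (Y m t) (Y m' t) (fun i => Y m' t i - Y m t i)));
      trivial; try lra.
    - apply Rmult_le_pos; trivial; apply Rabs_pos.
    - intros s j Hs; rewrite <- eval_slope.
      apply (is_derive_minus (fun s => Y m' s j) (fun s => Y m s j)); auto.
    - intros s D Hs HD j; rewrite Rplus_0_r; apply HL; auto.
    - intros j; rewrite !Hi by trivial.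
      replace (_ - _) with (be j * (m' - m)) by ring.
      rewrite Rabs_mult; apply Rmult_le_compat_r; [apply Rabs_pos|auto]. }
  assert (BV : forall m t i, rect d T m t -> Rabs (V m t i) <= G * B).
  { intros m t i [Hm Ht]; destruct (HV m Hm) as [V0 VD].
    rewrite <- (Rplus_0_r B).
    apply (HG (V m) (fun t i => slope (F i) (Y m t) (Y m t) (V m t))); trivial; try lra.
    - auto.
    - intros s D Hs HD j; rewrite Rplus_0_r; apply HL; auto.
    - intros j; rewrite V0; auto. }
  exists V, (G * B); split; [split|].
  - intros m [i|i] Hm; simpl; [auto|]; rewrite (proj1 (HV m Hm)); ring.
  - intros m t [i|i] H; simpl.
    + rewrite eval_lift; auto.
    + rewrite eval_diff; destruct H; now apply HV.
  - exists (K + G * B).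
    assert (PGB : 0 <= G * B) by nra.
    intros m t [i|i] H; simpl.
    + generalize (HK m t i H); lra.
    + generalize (BV m t i H) (HK m t i H) (Rabs_pos (Y m t i)); lra.
  - split; [|exact LipY]; intros m t i [Hm Ht]; apply is_derive_Reals; intros e He.
    (* The quotient differs from [V] by at most [G C (G B)^2 |h|]; the added 1 makes the divisor
       positive. *)
    set (Q := G * (C * (G * B * (G * B))) + 1).
    assert (PQ : 0 < Q).
    { unfold Q; assert (0 <= G * B) by nra.
      assert (0 <= G * (C * (G * B * (G * B)))) by (repeat apply Rmult_le_pos; lra); lra. }
    destruct (locally_Rabs_lt d m Hm) as [r Hr].
    assert (P : 0 < Rmin r (e / Q)).
    { apply Rmin_pos; [apply cond_pos|now apply Rdiv_lt_0_compat]. }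
    exists (mkposreal _ P); intros h Hh0 Hh; simpl in Hh.
    assert (Hmh : Rabs (m + h) < d).
    { apply Hr; unfold ball; simpl; unfold AbsRing_ball, abs, minus, plus, opp; simpl.
      replace (m + h + - m) with h by ring; eapply Rlt_le_trans; [exact Hh|apply Rmin_l]. }
    assert (He' : Q * Rabs h < e).
    { assert (X : Rabs h < e / Q) by (eapply Rlt_le_trans; [exact Hh|apply Rmin_r]).
      apply Rmult_lt_compat_l with (r := Q) in X; trivial.
      replace (Q * (e / Q)) with e in X by (field; lra); lra. }
    assert (Ph : 0 < Rabs h) by now apply Rabs_pos_lt.
    set (w t i := (Y (m + h) t i - Y m t i) / h).
    assert (Bw : forall s j, Rabs s < T -> Rabs (w s j) <= G * B).
    { intros s j Hs; unfold w, Rdiv; rewrite Rabs_mult, Rabs_inv.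
      apply Rmult_le_reg_r with (Rabs h); trivial.
      rewrite Rmult_assoc, Rinv_l, Rmult_1_r by lra.
      replace (Rabs h) with (Rabs (m + h - m)) by (f_equal; ring); apply LipY; auto. }
    assert (D : Rabs (w t i - V m t i) <= G * (0 + C * (G * B * (G * B)) * Rabs h)).
    { apply (HG (fun t i => w t i - V m t i)
        (fun t i => slope (F i) (Y m t) (Y (m + h) t) (w t) - slope (F i) (Y m t) (Y m t) (V m t)));
        trivial; try lra.
      - repeat apply Rmult_le_pos; lra.
      - intros s j Hs.
        apply (is_derive_minus (fun s => w s j) (fun s => V m s j)); [|now apply HV].
        apply is_derive_eq with
          ((eval (F j) (Y (m + h) s) - eval (F j) (Y m s)) * / h).
        + apply (is_derive_ext (fun s => / h * (Y (m + h) s j - Y m s j))).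
          { intros x; unfold w, Rdiv; apply Rmult_comm. }
          rewrite Rmult_comm.
          apply (is_derive_scal (fun s => Y (m + h) s j - Y m s j)).
          apply (is_derive_minus (fun s => Y (m + h) s j) (fun s => Y m s j)); auto.
        + rewrite eval_slope.
          replace (slope (F j) (Y m s) (Y (m + h) s) (fun i => Y (m + h) s i - Y m s i)) with
            (slope (F j) (Y m s) (Y (m + h) s) (fun i => h * w s i + 0 * w s i)).
          * rewrite slope_lin; field; trivial.
          (* The arguments agree pointwise; induction on the expression takes the place of
             extensionality. *)
          * assert (E : forall i, h * w s i + 0 * w s i = Y (m + h) s i - Y m s i)
              by (intros; unfold w; field; trivial).
            clear - E; induction (F j) as [| |a IHa b IHb|a IHa b IHb]; simpl; congruence.
      - intros s D Hs HD j.
        (* The first term is linear in the unknown [w - V]. The second is the defect of evaluating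
           the divided difference off the diagonal, which [slope_cont] makes of order [|h|]. *)
        replace (_ - _) with
          (slope (F j) (Y m s) (Y m s) (fun i => 1 * w s i + (-1) * V m s i) +
           (slope (F j) (Y m s) (Y (m + h) s) (w s) - slope (F j) (Y m s) (Y m s) (w s)))
          by (rewrite slope_lin; ring).
        eapply Rle_trans; [apply Rabs_triang|]; apply Rplus_le_compat.
        + apply HL; auto; intros k; replace (_ + _) with (w s k - V m s k) by ring; auto.
        + replace (C * (G * B * (G * B)) * Rabs h) with (C * ((G * B * Rabs h) * (G * B))) by ring.
          apply HC; auto.
          * intros k; replace (Rabs h) with (Rabs (m + h - m)) by (f_equal; ring); apply LipY; auto.
          * repeat apply Rmult_le_pos; lra.
          * apply Rmult_le_pos; lra.
      - intros j; unfold w; rewrite (proj1 (HV m Hm)), !Hi by trivial.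
        replace (_ - _) with 0 by (field; trivial); rewrite Rabs_R0; lra. }
    fold (w t i); eapply Rle_lt_trans; [exact D|].
    unfold Q in He'; lra.
Qed.

(** Induction on the order, over all index types and systems at once: the derivative in [m] is a
    component of the variational flow on [I + I], and the derivative in [t] is a polynomial in the
    flow. Joint continuity combines the Lipschitz bound in [m], uniform in [t], with continuity in
    [t] alone. *)
Lemma flow_smooth {I : Type} (l : list I) (F : I -> expr I) d T al be Y :
  (forall i, In i l) -> 0 < T -> flow F d T al be Y ->
  forall i, smooth2 (rect d T) (fun m t => Y m t i).
Proof.
  intros Hl PT HF i k; revert I l F al be Y Hl HF i.
  induction k as [|k IH]; intros I l F al be Y Hl HF i;
    destruct (flow_variation l F d T al be Y Hl PT HF) as [V [N [HV [DV LipY]]]].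
  all: assert (C0 : forall m t, rect d T m t -> continuity_2d_pt (fun m t => Y m t i) m t).
  1,3: intros m t H e; assert (Pe : 0 < e / 2) by (generalize (cond_pos e); lra);
    assert (Cy := is_derive_continuous _ _ _ (flow_ode _ _ _ _ _ _ HF m t i H));
    apply filterlim_locally with (eps := mkposreal _ Pe) in Cy; destruct Cy as [r Hr];
    set (N' := Rmax N 1); assert (PN : 0 < N') by (eapply Rlt_le_trans; [|apply Rmax_r]; lra);
    assert (Pd : 0 < Rmin r (e / 2 / N'))
      by (apply Rmin_pos; [apply cond_pos|now apply Rdiv_lt_0_compat]);
    generalize (open2_rect d T m t H); apply locally_2d_impl;
    exists (mkposreal _ Pd); intros m' t' Hm Ht H'; simpl in Hm, Ht;
    assert (B1 : Rabs (m' - m) < e / 2 / N') by (eapply Rlt_le_trans; [exact Hm|apply Rmin_r]);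
    assert (B2 : Rabs (Y m t' i - Y m t i) < e / 2)
      by (apply Hr; eapply Rlt_le_trans; [exact Ht|apply Rmin_l]);
    assert (B3 := LipY m m' t' i (proj1 H) H');
    replace (Y m' t' i - Y m t i) with ((Y m' t' i - Y m t' i) + (Y m t' i - Y m t i)) by ring;
    eapply Rle_lt_trans; [apply Rabs_triang|];
    apply Rmult_lt_compat_l with (r := N') in B1; trivial;
    replace (N' * (e / 2 / N')) with (e / 2) in B1 by (field; lra);
    assert (B4 : N * Rabs (m' - m) <= N' * Rabs (m' - m))
      by (apply Rmult_le_compat_r; [apply Rabs_pos|apply Rmax_l]); lra.
  - now split.
  - split; [exact C0|].
    exists (fun m t => V m t i), (fun m t => eval (F i) (Y m t)); split4.
    + intros m t H; now apply DV.
    + intros m t H; now apply (flow_ode _ _ _ _ _ _ HF).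
    + apply (IH (I + I)%type (map inl l ++ map inr l) _ _ _ _) with (i := inr i) in HV; trivial.
      intros [j|j]; apply in_or_app; [left|right]; now apply in_map.
    + apply Ck_eval; intros j; now apply (IH I l F al be).
Qed.

(** * Existence near a given solution, and uniqueness *)

(** Truncating the unknowns makes a polynomial field bounded and globally Lipschitz, so that
    [picard] applies; a truncated solution is a true one as long as it stays in the box. *)
Definition clip (K x : R) : R := Rmax (- K) (Rmin K x).

Lemma clip_lip (K x y : R) : Rabs (clip K x - clip K y) <= Rabs (x - y).
Proof.
  unfold clip, Rmax, Rmin, Rabs; repeat destruct Rle_dec; repeat destruct Rcase_abs; lra.
Qed.

Lemma clip_bound (K x : R) : 0 <= K -> Rabs (clip K x) <= K.
Proof.
  unfold clip, Rmax, Rmin, Rabs; repeat destruct Rle_dec; repeat destruct Rcase_abs; lra.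
Qed.

Lemma clip_id (K x : R) : Rabs x <= K -> clip K x = x.
Proof.
  intros H; apply Rabs_le_between in H.
  unfold clip, Rmax, Rmin; repeat destruct Rle_dec; lra.
Qed.

Lemma continuous_clip (K : R) (f : R -> R) (t : R) :
  continuous f t -> continuous (fun s => clip K (f s)) t.
Proof.
  intros Hf; apply (continuous_comp f (clip K)); trivial.
  apply filterlim_locally; intros e; exists e; intros y Hy.
  eapply Rle_lt_trans; [apply clip_lip|exact Hy].
Qed.

Lemma flow_near {I : Type} (l : list I) (F : I -> expr I) T al be (Y0 : R -> I -> R) K0 :
  (forall i, In i l) -> 0 < T -> 0 <= K0 ->
  (forall i, Y0 0 i = al i) ->
  (forall t i, Rabs t < T -> is_derive (fun s => Y0 s i) t (eval (F i) (Y0 t))) ->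
  (forall t i, Rabs t < T -> Rabs (Y0 t i) <= K0) ->
  exists d Y N, 0 < d /\ flow F d T al be Y /\
    forall m t i, rect d T m t -> Rabs (Y m t i - Y0 t i) <= N * Rabs m.
Proof.
  intros Hl PT PK H0 HO HK.
  (* One unit of room around the given solution; the choice [d = / (G * B + 1)] below keeps the
     perturbed solutions inside it. *)
  set (K := K0 + 1).
  assert (PK' : 0 <= K) by (unfold K; lra).
  destruct (list_uniform l (fun i L => forall y y' w W, (forall i, Rabs (y i) <= K) ->
    (forall i, Rabs (y' i) <= K) -> (forall i, Rabs (w i) <= W) -> 0 <= W ->
    Rabs (slope (F i) y y' w) <= L * W)) as [L0 [PL0 HL0]].
  { intros i a b H Hab y y' w W H1 H2 H3 H4; eapply Rle_trans; [now apply H|].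
    now apply Rmult_le_compat_r. }
  { intros i; apply slope_bound. }
  destruct (list_uniform l (fun i M => forall y, (forall i, Rabs (y i) <= K) ->
    Rabs (eval (F i) y) <= M)) as [M [PM HM]].
  { intros i a b H Hab y Hy; eapply Rle_trans; [now apply H|trivial]. }
  { intros i; apply eval_bound. }
  destruct (list_uniform l (fun i B => Rabs (be i) <= B)) as [B [PB HB]].
  { intros; lra. }
  { intros i; exists (Rabs (be i)); split; [apply Rabs_pos|lra]. }
  set (L := L0 + 1).
  assert (PL : 0 < L) by (unfold L; lra).
  set (f (t : R) (y : I -> R) i := eval (F i) (fun j => clip K (y j))).
  assert (Lip : forall t y y' D, (forall i, Rabs (y i - y' i) <= D) ->
    forall i, Rabs (f t y i - f t y' i) <= L * D).
  { intros t y y' D HD i; unfold f; rewrite eval_slope.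
    assert (PD : 0 <= D) by (eapply Rle_trans; [apply Rabs_pos|apply (HD i)]).
    eapply Rle_trans.
    - apply (HL0 i) with (W := D); trivial; intros j; try now apply clip_bound.
      eapply Rle_trans; [apply clip_lip|trivial].
    - apply Rmult_le_compat_r; unfold L; lra. }
  assert (Ch : forall m, exists y : R -> I -> R, (forall i, y 0 i = al i + be i * m) /\
    forall t i, Rabs t < T -> is_derive (fun s => y s i) t (f t (y t) i)).
  { intros m; apply (picard T L M f (fun i => al i + be i * m)); trivial.
    - intros; now apply Lip.
    - intros Y HY t i Ht; apply continuous_eval; intros j; apply continuous_clip; auto.
    - intros t i _; apply HM; auto; intros j; now apply clip_bound. }
  set (Y m := proj1_sig (constructive_indefinite_description _ (Ch m))).
  assert (HY : forall m, (forall i, Y m 0 i = al i + be i * m) /\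
    forall t i, Rabs t < T -> is_derive (fun s => Y m s i) t (f t (Y m t) i)).
  { intros m; unfold Y; destruct (constructive_indefinite_description _ _); simpl; auto. }
  destruct (gronwall l Hl T L (Rlt_le _ _ PL) PT) as [G [PG HG]].
  assert (Near : forall m t i, Rabs t < T -> Rabs (Y m t i - Y0 t i) <= G * B * Rabs m).
  { intros m t i Ht; destruct (HY m) as [Hi Hd].
    replace (G * B * Rabs m) with (G * (B * Rabs m + 0)) by ring.
    apply (HG (fun t i => Y m t i - Y0 t i) (fun t i => f t (Y m t) i - f t (Y0 t) i));
      trivial; try lra.
    - apply Rmult_le_pos; trivial; apply Rabs_pos.
    - intros s j Hs.
      apply (is_derive_minus (fun s => Y m s j) (fun s => Y0 s j)); auto.
      replace (f s (Y0 s) j) with (eval (F j) (Y0 s)); auto.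
      assert (E : forall i, clip K (Y0 s i) = Y0 s i).
      { intros k; apply clip_id; generalize (HK s k Hs); unfold K; lra. }
      clear - E; unfold f; induction (F j) as [| |a IHa b IHb|a IHa b IHb]; simpl; congruence.
    - intros s D _ HD j; rewrite Rplus_0_r; now apply Lip.
    - intros j; rewrite Hi, H0; replace (_ - _) with (be j * m) by ring.
      rewrite Rabs_mult; apply Rmult_le_compat_r; [apply Rabs_pos|auto]. }
  assert (PGB : 0 <= G * B) by nra.
  assert (Pd : 0 < / (G * B + 1)) by (apply Rinv_0_lt_compat; lra).
  assert (Box : forall m t i, rect (/ (G * B + 1)) T m t -> Rabs (Y m t i) <= K).
  { intros m t i [Hm Ht].
    replace (Y m t i) with ((Y m t i - Y0 t i) + Y0 t i) by ring.
    eapply Rle_trans; [apply Rabs_triang|].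
    generalize (Near m t i Ht) (HK t i Ht); unfold K; intros N1 N2.
    apply Rmult_lt_compat_l with (r := G * B + 1) in Hm; [|lra].
    rewrite Rinv_r in Hm by lra; generalize (Rabs_pos m); lra. }
  exists (/ (G * B + 1)), Y, (G * B); split; [trivial|split; [split|]].
  - intros m i _; apply HY.
  - intros m t i H; replace (eval (F i) (Y m t)) with (f t (Y m t) i).
    + destruct H; now apply HY.
    + assert (E : forall i, clip K (Y m t i) = Y m t i) by (intros; apply clip_id; auto).
      clear - E; unfold f; induction (F i) as [| |a IHa b IHb|a IHa b IHb]; simpl; congruence.
  - now exists K.
  - intros m t i [_ Ht]; now apply Near.
Qed.

(** Stated for [0 <= s <= t] because a profile lives on [[0, pend)]. Both solutions are bounded on
    this compact interval, which supplies a Lipschitz constant, and the energy estimate with zero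
    data forces their difference to vanish. *)
Lemma ode_unique {I : Type} (l : list I) (F : I -> expr I) (u v : R -> I -> R) (t : R) :
  (forall i, In i l) -> 0 <= t ->
  (forall s i, 0 <= s <= t -> is_derive (fun s => u s i) s (eval (F i) (u s))) ->
  (forall s i, 0 <= s <= t -> is_derive (fun s => v s i) s (eval (F i) (v s))) ->
  (forall i, u 0 i = v 0 i) -> forall i, u t i = v t i.
Proof.
  intros Hl Pt Hu Hv H0 i.
  assert (Bd : forall y : R -> I -> R,
    (forall s i, 0 <= s <= t -> is_derive (fun s => y s i) s (eval (F i) (y s))) ->
    exists K, 0 <= K /\ forall j, In j l -> forall s, 0 <= s <= t -> Rabs (y s j) <= K).
  { intros y Hy; apply list_uniform.
    - intros j a b H Hab s Hs; generalize (H s Hs); lra.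
    - intros j; destruct (continuity_ab_maj (fun s => Rabs (y s j)) 0 t Pt) as [x [Hx _]].
      + intros s Hs; apply continuity_pt_filterlim.
        apply (continuous_comp (fun s => y s j) Rabs); [|apply continuous_Rabs].
        eapply is_derive_continuous; now apply Hy.
      + exists (Rabs (y x j)); split; [apply Rabs_pos|trivial]. }
  destruct (Bd u Hu) as [K1 [PK1 HK1]]; destruct (Bd v Hv) as [K2 [PK2 HK2]].
  set (K := K1 + K2).
  destruct (list_uniform l (fun i L => forall y y' w W, (forall i, Rabs (y i) <= K) ->
    (forall i, Rabs (y' i) <= K) -> (forall i, Rabs (w i) <= W) -> 0 <= W ->
    Rabs (slope (F i) y y' w) <= L * W)) as [L [PL HL]].
  { intros j a b H Hab y y' w W H1 H2 H3 H4; eapply Rle_trans; [now apply H|].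
    now apply Rmult_le_compat_r. }
  { intros j; apply slope_bound. }
  assert (E := gronwall_energy l Hl L t 0 0 (fun s j => u s j - v s j)
    (fun s j => eval (F j) (u s) - eval (F j) (v s)) PL Pt (Rle_refl 0)).
  assert (Q : (u t i - v t i) ^ 2 <= 0).
  { eapply Rle_trans; [apply E|].
    - intros s j Hs; apply (is_derive_minus (fun s => u s j) (fun s => v s j)); auto.
    - intros s D Hs HD j; rewrite eval_slope, Rplus_0_r.
      apply HL; trivial; try (intros k).
      + generalize (HK2 k (Hl k) s Hs); unfold K; lra.
      + generalize (HK1 k (Hl k) s Hs); unfold K; lra.
      + eapply Rle_trans; [apply Rabs_pos|apply (HD j)].
    - intros j; rewrite H0, Rminus_diag, Rabs_R0; lra.
    - lra.
    - right; ring. }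
  apply Rminus_diag_uniq; generalize (pow2_ge_0 (u t i - v t i)); intros; nra.
Qed.

Lemma const_of_derive_0 (f : R -> R) (T t : R) :
  (forall s, Rabs s < T -> is_derive f s 0) -> Rabs t < T -> f t = f 0.
Proof.
  intros H Ht; apply Rminus_diag_uniq.
  assert (B : Rabs (f t - f 0) <= 0 * Rabs (t - 0)).
  { apply (bounded_variation f (fun _ => 0)); intros s Hs.
    rewrite !Rminus_0_r in Hs; split; [apply H; lra|rewrite Rabs_R0; lra]. }
  rewrite Rmult_0_l in B; generalize (Rabs_pos (f t - f 0)); intros P.
  assert (E : Rabs (f t - f 0) = 0) by lra.
  destruct (Req_dec (f t - f 0) 0) as [|N]; trivial; apply Rabs_no_R0 in N; lra.
Qed.

(** * Profiles with neck radius 1 *)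

(* The profile system made polynomial: [Vc], [Vs], [Vw] stand for
   cos theta, sin theta and 1 / rho, and [Vm] for the constant [c]. *)
Inductive var := Vr | Vz | Vt | Vc | Vs | Vw | Vm.

Definition vars : list var := Vr :: Vz :: Vt :: Vc :: Vs :: Vw :: Vm :: nil.

Lemma in_vars (i : var) : In i vars.
Proof. destruct i; simpl; tauto. Qed.

Definition Neg {I : Type} (e : expr I) : expr I := Mul (Cst (-1)) e.

Definition turn_expr : expr var :=
  Add (Mul (Var Vm) (Add (Mul (Var Vr) (Var Vs)) (Neg (Mul (Var Vz) (Var Vc)))))
      (Neg (Mul (Var Vs) (Var Vw))).

Definition profile_field (i : var) : expr var :=
  match i with
  | Vr => Var Vc
  | Vz => Var Vs
  | Vt => turn_expr
  | Vc => Neg (Mul (Var Vs) turn_expr)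
  | Vs => Mul (Var Vc) turn_expr
  | Vw => Neg (Mul (Mul (Var Vw) (Var Vw)) (Var Vc))
  | Vm => Cst 0
  end.

Definition start (i : var) : R :=
  match i with Vr => 1 | Vz => 0 | Vt => PI / 2 | Vc => 0 | Vs => 1 | Vw => 1 | Vm => 0 end.

Definition start_slope (i : var) : R := match i with Vm => 1 | _ => 0 end.

(** The catenoid of neck radius 1 in arclength: at [s = sinh t] its generating curve is at
    [(cosh t, t)]. *)
Definition cat_env (s : R) (i : var) : R :=
  match i with
  | Vr => sqrt (1 + s ^ 2)
  | Vz => arcsinh s
  | Vt => PI / 2 - atan s
  | Vc => s / sqrt (1 + s ^ 2)
  | Vs => / sqrt (1 + s ^ 2)
  | Vw => / sqrt (1 + s ^ 2)
  | Vm => 0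
  end.

Lemma is_derive_arcsinh (s : R) : is_derive arcsinh s (/ sqrt (1 + s ^ 2)).
Proof.
  apply is_derive_Reals; replace (1 + s ^ 2) with (s ^ 2 + 1) by ring.
  apply derivable_pt_lim_arcsinh.
Qed.

Lemma sqrt_1_sq (s : R) : 1 <= sqrt (1 + s ^ 2) /\ sqrt (1 + s ^ 2) * sqrt (1 + s ^ 2) = 1 + s ^ 2.
Proof.
  assert (0 <= s ^ 2) by apply pow2_ge_0; split.
  - rewrite <- sqrt_1 at 1; apply sqrt_le_1_alt; lra.
  - apply sqrt_sqrt; lra.
Qed.

Lemma cat_env_0 (i : var) : cat_env 0 i = start i.
Proof.
  destruct i; simpl; rewrite ?arcsinh_0, ?atan_0;
    try (replace (1 + 0 * (0 * 1)) with 1 by ring; rewrite sqrt_1); lra.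
Qed.

Lemma cat_env_ode (s : R) (i : var) :
  is_derive (fun s => cat_env s i) s (eval (profile_field i) (cat_env s)).
Proof.
  destruct (sqrt_1_sq s) as [Q1 Q2].
  assert (P2 : 0 <= s ^ 2) by apply pow2_ge_0.
  assert (D : is_derive (fun s => sqrt (1 + s ^ 2)) s (s / sqrt (1 + s ^ 2))).
  { auto_derive; [simpl in P2; lra|].
    replace (s * (s * 1)) with (s ^ 2) by ring; field; lra. }
  assert (Di := is_derive_inv _ _ _ D); cbv beta in Di.
  destruct i; cbn [eval turn_expr Neg cat_env profile_field].
  2: apply is_derive_arcsinh.
  2: { apply is_derive_eq with (0 + -1 * (/ (1 + s²))).
       - apply (is_derive_Rplus (fun _ => PI / 2) (fun s => - atan s)).
         + apply (is_derive_const (V := R_NormedModule)).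
         + apply (is_derive_ext (fun s => -1 * atan s)); [intros; simpl; ring|].
           apply (is_derive_scal atan); apply is_derive_atan.
       - unfold Rsqr; replace (1 + s * s) with (1 + s ^ 2) by ring.
         set (q := sqrt (1 + s ^ 2)) in *; rewrite <- Q2; field; lra. }
  - exact D.
  - eapply is_derive_eq.
    + apply (is_derive_Rmult (fun s => s) (fun s => / sqrt (1 + s ^ 2)) s 1); [|apply Di; lra].
      apply (is_derive_id (K := R_AbsRing)).
    + set (q := sqrt (1 + s ^ 2)) in *.
      replace (1 * / q + s * (- (s / q) / q ^ 2)) with (/ q - s ^ 2 / (q * q * q)) by (field; lra).
      replace (s ^ 2) with (q * q - 1) by lra; field; lra.
  - eapply is_derive_eq; [apply Di; lra|]; field; lra.
  - eapply is_derive_eq; [apply Di; lra|]; field; lra.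
  - apply (is_derive_const (V := R_NormedModule)).
Qed.

Definition support (r z th : R) : R := r * sin th - z * cos th.

Definition turn (c r z th : R) : R := c * support r z th - sin th / r.

(* Profiles with neck radius 1, indexed by [m = c a^2]. *)
Record unit_profiles (d T : R) (r z th : R -> R -> R) : Prop := {
  up_smooth_r : smooth2 (rect d T) r;
  up_smooth_z : smooth2 (rect d T) z;
  up_smooth_th : smooth2 (rect d T) th;
  up_dr : forall m t, rect d T m t -> is_derive (r m) t (cos (th m t));
  up_dz : forall m t, rect d T m t -> is_derive (z m) t (sin (th m t));
  up_dth : forall m t, rect d T m t -> is_derive (th m) t (turn m (r m t) (z m t) (th m t));
  up_r0 : forall m, Rabs m < d -> r m 0 = 1;
  up_z0 : forall m, Rabs m < d -> z m 0 = 0;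
  up_th0 : forall m, Rabs m < d -> th m 0 = PI / 2;
  up_even : forall m t, rect d T m t -> r m (- t) = r m t;
  up_odd : forall m t, rect d T m t -> z m (- t) = - z m t;
  up_flip : forall m t, rect d T m t -> th m (- t) = PI - th m t;
  up_r_pos : forall m t, rect d T m t -> 0 < r m t;
  up_sin_pos : forall m t, rect d T m t -> 0 < sin (th m t);
  up_turn_neg : forall m t, rect d T m t -> turn m (r m t) (z m t) (th m t) < 0;
  up_cat : forall t, Rabs t < T ->
    r 0 t = sqrt (1 + t ^ 2) /\ z 0 t = arcsinh t /\ th 0 t = PI / 2 - atan t
}.

(** [E1] and [E2] say that the vector [(Vc, Vs)], rotated back by the angle [Vt], stays at [(1, 0)]:
    both expressions have derivative 0. The quantity [Vw Vr - 1] solves a linear homogeneous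
    equation with initial value 0, so Gronwall annihilates it. *)
Lemma flow_angle d T Y : 0 < T -> flow profile_field d T start start_slope Y ->
  forall m t, rect d T m t -> Y m t Vc = cos (Y m t Vt) /\ Y m t Vs = sin (Y m t Vt) /\
    Y m t Vm = m /\ Y m t Vw * Y m t Vr = 1.
Proof.
  intros PT [Hi Ho [K HK]] m t [Hm Ht].
  assert (Ho' : forall s i, Rabs s < T -> is_derive (fun s => Y m s i) s (eval (profile_field i) (Y m s)))
    by (intros; apply Ho; now split).
  assert (I0 : forall i, Y m 0 i = start i + start_slope i * m) by auto.
  assert (Dc : forall s, Rabs s < T -> is_derive (fun s => cos (Y m s Vt)) s
                 (- sin (Y m s Vt) * eval turn_expr (Y m s))).
  { intros s Hs; apply (is_derive_Rcomp cos (fun s => Y m s Vt)); [apply is_derive_cos|].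
    exact (Ho' s Vt Hs). }
  assert (Ds : forall s, Rabs s < T -> is_derive (fun s => sin (Y m s Vt)) s
                 (cos (Y m s Vt) * eval turn_expr (Y m s))).
  { intros s Hs; apply (is_derive_Rcomp sin (fun s => Y m s Vt)); [apply is_derive_sin|].
    exact (Ho' s Vt Hs). }
  assert (E1 : Y m t Vc * cos (Y m t Vt) + Y m t Vs * sin (Y m t Vt) = 1).
  { rewrite (const_of_derive_0 (fun t => Y m t Vc * cos (Y m t Vt) + Y m t Vs * sin (Y m t Vt)) T t);
      trivial.
    - rewrite !I0; simpl; rewrite !Rmult_0_l, !Rplus_0_r, sin_PI2; ring.
    - intros s Hs; eapply is_derive_eq.
      + apply (is_derive_Rplus (fun t => Y m t Vc * cos (Y m t Vt)) (fun t => Y m t Vs * sin (Y m t Vt)));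
          [exact (is_derive_Rmult _ _ _ _ _ (Ho' s Vc Hs) (Dc s Hs))
          |exact (is_derive_Rmult _ _ _ _ _ (Ho' s Vs Hs) (Ds s Hs))].
      + cbn [eval profile_field Neg]; ring. }
  assert (E2 : Y m t Vc * sin (Y m t Vt) + -1 * (Y m t Vs * cos (Y m t Vt)) = 0).
  { rewrite (const_of_derive_0
      (fun t => Y m t Vc * sin (Y m t Vt) + -1 * (Y m t Vs * cos (Y m t Vt))) T t); trivial.
    - rewrite !I0; simpl; rewrite !Rmult_0_l, !Rplus_0_r, cos_PI2; ring.
    - intros s Hs; eapply is_derive_eq.
      + apply (is_derive_Rplus (fun t => Y m t Vc * sin (Y m t Vt))
                 (fun t => -1 * (Y m t Vs * cos (Y m t Vt))));
          [|apply (is_derive_scal (fun t => Y m t Vs * cos (Y m t Vt)))].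
        * exact (is_derive_Rmult _ _ _ _ _ (Ho' s Vc Hs) (Ds s Hs)).
        * exact (is_derive_Rmult _ _ _ _ _ (Ho' s Vs Hs) (Dc s Hs)).
      + cbn [eval profile_field Neg]; ring. }
  assert (E3 := sin2_cos2 (Y m t Vt)); unfold Rsqr in E3.
  set (C := cos _) in *; set (S := sin _) in *.
  split4.
  - replace (Y m t Vc) with (Y m t Vc * (S * S + C * C)) by (rewrite E3; ring).
    replace (Y m t Vc * (S * S + C * C)) with
      (S * (Y m t Vc * S + -1 * (Y m t Vs * C)) + C * (Y m t Vc * C + Y m t Vs * S)) by ring.
    rewrite E1, E2; ring.
  - replace (Y m t Vs) with (Y m t Vs * (S * S + C * C)) by (rewrite E3; ring).
    replace (Y m t Vs * (S * S + C * C)) with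
      (S * (Y m t Vc * C + Y m t Vs * S) - C * (Y m t Vc * S + -1 * (Y m t Vs * C))) by ring.
    rewrite E1, E2; ring.
  - rewrite (const_of_derive_0 (fun t => Y m t Vm) T t); trivial.
    + rewrite I0; simpl; ring.
    + intros s Hs; exact (Ho' s Vm Hs).
  - assert (PK : 0 <= K).
    { eapply Rle_trans; [apply Rabs_pos|apply (HK m t Vr)]; now split. }
    (* A scalar equation, treated as a system indexed by [unit]. *)
    destruct (gronwall (tt :: nil) (fun i => match i with tt => or_introl eq_refl end)
                T (K * K)) as [G [_ HG]]; trivial; [nra|].
    assert (B : Rabs (Y m t Vw * Y m t Vr + -1) <= G * (0 + 0)).
    { apply (HG (fun t _ => Y m t Vw * Y m t Vr + -1)
               (fun t _ => - (Y m t Vw * Y m t Vc) * (Y m t Vw * Y m t Vr + -1)));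
        trivial; try lra; try exact tt.
      - intros s _ Hs; eapply is_derive_eq.
        + apply (is_derive_Rplus (fun t => Y m t Vw * Y m t Vr) (fun _ => -1));
            [exact (is_derive_Rmult _ _ _ _ _ (Ho' s Vw Hs) (Ho' s Vr Hs))
            |apply (is_derive_const (V := R_NormedModule))].
        + cbn [eval profile_field Neg]; unfold zero; simpl; ring.
      - intros s D Hs HD _; specialize (HD tt).
        rewrite Rplus_0_r, Rabs_mult, Rabs_Ropp, Rabs_mult.
        apply Rmult_le_compat; trivial; try apply Rabs_pos.
        + apply Rmult_le_pos; apply Rabs_pos.
        + apply Rmult_le_compat; try apply Rabs_pos; apply HK; now split.
      - intros _; rewrite !I0; simpl.
        replace (_ + -1) with 0 by ring; rewrite Rabs_R0; lra. }
    rewrite Rplus_0_r, Rmult_0_r in B.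
    assert (E4 : Rabs (Y m t Vw * Y m t Vr + -1) = 0)
      by (generalize (Rabs_pos (Y m t Vw * Y m t Vr + -1)); lra).
    destruct (Req_dec (Y m t Vw * Y m t Vr + -1) 0) as [E|E]; [lra|].
    now apply Rabs_no_R0 in E.
Qed.

(** Reflection across [z = 0] together with a reversal of the direction of travel, which turns the
    angle [theta] into [PI - theta]. *)
Definition flip (y : var -> R) (i : var) : R :=
  match i with Vz => - y Vz | Vt => PI - y Vt | Vc => - y Vc | _ => y i end.

(** The flipped time reversal solves the same system with the same initial values, so uniqueness
    gives equality for nonnegative times; negative times follow because [flip] is an involution. *)
Lemma flow_parity d T Y : 0 < T -> flow profile_field d T start start_slope Y ->
  forall m t, rect d T m t -> forall i, Y m (- t) i = flip (Y m t) i.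
Proof.
  intros PT [Hi Ho _] m t [Hm Ht].
  assert (Ho' : forall s i, Rabs s < T -> is_derive (fun s => Y m s i) s (eval (profile_field i) (Y m s)))
    by (intros; apply Ho; now split).
  assert (Fd : forall s i, Rabs s < T ->
    is_derive (fun s => flip (Y m (- s)) i) s (eval (profile_field i) (flip (Y m (- s))))).
  { intros s i Hs.
    assert (Hr : forall j, is_derive (fun s => Y m (- s) j) s (- eval (profile_field j) (Y m (- s)))).
    { intros j; apply (is_derive_reflect (fun s => Y m s j)); apply Ho'; now rewrite Rabs_Ropp. }
    assert (Hn : forall j, is_derive (fun s => - Y m (- s) j) s (eval (profile_field j) (Y m (- s)))).
    { intros j; rewrite <- (Ropp_involutive (eval _ _)).
      apply (is_derive_opp (fun s => Y m (- s) j)); auto. }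
    destruct i; cbn [flip]; eapply is_derive_eq;
      match goal with
      | |- is_derive (fun s => Y m (- s) ?j) _ _ => exact (Hr j)
      | |- is_derive (fun s => - Y m (- s) ?j) _ _ => exact (Hn j)
      | |- is_derive _ _ _ =>
          apply (is_derive_Rplus (fun _ => PI) (fun s => - Y m (- s) Vt));
          [apply (is_derive_const (V := R_NormedModule))|exact (Hn Vt)]
      | _ => cbn [eval profile_field turn_expr Neg flip]; unfold zero; simpl; ring
      end. }
  assert (Pos : forall t, 0 <= t < T -> forall i, Y m t i = flip (Y m (- t)) i).
  { intros t' Ht' i.
    apply (ode_unique vars profile_field (Y m) (fun s => flip (Y m (- s))) t' in_vars); try lra.
    - intros s j Hs; apply Ho'; rewrite Rabs_pos_eq; lra.
    - intros s j Hs; apply Fd; rewrite Rabs_pos_eq; lra.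
    - intros j; rewrite Ropp_0; destruct j; simpl; rewrite !Hi by trivial; simpl; lra. }
  assert (FF : forall y i, flip (flip y) i = y i) by (intros y []; simpl; lra).
  intros i; destruct (Rle_dec 0 t) as [P|P].
  - rewrite Rabs_pos_eq in Ht by lra.
    rewrite <- (FF (Y m (- t)) i).
    destruct i; cbn [flip]; rewrite !(Pos t) by lra; reflexivity.
  - rewrite Rabs_left in Ht by lra.
    rewrite (Pos (- t)) by lra; now rewrite Ropp_involutive.
Qed.

Lemma flow_shrink {I : Type} (F : I -> expr I) d d' T al be Y :
  d' <= d -> flow F d T al be Y -> flow F d' T al be Y.
Proof.
  intros Hd [H1 H2 [K HK]]; split.
  - intros m i Hm; apply H1; lra.
  - intros m t i [Hm Ht]; apply H2; split; lra.
  - exists K; intros m t i [Hm Ht]; apply HK; split; lra.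
Qed.

Lemma unit_profiles_shrink d d' T r z th :
  d' <= d -> unit_profiles d T r z th -> unit_profiles d' T r z th.
Proof.
  intros Hd H.
  assert (S : forall m t, rect d' T m t -> rect d T m t) by (intros m t [Hm Ht]; split; lra).
  destruct H as [H1 H2 H3 H4 H5 H6 H7 H8 H9 H10 H11 H12 H13 H14 H15 H16].
  constructor; trivial.
  1,2,3: intros k; apply (Ck_subset k (rect d T)); trivial.
  all: intros; first [apply H4|apply H5|apply H6|apply H7|apply H8|apply H9|apply H10|apply H11
    |apply H12|apply H13|apply H14|apply H15]; auto; lra.
Qed.

Lemma cat_env_bound (T : R) : 0 < T ->
  exists K, 0 <= K /\ forall t i, Rabs t < T -> Rabs (cat_env t i) <= K.
Proof.
  intros PT.
  destruct (list_uniform vars (fun i K => forall t, Rabs t < T -> Rabs (cat_env t i) <= K))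
    as [K [PK HK]].
  - intros i a b H Hab t Ht; generalize (H t Ht); lra.
  - intros i; destruct (continuity_ab_maj (fun s => Rabs (cat_env s i)) (- T) T) as [x [Hx _]];
      [lra| |].
    + intros s _; apply continuity_pt_filterlim.
      apply (continuous_comp (fun s => cat_env s i) Rabs); [|apply continuous_Rabs].
      eapply is_derive_continuous; apply cat_env_ode.
    + exists (Rabs (cat_env x i)); split; [apply Rabs_pos|].
      intros t Ht; apply Hx; apply Rabs_def2 in Ht; lra.
  - exists K; split; trivial; intros; apply HK; trivial; apply in_vars.
Qed.

Lemma unit_profiles_exist (T : R) : 0 < T ->
  exists d r z th, 0 < d <= / 2 /\ unit_profiles d T r z th.
Proof.
  intros PT; destruct (cat_env_bound T PT) as [K0 [PK0 HK0]].
  destruct (flow_near vars profile_field T start start_slope cat_env K0 in_vars PT PK0 cat_env_0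
             (fun t i _ => cat_env_ode t i) HK0) as [d0 [Y [N0 [Pd0 [HF0 HN0]]]]].
  set (N := Rmax N0 0).
  assert (PN : 0 <= N) by apply Rmax_r.
  assert (HN : forall m t i, rect d0 T m t -> Rabs (Y m t i - cat_env t i) <= N * Rabs m).
  { intros m t i H; eapply Rle_trans; [now apply HN0|].
    apply Rmult_le_compat_r; [apply Rabs_pos|apply Rmax_l]. }
  destruct (flow_bound _ _ _ _ _ _ HF0) as [K HK].
  (* On the unit catenoid [sin theta] and [1 / rho] both equal [/ sqrt (1 + t ^ 2)], so [eta] bounds
     them from below on the window. *)
  set (eta := / sqrt (1 + T ^ 2)).
  destruct (sqrt_1_sq T) as [QT1 QT2].
  assert (Peta : 0 < eta) by (apply Rinv_0_lt_compat; lra).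
  assert (eta1 : eta <= 1).
  { apply Rle_trans with (/ 1); [apply Rinv_le_contravar|rewrite Rinv_1]; lra. }
  assert (He : forall t, Rabs t < T -> eta <= / sqrt (1 + t ^ 2)).
  { intros t Ht; destruct (sqrt_1_sq t) as [Q1 Q2].
    apply Rinv_le_contravar; [lra|]; apply sqrt_le_1_alt.
    rewrite <- (pow2_abs t); apply Rplus_le_compat_l, pow_incr; split; [apply Rabs_pos|lra]. }
  (* Four requirements: the flow exists; [d <= 1/2], for the pinching estimate; [sin theta] and
     [1 / rho] stay above [eta / 2]; and [2 d K^2 < eta^2 / 4], so that [sin theta / rho] outweighs
     [m Q] in [theta']. *)
  set (d := Rmin (Rmin d0 (/ 2)) (Rmin (eta / 2 / (N + 1)) (eta ^ 2 / 4 / (2 * K ^ 2 + 1)))).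
  assert (PK2 : 0 <= K ^ 2) by apply pow2_ge_0.
  assert (Pe2 : 0 < eta ^ 2) by (apply pow_lt; trivial).
  assert (Pd : 0 < d).
  { repeat apply Rmin_pos; trivial; try lra; repeat apply Rdiv_lt_0_compat; lra. }
  assert (d1 : d <= d0) by (eapply Rle_trans; [apply Rmin_l|apply Rmin_l]).
  assert (d2 : d <= / 2) by (eapply Rle_trans; [apply Rmin_l|apply Rmin_r]).
  assert (d3 : d * (N + 1) <= eta / 2).
  { assert (X : d <= eta / 2 / (N + 1)) by (eapply Rle_trans; [apply Rmin_r|apply Rmin_l]).
    apply Rmult_le_compat_r with (r := N + 1) in X; [|lra].
    replace (eta / 2 / (N + 1) * (N + 1)) with (eta / 2) in X by (field; lra); lra. }
  assert (d4 : d * (2 * K ^ 2 + 1) <= eta ^ 2 / 4).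
  { assert (X : d <= eta ^ 2 / 4 / (2 * K ^ 2 + 1)) by (eapply Rle_trans; [apply Rmin_r|apply Rmin_r]).
    apply Rmult_le_compat_r with (r := 2 * K ^ 2 + 1) in X; [|lra].
    replace (eta ^ 2 / 4 / (2 * K ^ 2 + 1) * (2 * K ^ 2 + 1)) with (eta ^ 2 / 4) in X
      by (field; lra); lra. }
  assert (HF := flow_shrink _ _ d _ _ _ _ d1 HF0).
  assert (S : forall m t, rect d T m t -> rect d0 T m t) by (intros m t [Hm Ht]; split; lra).
  assert (HA := flow_angle d T Y PT HF).
  assert (HP := flow_parity d T Y PT HF).
  assert (Hs := flow_smooth vars profile_field d T start start_slope Y in_vars PT HF).
  destruct HF as [Hi Ho _].
  assert (Near : forall m t i, rect d T m t -> cat_env t i - eta / 2 <= Y m t i).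
  { intros m t i H; assert (B := HN m t i (S m t H)); apply Rabs_le_between in B.
    destruct H as [Hm _]; assert (0 <= Rabs m) by apply Rabs_pos; nra. }
  exists d, (fun m t => Y m t Vr), (fun m t => Y m t Vz), (fun m t => Y m t Vt).
  assert (Pr : forall m t, rect d T m t -> 0 < Y m t Vr).
  { intros m t H; generalize (Near m t Vr H); simpl.
    destruct (sqrt_1_sq t) as [Q1 _]; simpl in Q1; lra. }
  assert (Ps : forall m t, rect d T m t -> eta / 2 <= Y m t Vs).
  { intros m t H; generalize (Near m t Vs H) (He t (proj2 H)); unfold cat_env; lra. }
  assert (Pw : forall m t, rect d T m t -> eta / 2 <= Y m t Vw).
  { intros m t H; generalize (Near m t Vw H) (He t (proj2 H)); unfold cat_env; lra. }
  assert (Et : forall m t, rect d T m t ->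
    turn m (Y m t Vr) (Y m t Vz) (Y m t Vt) = eval turn_expr (Y m t)).
  { intros m t H; destruct (HA m t H) as [A1 [A2 [A3 A4]]]; unfold turn, support.
    cbn [eval turn_expr Neg]; rewrite A1, A2, A3.
    replace (/ Y m t Vr) with (Y m t Vw); [unfold Rdiv|].
    - replace (/ Y m t Vr) with (Y m t Vw); [ring|].
      apply Rmult_eq_reg_r with (Y m t Vr); [|apply Rgt_not_eq; now apply Pr].
      rewrite A4; field; apply Rgt_not_eq; now apply Pr.
    - apply Rmult_eq_reg_r with (Y m t Vr); [|apply Rgt_not_eq; now apply Pr].
      rewrite A4; field; apply Rgt_not_eq; now apply Pr. }
  split; [split; trivial|constructor]; trivial.
  - intros m t H; destruct (HA m t H) as [A1 _]; rewrite <- A1; exact (Ho m t Vr H).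
  - intros m t H; destruct (HA m t H) as [_ [A2 _]]; rewrite <- A2; exact (Ho m t Vz H).
  - intros m t H; rewrite (Et m t H); exact (Ho m t Vt H).
  - intros m Hm; rewrite Hi by trivial; simpl; ring.
  - intros m Hm; rewrite Hi by trivial; simpl; ring.
  - intros m Hm; rewrite Hi by trivial; simpl; ring.
  - intros m t H; exact (HP m t H Vr).
  - intros m t H; exact (HP m t H Vz).
  - intros m t H; exact (HP m t H Vt).
  - intros m t H; destruct (HA m t H) as [_ [A2 _]]; rewrite <- A2; generalize (Ps m t H); lra.
  - intros m t H; rewrite Et by trivial; destruct (HA m t H) as [A1 [A2 [A3 A4]]].
    cbn [eval turn_expr Neg]; rewrite A3.
    assert (X : m * (Y m t Vr * Y m t Vs + -1 * (Y m t Vz * Y m t Vc)) <= d * (2 * K ^ 2)).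
    { eapply Rle_trans; [apply Rle_abs|]; rewrite Rabs_mult.
      assert (B : forall i, Rabs (Y m t i) <= K) by (intros; apply HK; auto).
      apply Rmult_le_compat; try apply Rabs_pos; [left; apply H|].
      eapply Rle_trans; [apply Rabs_triang|].
      rewrite !Rabs_mult, (Rabs_left (-1)) by lra.
      generalize (Rmult_le_compat _ _ _ _ (Rabs_pos _) (Rabs_pos _) (B Vr) (B Vs))
                 (Rmult_le_compat _ _ _ _ (Rabs_pos _) (Rabs_pos _) (B Vz) (B Vc)).
      simpl; lra. }
    generalize (Ps m t H) (Pw m t H); intros X1 X2.
    assert (X3 : eta / 2 * (eta / 2) <= Y m t Vs * Y m t Vw) by (apply Rmult_le_compat; lra).
    simpl in *; lra.
  - intros t Ht.
    assert (E : forall i, Y 0 t i = cat_env t i).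
    { intros i; assert (H : rect d0 T 0 t) by (split; [rewrite Rabs_R0; lra|trivial]).
      generalize (HN 0 t i H); rewrite Rabs_R0, Rmult_0_r; intros B.
      apply Rminus_diag_uniq; destruct (Req_dec (Y 0 t i - cat_env t i) 0) as [|Ne]; trivial.
      apply Rabs_pos_lt in Ne; lra. }
    now rewrite !E.
Qed.

(** * Maximal profiles *)

(** [filterdiff] quantifies over all limits of its filter. The one-sided filter at [s] has no limit
    but [s], because [s] itself lies in the half-line. *)
Lemma nonneg_filter_lim (s x : R) : 0 <= s ->
  is_filter_lim (within (fun t => 0 <= t) (locally s)) x -> x = s.
Proof.
  intros Hs Hx; destruct (Req_dec x s) as [|N]; trivial; exfalso.
  assert (P : 0 < Rabs (s - x)) by (apply Rabs_pos_lt; lra).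
  assert (L : locally x (fun t => Rabs (t - x) < Rabs (s - x))).
  { exists (mkposreal _ P); intros t Ht; exact Ht. }
  apply Hx in L; apply locally_singleton in L; specialize (L Hs); lra.
Qed.

Lemma is_derive_ge0_of (f : R -> R) (s l : R) : 0 <= s -> is_derive f s l -> is_derive_ge0 f s l.
Proof.
  intros Hs [Hl Hf]; split; [trivial|].
  intros x Hx.
  apply (nonneg_filter_lim s x Hs) in Hx as E; subst x; intros e.
  assert (L := Hf s (fun P H => H) e); unfold within; revert L; apply filter_imp; auto.
Qed.

Lemma is_derive_ge0_bound (f : R -> R) (s l : R) : is_derive_ge0 f s l ->
  forall e : posreal, locally s (fun t => 0 <= t ->
    norm (minus (minus (f t) (f s)) (scal (minus t s) l)) <= e * norm (minus t s)).
Proof.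
  intros [_ Hf] e; apply (fun H => Hf s H e).
  intros P HP; unfold within; revert HP; apply filter_imp; auto.
Qed.

Lemma is_derive_ge0_pos (f : R -> R) (s l : R) : 0 < s -> is_derive_ge0 f s l -> is_derive f s l.
Proof.
  intros Hs Hf; split; [apply Hf|].
  intros x Hx; rewrite <- (is_filter_lim_locally_unique _ _ Hx); intros e.
  assert (L : locally s (fun t => 0 < t)) by now apply (open_gt 0).
  generalize (filter_and _ _ L (is_derive_ge0_bound f s l Hf e)).
  apply filter_imp; intros t [H1 H2]; apply H2; lra.
Qed.

Lemma is_derive_ge0_ext (f g : R -> R) (s l : R) : 0 <= s ->
  locally s (fun t => 0 <= t -> f t = g t) -> is_derive_ge0 f s l -> is_derive_ge0 g s l.
Proof.
  intros Hs HL Hf; split; [apply Hf|].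
  intros x Hx e; generalize (proj2 Hf x Hx e); unfold within.
  apply (nonneg_filter_lim s x Hs) in Hx as E; subst x; rewrite <- (locally_singleton _ _ HL Hs).
  intros H; generalize (filter_and _ _ HL H); apply filter_imp.
  intros t [H1 H2] Ht; rewrite <- (H1 Ht); now apply H2.
Qed.

(** Continuing linearly to the left of 0 turns the one-sided derivative at 0 into the two-sided one
    that [ode_unique] expects. *)
Definition extend (f : R -> R) (l t : R) : R := if Rle_dec 0 t then f t else f 0 + l * t.

Lemma extend_nonneg (f : R -> R) (l t : R) : 0 <= t -> extend f l t = f t.
Proof. unfold extend; destruct Rle_dec; lra. Qed.

Lemma is_derive_extend (f : R -> R) (l0 l s : R) : 0 <= s -> (s = 0 -> l0 = l) ->
  is_derive_ge0 f s l -> is_derive (extend f l0) s l.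
Proof.
  intros Hs H0 Hf; destruct (Rle_lt_or_eq_dec 0 s Hs) as [P|<-].
  - apply (is_derive_ext_loc f); [|now apply is_derive_ge0_pos].
    generalize (open_gt 0 s P); apply filter_imp; intros t Ht; symmetry; apply extend_nonneg.
    now apply Rlt_le.
  - rewrite (H0 eq_refl) in *; clear H0 l0.
    split; [apply Hf|].
    intros x Hx; rewrite <- (is_filter_lim_locally_unique _ _ Hx); intros e.
    generalize (is_derive_ge0_bound f 0 l Hf e); apply filter_imp; intros t Ht.
    rewrite (extend_nonneg f l 0) by lra.
    destruct (Rle_dec 0 t) as [P|P].
    + rewrite extend_nonneg by trivial; now apply Ht.
    + unfold extend; destruct Rle_dec; [lra|].
      replace (minus _ _) with (zero : R_NormedModule).
      * rewrite (norm_zero (V := R_NormedModule)).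
        apply Rmult_le_pos; [left; apply cond_pos|apply norm_ge_0].
      * unfold zero, minus, plus, opp, scal; simpl; unfold mult; simpl; ring.
Qed.

Lemma profile_env (c a t : R) (P : profile) : 0 < a -> profile_solution c a P ->
  0 <= t -> Rbar_lt t (pend P) ->
  exists u : R -> var -> R,
    (forall i, u 0 i = match i with Vr => a | Vz => 0 | Vt => PI / 2 | Vc => 0 | Vs => 1
                       | Vw => / a | Vm => c end) /\
    (forall s i, 0 <= s <= t -> is_derive (fun s => u s i) s (eval (profile_field i) (u s))) /\
    u t Vr = rho P t /\ u t Vz = zed P t /\ u t Vt = theta P t.
Proof.
  intros Pa [H1 [H2 [H3 HP]]] Pt Ht.
  set (K s := c * (rho P s * sin (theta P s) - zed P s * cos (theta P s)) - sin (theta P s) / rho P s).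
  set (r := extend (rho P) (cos (theta P 0))).
  set (z := extend (zed P) (sin (theta P 0))).
  set (th := extend (theta P) (K 0)).
  assert (E : forall s, 0 <= s -> r s = rho P s /\ z s = zed P s /\ th s = theta P s).
  { intros s Hs; unfold r, z, th; rewrite !extend_nonneg by trivial; auto. }
  exists (fun s i => match i with Vr => r s | Vz => z s | Vt => th s | Vc => cos (th s)
            | Vs => sin (th s) | Vw => / r s | Vm => c end).
  split4.
  - destruct (E 0 (Rle_refl 0)) as [E1 [E2 E3]].
    intros []; rewrite ?E1, ?E2, ?E3, ?H1, ?H2, ?H3, ?cos_PI2, ?sin_PI2; reflexivity.
  - intros s i Hs; destruct (HP s (proj1 Hs)) as [Pr [Dr [Dz Dt]]].
    { apply Rbar_le_lt_trans with t; [apply Hs|trivial]. }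
    destruct (E s (proj1 Hs)) as [E1 [E2 E3]].
    assert (Dr' : is_derive r s (cos (th s))).
    { rewrite E3; apply is_derive_extend; [apply Hs|now intros ->|trivial]. }
    assert (Dz' : is_derive z s (sin (th s))).
    { rewrite E3; apply is_derive_extend; [apply Hs|now intros ->|trivial]. }
    assert (Dt' : is_derive th s (K s)).
    { apply is_derive_extend; [apply Hs|now intros ->|trivial]. }
    assert (EK : c * (r s * sin (th s) + -1 * (z s * cos (th s))) + -1 * (sin (th s) * / r s) = K s).
    { unfold K; rewrite E1, E2, E3; unfold Rdiv; ring. }
    destruct i; cbn [eval profile_field turn_expr Neg].
    + exact Dr'.
    + exact Dz'.
    + rewrite EK; exact Dt'.
    + rewrite EK; apply is_derive_eq with (- sin (th s) * K s); [|ring].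
      apply (is_derive_Rcomp cos th); [apply is_derive_cos|trivial].
    + rewrite EK; apply (is_derive_Rcomp sin th); [apply is_derive_sin|trivial].
    + eapply is_derive_eq; [apply (is_derive_inv r s _ Dr'); rewrite E1; lra|].
      field; rewrite E1; lra.
    + apply (is_derive_const (V := R_NormedModule)).
  - now apply E.
  - destruct (E t Pt) as [_ [E2 E3]]; auto.
Qed.

Lemma profile_unique (c a t : R) (P P' : profile) : 0 < a ->
  profile_solution c a P -> profile_solution c a P' ->
  0 <= t -> Rbar_lt t (pend P) -> Rbar_lt t (pend P') ->
  rho P t = rho P' t /\ zed P t = zed P' t /\ theta P t = theta P' t.
Proof.
  intros Pa H H' Pt Ht Ht'.
  destruct (profile_env c a t P Pa H Pt Ht) as [u [U0 [Du [<- [<- <-]]]]].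
  destruct (profile_env c a t P' Pa H' Pt Ht') as [v [V0 [Dv' [<- [<- <-]]]]].
  assert (E := ode_unique vars profile_field u v t in_vars Pt Du Dv'
                 (fun i => eq_trans (U0 i) (eq_sym (V0 i)))).
  auto.
Qed.

(** Gluing: at each time take the value of some solution that lives past it. Uniqueness makes these
    choices consistent, and the end is the supremum of such times. *)
Lemma maximal_profile_exists (c a : R) (P0 : profile) : 0 < a ->
  profile_solution c a P0 -> Rbar_lt 0 (pend P0) -> exists P, maximal_profile c a P.
Proof.
  intros Pa H0 Pe.
  set (E s := 0 <= s /\ exists P, profile_solution c a P /\ Rbar_lt s (pend P)).
  destruct (Lub_Rbar_correct E) as [Ub Lub]; set (e := Lub_Rbar E) in *.
  assert (Ch : forall s, exists P, E s -> profile_solution c a P /\ Rbar_lt s (pend P)).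
  { intros s; destruct (excluded_middle_informative (E s)) as [[_ [P HP]]|N].
    - now exists P.
    - exists P0; intros X; now elim N. }
  set (Q s := proj1_sig (constructive_indefinite_description _ (Ch s))).
  assert (HQ : forall s, E s -> profile_solution c a (Q s) /\ Rbar_lt s (pend (Q s))).
  { intros s; unfold Q; destruct (constructive_indefinite_description _ _); trivial. }
  assert (Dn : forall s s', E s' -> 0 <= s <= s' -> E s).
  { intros s s' [_ [P [HP Hs]]] [H1 H2]; split; trivial; exists P; split; trivial.
    now apply Rbar_le_lt_trans with s'. }
  (* Below the supremum a single solution reaches past [s], so near [s] the glued functions coincide
     with it and inherit its derivatives. *)
  assert (Up : forall s, 0 <= s -> Rbar_lt s e -> exists s', s < s' /\ E s').
  { intros s Hs He; apply NNPP; intros N.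
    apply (Rbar_lt_not_le _ _ He), Lub; intros s' Es'.
    destruct (Rle_dec s' s) as [|M]; trivial; exfalso; apply N; exists s'; split; trivial; lra. }
  set (P := Profile e (fun s => rho (Q s) s) (fun s => zed (Q s) s) (fun s => theta (Q s) s)).
  assert (Ag : forall P1 s, profile_solution c a P1 -> 0 <= s -> Rbar_lt s (pend P1) ->
    rho P1 s = rho P s /\ zed P1 s = zed P s /\ theta P1 s = theta P s).
  { intros P1 s HP1 Hs He.
    assert (Es : E s) by (split; trivial; now exists P1).
    destruct (HQ s Es); now apply (profile_unique c a s P1 (Q s)). }
  assert (E0 : E 0) by (split; [lra|now exists P0]).
  exists P; split; [|split].
  - destruct (HQ 0 E0) as [HQ0 _].
    assert (Pos : exists s, 0 < s /\ E s).
    { destruct (pend P0) as [x| |] eqn:Ex; simpl in Pe; try easy.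
      - exists (x / 2); split; [lra|]; split; [lra|]; exists P0; rewrite Ex; split; trivial.
        simpl; lra.
      - exists 1; split; [lra|]; split; [lra|]; exists P0; now rewrite Ex. }
    destruct Pos as [s [Hs Es]]; apply Rbar_lt_le_trans with s; [trivial|now apply Ub].
  - assert (A0 := Ag P0 0 H0 (Rle_refl 0) Pe).
    destruct H0 as [H1 [H2 [H3 _]]]; rewrite H1, H2, H3 in A0; destruct A0 as [A1 [A2 A3]].
    split4; auto.
    intros s Hs He; destruct (Up s Hs He) as [s' [Hs' Es']].
    destruct (HQ s' Es') as [HP1 Hp]; set (P1 := Q s') in *.
    assert (Hl : forall t, 0 <= t <= s' -> Rbar_lt t (pend P1)).
    { intros t Ht; apply Rbar_le_lt_trans with s'; [apply Ht|trivial]. }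
    assert (L : locally s (fun t => t < s')) by now apply (open_lt s').
    destruct (Ag P1 s HP1 Hs) as [E1 [E2 E3]]; [apply Hl; lra|].
    destruct (proj2 (proj2 (proj2 HP1)) s Hs) as [Pr [Dr [Dz Dt]]]; [apply Hl; lra|].
    rewrite <- E1, <- E2, <- E3; split4; trivial.
    + apply (is_derive_ge0_ext (rho P1)); trivial; revert L; apply filter_imp; intros t Ht Pt.
      apply Ag; trivial; apply Hl; lra.
    + apply (is_derive_ge0_ext (zed P1)); trivial; revert L; apply filter_imp; intros t Ht Pt.
      apply Ag; trivial; apply Hl; lra.
    + apply (is_derive_ge0_ext (theta P1)); trivial; revert L; apply filter_imp; intros t Ht Pt.
      apply Ag; trivial; apply Hl; lra.
  - intros P' HP'; apply Rbar_not_lt_le; intros He; simpl in He.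
    assert (X : exists s : R, 0 <= s /\ Rbar_lt e s /\ Rbar_lt s (pend P')).
    { assert (Ee : Rbar_le 0 e) by now apply Ub.
      destruct e as [x| |]; destruct (pend P') as [y| |]; simpl in *; try easy.
      - exists ((x + y) / 2); lra.
      - exists (x + 1); repeat split; lra. }
    destruct X as [s [Hs [X1 X2]]].
    apply (Rbar_lt_not_le _ _ X1), Ub; split; trivial; now exists P'.
Qed.

(** This is the access to the [epsilon]-chosen profile: an explicit solution determines it wherever
    that solution lives. *)
Lemma the_profile_spec (c a : R) (P0 : profile) : 0 < a ->
  profile_solution c a P0 -> Rbar_lt 0 (pend P0) ->
  Rbar_le (pend P0) (pend (the_profile c a)) /\
  forall s, 0 <= s -> Rbar_lt s (pend P0) ->
    rho (the_profile c a) s = rho P0 s /\ zed (the_profile c a) s = zed P0 s /\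
    theta (the_profile c a) s = theta P0 s.
Proof.
  intros Pa H0 Pe.
  assert (M : maximal_profile c a (the_profile c a)).
  { unfold the_profile; apply epsilon_spec; now apply maximal_profile_exists with P0. }
  destruct M as [_ [M1 M2]]; split; [now apply M2|].
  intros s Hs He; apply (profile_unique c a); trivial.
  apply Rbar_lt_le_trans with (pend P0); auto.
Qed.

Lemma scaled_profile d T r z th c a : unit_profiles d T r z th -> 0 < T -> 0 < a ->
  Rabs (c * a ^ 2) < d ->
  profile_solution c a (Profile (a * T) (fun s => a * r (c * a ^ 2) (s / a))
    (fun s => a * z (c * a ^ 2) (s / a)) (fun s => th (c * a ^ 2) (s / a))).
Proof.
  intros H PT Pa Hm; set (m := c * a ^ 2) in *.
  unfold profile_solution; cbn [rho zed theta pend].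
  replace (0 / a) with 0 by (field; lra).
  rewrite (up_r0 _ _ _ _ _ H), (up_z0 _ _ _ _ _ H), (up_th0 _ _ _ _ _ H) by trivial.
  split4; try ring.
  intros s Hs Hs'; simpl in Hs'.
  assert (Hr : rect d T m (s / a)).
  { split; trivial; rewrite Rabs_pos_eq by (apply Rdiv_le_0_compat; lra).
    apply Rmult_lt_reg_r with a; trivial; replace (s / a * a) with s by (field; lra); lra. }
  assert (Pr := up_r_pos _ _ _ _ _ H _ _ Hr).
  assert (Da : is_derive (fun s => s / a) s (/ a)) by (auto_derive; trivial; field; lra).
  split4.
  - now apply Rmult_lt_0_compat.
  - apply is_derive_ge0_of; trivial.
    apply is_derive_eq with (a * (cos (th m (s / a)) * / a)); [|field; lra].
    apply (is_derive_scal (fun s => r m (s / a))).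
    apply (is_derive_Rcomp (r m) (fun s => s / a)); trivial; now apply (up_dr _ _ _ _ _ H).
  - apply is_derive_ge0_of; trivial.
    apply is_derive_eq with (a * (sin (th m (s / a)) * / a)); [|field; lra].
    apply (is_derive_scal (fun s => z m (s / a))).
    apply (is_derive_Rcomp (z m) (fun s => s / a)); trivial; now apply (up_dz _ _ _ _ _ H).
  - apply is_derive_ge0_of; trivial.
    eapply is_derive_eq; [apply (is_derive_Rcomp (th m) (fun s => s / a)); eauto;
      now apply (up_dth _ _ _ _ _ H)|].
    unfold turn, support, m; field; split; trivial; fold m; lra.
Qed.

(** * Shooting *)

Lemma strictly_increasing (f df : R -> R) (x y : R) : x < y ->
  (forall t, x <= t <= y -> is_derive f t (df t)) ->
  (forall t, x < t < y -> 0 < df t) -> f x < f y.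
Proof.
  intros H Hd Hp; destruct (MVT_cor2 f df x y H) as [t [E Ht]].
  - intros t Ht; apply is_derive_Reals; auto.
  - specialize (Hp t Ht); nra.
Qed.

(** The signs of [F] at heights [g x - h] and [g x + h] persist when [x] moves a little, and
    monotonicity in the second variable traps the root between these heights. *)
Lemma root_continuous (J : R -> Prop) (F : R -> R -> R) (g : R -> R) (lo hi x : R) :
  open J ->
  (forall x, J x -> lo < g x < hi /\ F x (g x) = 0) ->
  (forall x y y', J x -> lo < y -> y < y' -> y' < hi -> F x y' < F x y) ->
  (forall x y, J x -> lo < y < hi -> continuous (fun x => F x y) x) ->
  J x -> continuous g x.
Proof.
  intros HJ Hg Hm Hc Jx; destruct (Hg x Jx) as [Gx Rx].
  apply filterlim_locally; intros e.
  set (h := Rmin (e / 2) (Rmin ((g x - lo) / 2) ((hi - g x) / 2))).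
  assert (Ph : 0 < h).
  { assert (Pe := cond_pos e); repeat apply Rmin_pos; lra. }
  assert (h1 : h <= e / 2) by apply Rmin_l.
  assert (h2 : h <= (g x - lo) / 2) by (eapply Rle_trans; [apply Rmin_r|apply Rmin_l]).
  assert (h3 : h <= (hi - g x) / 2) by (eapply Rle_trans; [apply Rmin_r|apply Rmin_r]).
  assert (S1 : 0 < F x (g x - h)) by (rewrite <- Rx; apply Hm; trivial; lra).
  assert (S2 : F x (g x + h) < 0) by (rewrite <- Rx; apply Hm; trivial; lra).
  assert (C1 := Hc x (g x - h) Jx ltac:(lra)).
  assert (C2 := Hc x (g x + h) Jx ltac:(lra)).
  assert (L1 : locally x (fun u => 0 < F u (g x - h))).
  { apply (C1 (fun v => 0 < v)); now apply (open_gt 0). }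
  assert (L2 : locally x (fun u => F u (g x + h) < 0)).
  { apply (C2 (fun v => v < 0)); now apply (open_lt 0). }
  generalize (filter_and _ _ (HJ x Jx) (filter_and _ _ L1 L2)); apply filter_imp.
  intros u [Ju [U1 U2]]; destruct (Hg u Ju) as [Gu Ru].
  assert (B1 : g x - h < g u).
  { destruct (Rlt_le_dec (g x - h) (g u)) as [|[H|H]]; trivial; exfalso.
    - assert (X := Hm u (g u) (g x - h) Ju ltac:(lra) H ltac:(lra)); lra.
    - rewrite <- H in U1; lra. }
  assert (B2 : g u < g x + h).
  { destruct (Rlt_le_dec (g u) (g x + h)) as [|[H|H]]; trivial; exfalso.
    - assert (X := Hm u (g x + h) (g u) Ju ltac:(lra) H ltac:(lra)); lra.
    - rewrite H in U2; lra. }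
  unfold ball; simpl; unfold AbsRing_ball, abs, minus, plus, opp; simpl.
  apply Rabs_def1; generalize (cond_pos e); lra.
Qed.

Lemma intermediate_value (f : R -> R) (x y v : R) : x < y ->
  (forall t, x <= t <= y -> continuous f t) -> f x < v < f y ->
  exists t, x < t < y /\ f t = v.
Proof.
  intros H Hc Hv.
  destruct (Ranalysis5.IVT_interv (fun t => f t - v) x y) as [t [Ht E]]; try lra.
  { intros t Ht; apply continuity_pt_filterlim.
    apply (continuous_minus f (fun _ => v)); [auto|apply continuous_const]. }
  apply Rminus_diag_uniq in E.
  exists t; split; trivial; destruct Ht as [[H1|H1] [H2|H2]]; subst; lra.
Qed.

(** * Monotone quantities along unit profiles *)

Section UnitProfiles.
Variables (d T : R) (r z th : R -> R -> R).
Hypothesis HU : unit_profiles d T r z th.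

Definition unit_sqdist (m t : R) : R := r m t ^ 2 + z m t ^ 2.
Definition unit_support (m t : R) : R := support (r m t) (z m t) (th m t).
Definition unit_radial (m t : R) : R := r m t * cos (th m t) + z m t * sin (th m t).

Lemma rect_nonneg m t s : Rabs m < d -> 0 <= s <= t -> t < T -> rect d T m s.
Proof. intros; split; trivial; rewrite Rabs_pos_eq; lra. Qed.

Lemma is_derive_unit_sqdist m t : rect d T m t -> is_derive (unit_sqdist m) t (2 * unit_radial m t).
Proof.
  intros H.
  assert (Dr := up_dr _ _ _ _ _ HU m t H); assert (Dz := up_dz _ _ _ _ _ HU m t H).
  eapply is_derive_eq.
  - exact (is_derive_Rplus _ _ _ _ _ (is_derive_pow _ 2 _ _ Dr) (is_derive_pow _ 2 _ _ Dz)).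
  - unfold unit_radial; simpl; ring.
Qed.

Lemma is_derive_cos_th m t : rect d T m t ->
  is_derive (fun t => cos (th m t)) t (- sin (th m t) * turn m (r m t) (z m t) (th m t)).
Proof.
  intros H; apply (is_derive_Rcomp cos (th m)); [apply is_derive_cos|now apply (up_dth _ _ _ _ _ HU)].
Qed.

Lemma is_derive_sin_th m t : rect d T m t ->
  is_derive (fun t => sin (th m t)) t (cos (th m t) * turn m (r m t) (z m t) (th m t)).
Proof.
  intros H; apply (is_derive_Rcomp sin (th m)); [apply is_derive_sin|now apply (up_dth _ _ _ _ _ HU)].
Qed.

(** In the derivative of [r sin th - z cos th] the terms [cos th * sin th] cancel. What remains is
    the turning rate times the tangential component of the position vector, so [Q] decreases while
    [|x|] grows. *)
Lemma is_derive_unit_support m t : rect d T m t ->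
  is_derive (unit_support m) t (turn m (r m t) (z m t) (th m t) * unit_radial m t).
Proof.
  intros H.
  assert (Dr := up_dr _ _ _ _ _ HU m t H); assert (Dz := up_dz _ _ _ _ _ HU m t H).
  eapply is_derive_eq.
  - exact (is_derive_minus _ _ _ _ _
      (is_derive_Rmult _ _ _ _ _ Dr (is_derive_sin_th m t H))
      (is_derive_Rmult _ _ _ _ _ Dz (is_derive_cos_th m t H))).
  - unfold unit_radial, minus, plus, opp; simpl; ring.
Qed.

Lemma cos_th_pos m t : Rabs m < d -> 0 < t < T -> 0 < cos (th m t).
Proof.
  intros Hm Ht; replace 0 with (cos (th m 0)) at 1
    by (rewrite (up_th0 _ _ _ _ _ HU m Hm); apply cos_PI2).
  apply (strictly_increasing (fun t => cos (th m t))
    (fun t => - sin (th m t) * turn m (r m t) (z m t) (th m t)) 0 t (proj1 Ht)).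
  - intros s Hs; apply is_derive_cos_th; apply (rect_nonneg m t); lra.
  - intros s Hs; assert (H : rect d T m s) by (apply (rect_nonneg m t); lra).
    generalize (up_sin_pos _ _ _ _ _ HU m s H) (up_turn_neg _ _ _ _ _ HU m s H); nra.
Qed.

Lemma z_increasing m s t : Rabs m < d -> - T < s -> s < t -> t < T -> z m s < z m t.
Proof.
  intros Hm Hs H Ht; apply (strictly_increasing (z m) (fun t => sin (th m t))); trivial.
  - intros x Hx; apply (up_dz _ _ _ _ _ HU); split; trivial; apply Rabs_def1; lra.
  - intros x Hx; apply (up_sin_pos _ _ _ _ _ HU); split; trivial; apply Rabs_def1; lra.
Qed.

Lemma z_pos m t : Rabs m < d -> 0 < t < T -> 0 < z m t.
Proof.
  intros Hm Ht; rewrite <- (up_z0 _ _ _ _ _ HU m Hm); apply z_increasing; lra.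
Qed.

Lemma unit_radial_pos m t : Rabs m < d -> 0 < t < T -> 0 < unit_radial m t.
Proof.
  intros Hm Ht; assert (H : rect d T m t) by (apply (rect_nonneg m t); lra).
  generalize (cos_th_pos m t Hm Ht) (z_pos m t Hm Ht)
    (up_r_pos _ _ _ _ _ HU m t H) (up_sin_pos _ _ _ _ _ HU m t H); unfold unit_radial; intros.
  apply Rplus_lt_0_compat; now apply Rmult_lt_0_compat.
Qed.

Lemma unit_sqdist_increasing m s t : Rabs m < d -> 0 <= s -> s < t -> t < T -> unit_sqdist m s < unit_sqdist m t.
Proof.
  intros Hm Hs H Ht; apply (strictly_increasing (unit_sqdist m) (fun t => 2 * unit_radial m t)); trivial.
  - intros x Hx; apply is_derive_unit_sqdist, (rect_nonneg m t); lra.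
  - intros x Hx; generalize (unit_radial_pos m x Hm); lra.
Qed.

Lemma unit_support_decreasing m s t : Rabs m < d -> 0 <= s -> s < t -> t < T -> unit_support m t < unit_support m s.
Proof.
  intros Hm Hs H Ht; apply Ropp_lt_cancel.
  apply (strictly_increasing (fun t => - unit_support m t)
    (fun t => - (turn m (r m t) (z m t) (th m t) * unit_radial m t))); trivial.
  - intros x Hx; apply (is_derive_opp (unit_support m)); apply is_derive_unit_support, (rect_nonneg m t); lra.
  - intros x Hx; assert (Hr : rect d T m x) by (apply (rect_nonneg m t); lra).
    generalize (unit_radial_pos m x Hm ltac:(lra)) (up_turn_neg _ _ _ _ _ HU m x Hr); nra.
Qed.

Lemma unit_sqdist_0 m : Rabs m < d -> unit_sqdist m 0 = 1.
Proof.
  intros Hm; unfold unit_sqdist; rewrite (up_r0 _ _ _ _ _ HU), (up_z0 _ _ _ _ _ HU) by trivial; ring.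
Qed.

Lemma unit_support_0 m : Rabs m < d -> unit_support m 0 = 1.
Proof.
  intros Hm; unfold unit_support, support.
  rewrite (up_r0 _ _ _ _ _ HU), (up_z0 _ _ _ _ _ HU), (up_th0 _ _ _ _ _ HU), sin_PI2 by trivial.
  ring.
Qed.

Lemma smooth_unit_sqdist : smooth2 (rect d T) unit_sqdist.
Proof.
  intros k; unfold unit_sqdist; apply Ck_plus; apply Ck_pow;
    first [apply (up_smooth_r _ _ _ _ _ HU)|apply (up_smooth_z _ _ _ _ _ HU)].
Qed.

Lemma smooth_unit_support : smooth2 (rect d T) unit_support.
Proof.
  intros k; unfold unit_support, support.
  assert (O : open2 (fun _ _ => True)).
  { intros x y _; now apply locally_2d_forall. }
  assert (C : forall f, Ck k (fun _ _ => True) (fun _ y => f y) ->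
    Ck k (rect d T) (fun m t => f (th m t))).
  { intros f Hf; apply (Ck_comp k (fun _ _ => True) _ (fun _ y => f y) (fun x _ => x) th); trivial.
    - apply Ck_fst.
    - apply (up_smooth_th _ _ _ _ _ HU). }
  apply Ck_minus; apply Ck_mult; try apply C; try apply Ck_cos_sin;
    first [apply (up_smooth_r _ _ _ _ _ HU)|apply (up_smooth_z _ _ _ _ _ HU)].
Qed.

(** * Transfer to the maximal profile by scaling *)

Section Scaling.
Hypothesis PT : 0 < T.
Variables (c a : R).
Hypothesis Pa : 0 < a.
Hypothesis Hm : Rabs (c * a ^ 2) < d.

Lemma scaled_agree s : 0 <= s < a * T ->
  rho (the_profile c a) s = a * r (c * a ^ 2) (s / a) /\
  zed (the_profile c a) s = a * z (c * a ^ 2) (s / a) /\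
  theta (the_profile c a) s = th (c * a ^ 2) (s / a) /\
  Rbar_lt s (pend (the_profile c a)).
Proof.
  intros Hs.
  assert (PaT : 0 < a * T) by now apply Rmult_lt_0_compat.
  destruct (the_profile_spec c a _ Pa (scaled_profile d T r z th c a HU PT Pa Hm) PaT) as [H1 H2].
  destruct (H2 s (proj1 Hs) (proj2 Hs)) as [E1 [E2 E3]]; cbn [rho zed theta pend] in *.
  repeat split; trivial.
  apply Rbar_lt_le_trans with (a * T); trivial; apply Hs.
Qed.

Lemma sqdist_scaled s : 0 <= s < a * T -> sqdist c a s = a ^ 2 * unit_sqdist (c * a ^ 2) (s / a).
Proof.
  intros Hs; destruct (scaled_agree s Hs) as [E1 [E2 _]]; unfold sqdist, unit_sqdist; rewrite E1, E2; ring.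
Qed.

Variables (Rad tau : R).
Hypothesis Ht : 0 < tau < T.
Hypothesis Hit : a ^ 2 * unit_sqdist (c * a ^ 2) tau = Rad ^ 2.

Lemma tau_range : 0 < a * tau < a * T.
Proof. split; [apply Rmult_lt_0_compat|apply Rmult_lt_compat_l]; lra. Qed.

Lemma tau_cancel : a * tau / a = tau.
Proof. field; lra. Qed.

(** Strict growth of [|x|^2] excludes a hit before [a * tau], so the known hit is the infimum,
    whatever the maximal profile does afterwards. *)
Lemma shooting_time_scaled : shooting_time Rad c a = Finite (a * tau).
Proof.
  assert (Rt := tau_range).
  apply is_glb_Rbar_unique; split.
  - intros s [Hs [_ E]]; simpl; apply Rnot_lt_le; intros H.
    rewrite sqdist_scaled, <- Hit in E by lra.
    apply Rmult_eq_reg_l in E; [|apply Rgt_not_eq, pow_lt; lra].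
    assert (X := unit_sqdist_increasing (c * a ^ 2) (s / a) tau Hm).
    assert (s / a < tau).
    { apply Rmult_lt_reg_r with a; trivial; replace (s / a * a) with s by (field; lra); lra. }
    assert (0 <= s / a) by (apply Rdiv_le_0_compat; lra).
    lra.
  - intros b Hb; apply Hb; split; [lra|split].
    + apply scaled_agree; lra.
    + rewrite sqdist_scaled, tau_cancel by lra; exact Hit.
Qed.

Lemma shooting_length_scaled : shooting_length Rad c a = a * tau.
Proof. unfold shooting_length; now rewrite shooting_time_scaled. Qed.

Lemma shooting_domain_scaled : a < Rad -> shooting_domain Rad c a.
Proof.
  intros HR; assert (Rt := tau_range); split; [lra|split].
  - rewrite shooting_time_scaled; exact Logic.I.
  - rewrite shooting_length_scaled.
    assert (Da : is_derive (fun s => s / a) (a * tau) (/ a)) by (auto_derive; trivial; field; lra).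
    assert (H : rect d T (c * a ^ 2) (a * tau / a)) by (rewrite tau_cancel; apply (rect_nonneg _ tau); lra).
    assert (D : is_derive (sqdist c a) (a * tau) (a ^ 2 * (2 * unit_radial (c * a ^ 2) (a * tau / a) * / a))).
    { apply (is_derive_ext_loc (fun s => a ^ 2 * unit_sqdist (c * a ^ 2) (s / a))).
      - generalize (filter_and _ _ (open_gt 0 _ (proj1 Rt)) (open_lt (a * T) _ (proj2 Rt))).
        apply filter_imp; intros s [H1 H2]; symmetry; apply sqdist_scaled; lra.
      - apply (is_derive_scal (fun s => unit_sqdist (c * a ^ 2) (s / a))).
        apply (is_derive_Rcomp (unit_sqdist (c * a ^ 2)) (fun s => s / a)); trivial; now apply is_derive_unit_sqdist. }
    rewrite (is_derive_unique _ _ _ D), tau_cancel.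
    assert (0 < unit_radial (c * a ^ 2) tau) by (apply unit_radial_pos; lra).
    assert (0 < / a) by now apply Rinv_0_lt_compat.
    repeat apply Rmult_lt_0_compat; try lra.
Qed.

Lemma Qhat_scaled : Qhat Rad c a = a * unit_support (c * a ^ 2) tau.
Proof.
  assert (Rt := tau_range); unfold Qhat; rewrite shooting_length_scaled.
  destruct (scaled_agree (a * tau)) as [E1 [E2 [E3 _]]]; [lra|].
  rewrite E1, E2, E3, tau_cancel; unfold unit_support, support; ring.
Qed.

End Scaling.
End UnitProfiles.

(** * Neck radii of the shooting roots *)

Lemma continuous_of_2d_fst (f : R -> R -> R) (x y : R) :
  continuity_2d_pt f x y -> continuous (fun u => f u y) x.
Proof.
  intros H; apply filterlim_locally; intros e.
  exact (locally_2d_1d_const_y _ _ _ (H e)).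
Qed.

Lemma locally_2d_gt (f : R -> R -> R) (x y v : R) :
  continuity_2d_pt f x y -> v < f x y -> locally_2d (fun u w => v < f u w) x y.
Proof.
  intros H Hv; assert (P : 0 < f x y - v) by lra.
  generalize (H (mkposreal _ P)); apply locally_2d_impl, locally_2d_forall.
  simpl; intros u w B; apply Rabs_def2 in B; lra.
Qed.

Lemma Rabs_lt_open (d : R) : open (fun x => Rabs x < d).
Proof. exact (locally_Rabs_lt d). Qed.

Section Necks.
Variables (d T T1 : R) (r z th : R -> R -> R).
Hypothesis PT1 : 0 < T1 < T.
Hypothesis HU : unit_profiles d T r z th.
Hypothesis Hd : 0 < d.
Hypothesis H1 : forall m, Rabs m < d -> unit_support r z th m T1 < 0.
Let sqd := unit_sqdist r z.
Let supf := unit_support r z th.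

Let PT : 0 < T := Rlt_trans _ _ _ (proj1 PT1) (proj2 PT1).

(** The interval [[0, T1]] brackets the zero uniformly in [m]: [Q] is 1 at its start and negative at
    its end. The implicit function argument applies because [Q'] is the product of a negative
    turning rate and a positive radial component. *)
Lemma unit_support_root : exists sg : R -> R,
  (forall m, Rabs m < d -> 0 < sg m < T1 /\ supf m (sg m) = 0) /\
  (forall m t, Rabs m < d -> 0 <= t < T -> supf m t = 0 -> t = sg m) /\
  smooth2 (fun m _ => Rabs m < d) (fun m _ => sg m).
Proof.
  assert (Dec := unit_support_decreasing d T r z th HU).
  assert (Ex : forall m, exists t, Rabs m < d -> 0 < t < T1 /\ supf m t = 0).
  { intros m; destruct (Rlt_dec (Rabs m) d) as [Hm|Hm]; [|now exists 0].
    destruct (intermediate_value (fun t => - supf m t) 0 T1 0) as [t [Ht E]].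
    - lra.
    - intros t Ht; apply (continuous_opp (supf m)).
      eapply is_derive_continuous, (is_derive_unit_support d T r z th HU).
      apply (rect_nonneg d T m T1); lra.
    - unfold supf; rewrite (unit_support_0 d T r z th HU) by trivial; specialize (H1 m Hm); lra.
    - exists t; intros _; split; [trivial|lra]. }
  set (sg m := proj1_sig (constructive_indefinite_description _ (Ex m))).
  assert (Hs : forall m, Rabs m < d -> 0 < sg m < T1 /\ supf m (sg m) = 0).
  { intros m; unfold sg; destruct (constructive_indefinite_description _ _); trivial. }
  exists sg; split; [trivial|split].
  - intros m t Hm Ht E; destruct (Hs m Hm) as [S1 S2].
    destruct (Rtotal_order t (sg m)) as [L|[L|L]]; trivial; exfalso.
    + assert (X := Dec m t (sg m) Hm ltac:(lra) L ltac:(lra)); fold supf in X; lra.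
    + assert (X := Dec m (sg m) t Hm ltac:(lra) L ltac:(lra)); fold supf in X; lra.
  - apply (Ck_implicit (fun m => Rabs m < d) (rect d T) supf).
    + apply Rabs_lt_open.
    + apply open2_rect.
    + apply smooth_unit_support; trivial.
    + intros m Hm; destruct (Hs m Hm) as [S1 S2].
      assert (Hr : rect d T m (sg m)) by (apply (rect_nonneg d T m T1); lra).
      split4; trivial.
      * apply (root_continuous (fun m => Rabs m < d) supf sg 0 T1); trivial.
        -- apply Rabs_lt_open.
        -- intros m' t t' Hm' Ht Htt Ht'; apply (Dec m'); trivial; lra.
        -- intros m' t Hm' Ht; apply continuous_of_2d_fst.
           apply (Ck_cont 0 (rect d T)); [apply (smooth_unit_support d T r z th HU)|].
           apply (rect_nonneg d T m' T1); lra.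
      * eexists; split; [|apply (is_derive_unit_support d T r z th HU m (sg m) Hr)].
        apply Rmult_integral_contrapositive_currified.
        -- apply Rlt_not_eq, (up_turn_neg _ _ _ _ _ HU m (sg m) Hr).
        -- apply Rgt_not_eq, (unit_radial_pos d T r z th HU); lra.
Qed.

Variable sg : R -> R.
Hypothesis Hsg : forall m, Rabs m < d -> 0 < sg m < T1 /\ supf m (sg m) = 0.
Hypothesis Hsu : forall m t, Rabs m < d -> 0 <= t < T -> supf m t = 0 -> t = sg m.
Hypothesis Ssg : smooth2 (fun m _ => Rabs m < d) (fun m _ => sg m).

Definition exit_size (m : R) : R := sqd m (sg m).

Lemma exit_size_smooth : smooth2 (fun m _ => Rabs m < d) (fun m _ => exit_size m).
Proof.
  intros k; unfold exit_size.
  apply (Ck_comp k (rect d T) _ sqd (fun m _ => m) (fun m _ => sg m)).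
  - apply open2_rect.
  - intros m _ Hm; apply (rect_nonneg d T m T1); destruct (Hsg m Hm); lra.
  - apply (smooth_unit_sqdist d T r z th HU).
  - apply Ck_fst.
  - apply Ssg.
Qed.

Lemma exit_size_gt_1 m : Rabs m < d -> 1 < exit_size m.
Proof.
  intros Hm; destruct (Hsg m Hm) as [S1 _].
  rewrite <- (unit_sqdist_0 d T r z th HU m Hm); apply (unit_sqdist_increasing d T r z th HU); lra.
Qed.

Definition neck_domain (c b : R) : Prop := Rabs (c * b ^ 2) < d.

Lemma continuity_neck_mass c b : continuity_2d_pt (fun c b => c * b ^ 2) c b.
Proof.
  apply (Ck_cont 0 (fun _ _ => True)); trivial.
  apply Ck_mult; [apply Ck_fst|apply Ck_pow, Ck_snd].
Qed.

Lemma open2_neck_domain : open2 neck_domain.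
Proof.
  intros c b H; destruct (locally_Rabs_lt d _ H) as [e He].
  generalize (continuity_neck_mass c b e); apply locally_2d_impl, locally_2d_forall.
  intros u v B; apply He, B.
Qed.

Lemma Ck_neck_mass k : Ck k neck_domain (fun c b => c * b ^ 2).
Proof.
  apply Ck_mult; [apply Ck_fst|apply Ck_pow, Ck_snd].
Qed.

(** The sign makes it decrease in [b], as [root_continuous] expects. *)
Definition gap (Rad c b : R) : R := Rad ^ 2 - b ^ 2 * exit_size (c * b ^ 2).

Lemma gap_smooth Rad : smooth2 neck_domain (gap Rad).
Proof.
  intros k; unfold gap; apply Ck_minus; [apply Ck_const|].
  apply Ck_mult; [apply Ck_pow, Ck_snd|].
  apply (Ck_comp k (fun m _ => Rabs m < d) _ (fun m _ => exit_size m) (fun c b => c * b ^ 2) (fun _ b => b)).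
  - apply open2_fst, Rabs_lt_open.
  - trivial.
  - apply exit_size_smooth.
  - apply Ck_neck_mass.
  - apply Ck_snd.
Qed.

Lemma gap_decreasing_near Rad b0 : 0 < b0 -> neck_domain 0 b0 ->
  locally_2d (fun c b => neck_domain c b /\ exists l, l < 0 /\ is_derive (gap Rad c) b l) 0 b0.
Proof.
  intros Pb H0; destruct (gap_smooth Rad 1%nat) as [_ [_ [gy [_ [Dy [_ Cy]]]]]].
  (* At [c = 0] the parameter [c * b ^ 2] is 0 for every [b], so [gap Rad 0] is an explicit
     quadratic polynomial in [b]. Continuity of the partial derivative carries its sign to nearby
     [(c, b)]. *)
  assert (E : gy 0 b0 = - (2 * b0 * exit_size 0)).
  { rewrite <- (is_derive_unique _ _ _ (Dy 0 b0 H0)).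
    apply is_derive_unique; unfold gap.
    apply (is_derive_ext (fun b => Rad ^ 2 - b ^ 2 * exit_size 0)).
    - intros b; now rewrite Rmult_0_l.
    - auto_derive; trivial; ring. }
  assert (P0 : 1 < exit_size 0) by (apply exit_size_gt_1; rewrite Rabs_R0; lra).
  assert (L := locally_2d_gt (fun c b => - gy c b) 0 b0 0
    (continuity_2d_pt_opp _ _ _ (proj1 Cy _ _ H0))).
  cbv beta in L; rewrite E in L; specialize (L ltac:(nra)).
  generalize (locally_2d_and _ _ _ _ (open2_neck_domain 0 b0 H0) L).
  apply locally_2d_impl, locally_2d_forall; intros c b [B1 B2]; split; trivial.
  exists (gy c b); split; [lra|now apply Dy].
Qed.

(* For [b] near [b0] the curve leaves the ball before arclength [b * T1], so the
   zeros of [gap] are exactly the shooting roots. *)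
Lemma neck_family (Rad b0 : R) : 0 < b0 < Rad -> gap Rad 0 b0 = 0 ->
  exists eps a U, 0 < eps /\ a 0 = b0 /\
    smooth2 (fun c _ => Rabs c < eps) (fun c _ => a c) /\
    (forall c, Rabs c < eps -> 0 < a c < Rad /\ neck_domain c (a c) /\
       a c ^ 2 * sqd (c * a c ^ 2) (sg (c * a c ^ 2)) = Rad ^ 2) /\
    locally b0 U /\ (forall b, U b -> 0 < b < Rad) /\
    forall c, Rabs c < eps -> U (a c) /\ shooting_root Rad c (a c) /\
      forall b, U b -> shooting_root Rad c b -> b = a c.
Proof.
  intros Hb0 G0.
  assert (D0 : neck_domain 0 b0) by (unfold neck_domain; rewrite Rmult_0_l, Rabs_R0; lra).
  assert (D0' : Rabs 0 < d) by (rewrite Rabs_R0; lra).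
  set (far c b := b ^ 2 * sqd (c * b ^ 2) T1).
  assert (Sfar : continuity_2d_pt far 0 b0).
  { apply (Ck_cont 0 neck_domain); trivial; unfold far.
    apply Ck_mult; [apply Ck_pow, Ck_snd|].
    apply (Ck_comp 0 (rect d T) _ sqd (fun c b => c * b ^ 2) (fun _ _ => T1)).
    - apply open2_rect.
    - intros c b H; apply (rect_nonneg d T _ T1); trivial; lra.
    - apply (smooth_unit_sqdist d T r z th HU).
    - apply Ck_neck_mass.
    - apply Ck_const. }
  assert (Lf : locally_2d (fun c b => Rad ^ 2 < far c b) 0 b0).
  { apply locally_2d_gt; trivial.
    assert (X := unit_sqdist_increasing d T r z th HU 0 (sg 0) T1 D0').
    destruct (Hsg 0 D0') as [S1 _].
    unfold gap, exit_size, far, sqd in *; rewrite Rmult_0_l in *.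
    assert (0 < b0 ^ 2) by (apply pow_lt; lra); specialize (X ltac:(lra) ltac:(lra) ltac:(lra)).
    nra. }
  assert (Lb : locally_2d (fun _ b => 0 < b < Rad) 0 b0).
  { assert (P : 0 < Rmin b0 (Rad - b0)) by (apply Rmin_pos; lra).
    exists (mkposreal _ P); intros u v _ Hv; simpl in Hv; apply Rabs_def2 in Hv.
    generalize (Rmin_l b0 (Rad - b0)) (Rmin_r b0 (Rad - b0)); lra. }
  destruct (locally_2d_and _ _ _ _ (gap_decreasing_near Rad b0 (proj1 Hb0) D0)
             (locally_2d_and _ _ _ _ Lf Lb)) as [e He].
  assert (Pe := cond_pos e).
  (* Half of [e], so that the closed interval [[b1, b2]] stays inside the box where the local facts
     hold. *)
  set (b1 := b0 - e / 2); set (b2 := b0 + e / 2).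
  assert (Hn : forall c b, Rabs c < e -> b1 <= b <= b2 ->
    (neck_domain c b /\ (exists l, l < 0 /\ is_derive (gap Rad c) b l)) /\ Rad ^ 2 < far c b /\ 0 < b < Rad).
  { intros c b Hc Hb; apply He; [now rewrite Rminus_0_r|].
    unfold b1, b2 in Hb; apply Rabs_def1; lra. }
  assert (Dec : forall c x y, Rabs c < e -> b1 <= x -> x < y -> y <= b2 -> gap Rad c y < gap Rad c x).
  { intros c x y Hc Hx Hxy Hy; apply Ropp_lt_cancel.
    apply (strictly_increasing (fun b => - gap Rad c b) (fun b => - Derive (gap Rad c) b)); trivial.
    - intros t Ht; destruct (Hn c t Hc) as [[_ [l [Hl Dl]]] _]; [lra|].
      rewrite (is_derive_unique _ _ _ Dl); now apply (is_derive_opp (gap Rad c)).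
    - intros t Ht; destruct (Hn c t Hc) as [[_ [l [Hl Dl]]] _]; [lra|].
      rewrite (is_derive_unique _ _ _ Dl); lra. }
  assert (e0 : Rabs 0 < e) by (rewrite Rabs_R0; lra).
  assert (Cc : forall c b, Rabs c < e -> b1 <= b <= b2 -> continuous (fun c => gap Rad c b) c).
  { intros c b Hc Hb; apply continuous_of_2d_fst, (Ck_cont 0 neck_domain).
    - apply gap_smooth.
    - now apply (Hn c b). }
  assert (G1 : 0 < gap Rad 0 b1).
  { apply Rle_lt_trans with (gap Rad 0 b0); [lra|apply Dec; trivial; unfold b1, b2; lra]. }
  assert (G2 : gap Rad 0 b2 < 0).
  { apply Rlt_le_trans with (gap Rad 0 b0); [apply Dec; trivial; unfold b1, b2; lra|lra]. }
  assert (L1 : locally 0 (fun c => 0 < gap Rad c b1)).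
  { apply (Cc 0 b1 e0 ltac:(unfold b1, b2; lra) (fun v => 0 < v)); now apply (open_gt 0). }
  assert (L2 : locally 0 (fun c => gap Rad c b2 < 0)).
  { apply (Cc 0 b2 e0 ltac:(unfold b1, b2; lra) (fun v => v < 0)); now apply (open_lt 0). }
  destruct (filter_and _ _ L1 L2) as [e' He'].
  set (eps := Rmin e e').
  assert (Peps : 0 < eps) by (apply Rmin_pos; apply cond_pos).
  assert (E1 : forall c, Rabs c < eps -> Rabs c < e) by (intros c Hc; eapply Rlt_le_trans; [exact Hc|apply Rmin_l]).
  assert (E2 : forall c, Rabs c < eps -> 0 < gap Rad c b1 /\ gap Rad c b2 < 0).
  { intros c Hc; apply He'; unfold ball; simpl; unfold AbsRing_ball, abs, minus, plus, opp; simpl.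
    replace (c + - 0) with c by ring; eapply Rlt_le_trans; [exact Hc|apply Rmin_r]. }
  assert (Ex : forall c, exists b, Rabs c < eps -> b1 < b < b2 /\ gap Rad c b = 0).
  { intros c; destruct (Rlt_dec (Rabs c) eps) as [Hc|Hc]; [|now exists 0].
    destruct (intermediate_value (fun b => - gap Rad c b) b1 b2 0) as [b [Hb E]].
    - unfold b1, b2; lra.
    - intros b Hb; apply (continuous_opp (gap Rad c)).
      destruct (Hn c b (E1 c Hc) Hb) as [[_ [l [_ Dl]]] _]; now apply is_derive_continuous with l.
    - generalize (E2 c Hc); lra.
    - exists b; intros _; split; [trivial|lra]. }
  set (a c := proj1_sig (constructive_indefinite_description _ (Ex c))).
  assert (Ha : forall c, Rabs c < eps -> b1 < a c < b2 /\ gap Rad c (a c) = 0).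
  { intros c; unfold a; destruct (constructive_indefinite_description _ _); trivial. }
  assert (Un : forall c b, Rabs c < eps -> b1 < b < b2 -> gap Rad c b = 0 -> b = a c).
  { intros c b Hc Hb E; destruct (Ha c Hc) as [A1 A2].
    destruct (Rtotal_order b (a c)) as [L|[L|L]]; trivial; exfalso.
    - assert (X := Dec c b (a c) (E1 c Hc) ltac:(lra) L ltac:(lra)); lra.
    - assert (X := Dec c (a c) b (E1 c Hc) ltac:(lra) L ltac:(lra)); lra. }
  assert (eps0 : Rabs 0 < eps) by (rewrite Rabs_R0; lra).
  exists eps, a, (fun b => b1 < b < b2).
  split; [trivial|split; [symmetry; apply Un; trivial; unfold b1, b2; lra|split; [|split; [|split; [|split]]]]].
  - apply (Ck_implicit (fun c => Rabs c < eps) neck_domain (gap Rad)).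
    + apply Rabs_lt_open.
    + apply open2_neck_domain.
    + apply gap_smooth.
    + intros c Hc; destruct (Ha c Hc) as [A1 A2].
      destruct (Hn c (a c) (E1 c Hc) ltac:(lra)) as [[B1 [l [B2 B3]]] _].
      split4; trivial.
      * apply (root_continuous (fun c => Rabs c < eps) (gap Rad) a b1 b2); trivial.
        -- apply Rabs_lt_open.
        -- intros c' x y Hc' Hx Hxy Hy; apply Dec; auto; lra.
        -- intros c' b Hc' Hb; apply Cc; auto; lra.
      * exists l; split; [lra|trivial].
  - intros c Hc; destruct (Ha c Hc) as [A1 A2].
    destruct (Hn c (a c) (E1 c Hc) ltac:(lra)) as [[B1 _] [_ B3]].
    split; [trivial|split; trivial]; unfold gap, exit_size in A2; lra.
  - assert (P : 0 < e / 2) by lra.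
    exists (mkposreal _ P); intros b Hb; unfold ball in Hb; simpl in Hb.
    unfold AbsRing_ball, abs, minus, plus, opp in Hb; simpl in Hb.
    apply Rabs_def2 in Hb; unfold b1, b2; lra.
  - intros b Hb; apply (Hn 0 b e0); lra.
  - intros c Hc; destruct (Ha c Hc) as [A1 A2]; split; [trivial|split].
    + destruct (Hn c (a c) (E1 c Hc) ltac:(lra)) as [[B1 _] [_ B3]].
      destruct (Hsg _ B1) as [S1 S2].
      assert (Hit : a c ^ 2 * unit_sqdist r z (c * a c ^ 2) (sg (c * a c ^ 2)) = Rad ^ 2)
        by (unfold gap, exit_size, sqd in A2; lra).
      assert (S1' : 0 < sg (c * a c ^ 2) < T) by lra.
      split.
      * apply (shooting_domain_scaled d T r z th HU PT c (a c) (proj1 B3) B1 Rad _ S1' Hit); lra.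
      * rewrite (Qhat_scaled d T r z th HU PT c (a c) (proj1 B3) B1 Rad _ S1' Hit).
        unfold supf in S2; rewrite S2; ring.
    (* For an arbitrary root [b], [|x|^2] rises from [b^2 < Rad^2] to [far c b > Rad^2], so the
       sphere is hit at some unit time [t < T1]. Vanishing of [Qhat] then identifies [t] with the
       zero [sg] of the support function, which makes [b] a zero of [gap]. *)
    + intros b Hb [_ HQ]; apply Un; trivial.
      destruct (Hn c b (E1 c Hc) ltac:(lra)) as [[B1 _] [B2 B3]].
      assert (Pb2 : 0 < b ^ 2) by (apply pow_lt; lra).
      destruct (intermediate_value (sqd (c * b ^ 2)) 0 T1 (Rad ^ 2 / b ^ 2)) as [t [Ht E]].
      * lra.
      * intros t Ht; eapply is_derive_continuous, (is_derive_unit_sqdist d T r z th HU).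
        apply (rect_nonneg d T _ T1); trivial; lra.
      * unfold sqd; rewrite (unit_sqdist_0 d T r z th HU) by trivial; split.
        -- apply Rmult_lt_reg_r with (b ^ 2); trivial.
           replace (Rad ^ 2 / b ^ 2 * b ^ 2) with (Rad ^ 2) by (field; lra).
           rewrite Rmult_1_l; simpl; rewrite !Rmult_1_r; apply Rmult_le_0_lt_compat; lra.
        -- apply Rmult_lt_reg_r with (b ^ 2); trivial.
           replace (Rad ^ 2 / b ^ 2 * b ^ 2) with (Rad ^ 2) by (field; lra).
           unfold far, sqd in B2; lra.
      * assert (Hit : b ^ 2 * unit_sqdist r z (c * b ^ 2) t = Rad ^ 2).
        { unfold sqd in E; rewrite E; field; lra. }
        assert (Ht' : 0 < t < T) by lra.
        rewrite (Qhat_scaled d T r z th HU PT c b (proj1 B3) B1 Rad t Ht' Hit) in HQ.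
        apply Rmult_integral in HQ; destruct HQ as [HQ|HQ]; [lra|].
        assert (Et : t = sg (c * b ^ 2)) by (apply Hsu; trivial; lra).
        unfold gap, exit_size, sqd; rewrite <- Et, Hit; ring.
Qed.

End Necks.

(** * Surfaces of revolution *)

(** A square matrix with orthonormal rows has orthonormal columns. Here the determinant [D]
    satisfies [D^2 = 1], and comparison with the adjugate gives [a = D d] and [c = - D b]. *)
Lemma orthonormal_transpose (a b c d : R) :
  a * a + b * b = 1 -> c * c + d * d = 1 -> a * c + b * d = 0 ->
  a * a + c * c = 1 /\ b * b + d * d = 1 /\ a * b + c * d = 0.
Proof.
  intros H1 H2 H3; set (D := a * d - b * c).
  assert (HD : D * D = 1).
  { replace (D * D) with ((a * a + b * b) * (c * c + d * d) - (a * c + b * d) * (a * c + b * d))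
      by (unfold D; ring).
    rewrite H1, H2, H3; ring. }
  assert (Ha : a = D * d).
  { replace (D * d) with (a * (c * c + d * d) - c * (a * c + b * d)) by (unfold D; ring).
    rewrite H2, H3; ring. }
  assert (Hc : c = - D * b).
  { replace (- D * b) with (c * (a * a + b * b) - a * (a * c + b * d)) by (unfold D; ring).
    rewrite H1, H3; ring. }
  assert (E1 : a * a = d * d).
  { rewrite Ha at 1 2; replace (D * d * (D * d)) with (D * D * (d * d)) by ring; rewrite HD; ring. }
  assert (E2 : c * c = b * b).
  { rewrite Hc at 1 2; replace (- D * b * (- D * b)) with (D * D * (b * b)) by ring; rewrite HD; ring. }
  split; [lra|split; [lra|]].
  rewrite Ha, Hc at 1; ring.
Qed.

Lemma Derive3_val (f : R -> E3) (g1 g2 g3 : R -> R) (t l1 l2 l3 : R) :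
  locally t (fun s => f s = mkE3 (g1 s) (g2 s) (g3 s)) ->
  is_derive g1 t l1 -> is_derive g2 t l2 -> is_derive g3 t l3 ->
  Derive3 f t = mkE3 l1 l2 l3.
Proof.
  intros HL H1 H2 H3; unfold Derive3; f_equal; apply is_derive_unique.
  - apply (is_derive_ext_loc g1); trivial; revert HL; apply filter_imp; now intros s ->.
  - apply (is_derive_ext_loc g2); trivial; revert HL; apply filter_imp; now intros s ->.
  - apply (is_derive_ext_loc g3); trivial; revert HL; apply filter_imp; now intros s ->.
Qed.

Section Revolve.
Variables (r h th kappa : R -> R) (B L : R).
Hypothesis Dr : forall u, Rabs u < B -> is_derive r u (cos (th u)).
Hypothesis Dh : forall u, Rabs u < B -> is_derive h u (sin (th u)).
Hypothesis Dth : forall u, Rabs u < B -> is_derive th u (kappa u).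
Hypothesis Pr : forall u, Rabs u < B -> 0 < r u.
Let X := chart (revolve r h L).

Lemma is_derive_times_cos (k v : R) : is_derive (fun v => k * cos v) v (k * - sin v).
Proof. apply (is_derive_scal cos); apply is_derive_cos. Qed.

Lemma is_derive_times_sin (k v : R) : is_derive (fun v => k * sin v) v (k * cos v).
Proof. apply (is_derive_scal sin); apply is_derive_sin. Qed.

Lemma is_derive_scaled (f : R -> R) (k u l : R) :
  is_derive f u l -> is_derive (fun u => f u * k) u (l * k).
Proof.
  intros H; rewrite (Rmult_comm l); apply (is_derive_ext (fun u => k * f u)).
  - intros t; apply Rmult_comm.
  - now apply (is_derive_scal f).
Qed.

Lemma Du_revolve u v : Rabs u < B ->
  Du X u v = mkE3 (cos (th u) * cos v) (cos (th u) * sin v) (sin (th u)).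
Proof.
  intros H; unfold Du.
  apply (Derive3_val _ (fun t => r t * cos v) (fun t => r t * sin v) h).
  - now apply filter_forall.
  - apply is_derive_scaled; auto.
  - apply is_derive_scaled; auto.
  - auto.
Qed.

Lemma Dv_revolve u v : Dv X u v = mkE3 (r u * - sin v) (r u * cos v) 0.
Proof.
  unfold Dv.
  apply (Derive3_val _ (fun t => r u * cos t) (fun t => r u * sin t) (fun _ => h u)).
  - now apply filter_forall.
  - apply is_derive_times_cos.
  - apply is_derive_times_sin.
  - apply (is_derive_const (V := R_NormedModule)).
Qed.

Lemma is_derive_cos_comp u : Rabs u < B -> is_derive (fun u => cos (th u)) u (- sin (th u) * kappa u).
Proof.
  intros H; rewrite Rmult_comm; apply (is_derive_comp cos th); [apply is_derive_cos|now apply Dth].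
Qed.

Lemma is_derive_sin_comp u : Rabs u < B -> is_derive (fun u => sin (th u)) u (cos (th u) * kappa u).
Proof.
  intros H; rewrite Rmult_comm; apply (is_derive_comp sin th); [apply is_derive_sin|now apply Dth].
Qed.

Lemma DuDu_revolve u v : Rabs u < B ->
  Du (Du X) u v = mkE3 (- sin (th u) * kappa u * cos v) (- sin (th u) * kappa u * sin v)
                       (cos (th u) * kappa u).
Proof.
  intros H; unfold Du at 1.
  apply (Derive3_val _ (fun t => cos (th t) * cos v) (fun t => cos (th t) * sin v)
           (fun t => sin (th t))).
  - generalize (locally_Rabs_lt B u H); apply filter_imp; intros t Ht; now apply Du_revolve.
  - apply (is_derive_scaled (fun t => cos (th t))); now apply is_derive_cos_comp.
  - apply (is_derive_scaled (fun t => cos (th t))); now apply is_derive_cos_comp.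
  - now apply is_derive_sin_comp.
Qed.

Lemma DuDv_revolve u v : Rabs u < B ->
  Du (Dv X) u v = mkE3 (cos (th u) * - sin v) (cos (th u) * cos v) 0.
Proof.
  intros H; unfold Du.
  apply (Derive3_val _ (fun t => r t * - sin v) (fun t => r t * cos v) (fun _ => 0)).
  - apply filter_forall; intros t; apply Dv_revolve.
  - apply is_derive_scaled; auto.
  - apply is_derive_scaled; auto.
  - apply (is_derive_const (V := R_NormedModule)).
Qed.

Lemma DvDu_revolve u v : Rabs u < B ->
  Dv (Du X) u v = mkE3 (cos (th u) * - sin v) (cos (th u) * cos v) 0.
Proof.
  intros H; unfold Dv.
  apply (Derive3_val _ (fun t => cos (th u) * cos t) (fun t => cos (th u) * sin t)
           (fun _ => sin (th u))).
  - apply filter_forall; intros t; now apply Du_revolve.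
  - apply is_derive_times_cos.
  - apply is_derive_times_sin.
  - apply (is_derive_const (V := R_NormedModule)).
Qed.

Lemma DvDv_revolve u v : Dv (Dv X) u v = mkE3 (r u * - cos v) (r u * - sin v) 0.
Proof.
  unfold Dv at 1.
  apply (Derive3_val _ (fun t => r u * - sin t) (fun t => r u * cos t) (fun _ => 0)).
  - apply filter_forall; intros t; apply Dv_revolve.
  - apply (is_derive_scal (fun t => - sin t)); apply (is_derive_opp sin); apply is_derive_sin.
  - apply is_derive_times_cos.
  - apply (is_derive_const (V := R_NormedModule)).
Qed.

Definition revolve_normal u v : E3 := mkE3 (- sin (th u) * cos v) (- sin (th u) * sin v) (cos (th u)).

Lemma sin_mul_sin (x : R) : sin x * sin x = 1 - cos x * cos x.
Proof. generalize (sin2_cos2 x); unfold Rsqr; lra. Qed.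

Lemma cross_revolve u v : Rabs u < B ->
  cross (Du X u v) (Dv X u v) = mulv (r u) (revolve_normal u v).
Proof.
  intros H; rewrite Du_revolve, Dv_revolve by trivial.
  unfold cross, mulv, revolve_normal, mkE3, cx, cy, cz; simpl; f_equal; [f_equal; ring|].
  replace (_ - _) with (r u * cos (th u) * (cos v * cos v + sin v * sin v)) by ring.
  rewrite sin_mul_sin; ring.
Qed.

Lemma dot_revolve_normal u v : dot (revolve_normal u v) (revolve_normal u v) = 1.
Proof.
  unfold dot, revolve_normal, mkE3, cx, cy, cz; simpl.
  replace (_ + _) with (sin (th u) * sin (th u) * (cos v * cos v + sin v * sin v) +
    cos (th u) * cos (th u)) by ring.
  rewrite !sin_mul_sin; ring.
Qed.

Lemma dot_mulv k l p q : dot (mulv k p) (mulv l q) = k * l * dot p q.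
Proof. unfold dot, mulv, mkE3, cx, cy, cz; simpl; ring. Qed.

Lemma mulv_mulv k l p : mulv k (mulv l p) = mulv (k * l) p.
Proof. unfold mulv, mkE3, cx, cy, cz; simpl; f_equal; [f_equal; ring|ring]. Qed.

Lemma unit_normal_revolve u v : Rabs u < B -> unit_normal X u v = revolve_normal u v.
Proof.
  intros H; unfold unit_normal; rewrite cross_revolve, dot_mulv, dot_revolve_normal, Rmult_1_r by trivial.
  assert (P := Pr u H); rewrite sqrt_square by lra.
  rewrite mulv_mulv, Rinv_l by lra.
  unfold mulv, revolve_normal, mkE3, cx, cy, cz; simpl; f_equal; [f_equal; ring|ring].
Qed.

(** The principal curvatures are [kappa] and [sin th / r]. Since [Dv X] has length [r], the second
    enters multiplied by [r ^ 2] in these coordinates. *)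
Definition second_coef (u : R) (e f : R * R) : R :=
  kappa u * (fst e * fst f) + r u * sin (th u) * (snd e * snd f).

Lemma second_form_revolve u v e f : Rabs u < B ->
  second_form X u v e f = mulv (second_coef u e f) (revolve_normal u v).
Proof.
  intros H; unfold second_form, normal_proj; rewrite unit_normal_revolve by trivial.
  f_equal; unfold hessian.
  rewrite DuDu_revolve, DuDv_revolve, DvDu_revolve, DvDv_revolve by trivial.
  unfold dot, addv, mulv, revolve_normal, second_coef, mkE3, cx, cy, cz; simpl.
  replace (_ + _) with
    (fst e * fst f * kappa u *
       (sin (th u) * sin (th u) * (cos v * cos v + sin v * sin v) + cos (th u) * cos (th u)) +
     r u * sin (th u) * (snd e * snd f) * (cos v * cos v + sin v * sin v)) by ring.
  rewrite !sin_mul_sin; ring.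
Qed.

(** This is minus the product of the position vector with [revolve_normal]; the sign agrees with
    [support]. *)
Definition support_along (u : R) : R := r u * sin (th u) - h u * cos (th u).

Lemma dot_chart_revolve_normal u v : dot (X u v) (revolve_normal u v) = - support_along u.
Proof.
  unfold X, revolve, dot, revolve_normal, support_along, mkE3, cx, cy, cz; simpl.
  replace (_ + _) with
    (- (r u * sin (th u) * (cos v * cos v + sin v * sin v)) + h u * cos (th u)) by ring.
  rewrite sin_mul_sin; ring.
Qed.

Lemma xperp_revolve u v : Rabs u < B -> xperp X u v = mulv (- support_along u) (revolve_normal u v).
Proof.
  intros H; unfold xperp, normal_proj.
  now rewrite unit_normal_revolve, dot_chart_revolve_normal by trivial.
Qed.

(** Once the second coordinates are rescaled by [r], the frame is an orthonormal pair of rows.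
    Traces over the frame involve sums down the columns, whence the transposition. *)
Lemma frame_revolve u v e1 e2 : Rabs u < B -> orthonormal_frame X u v e1 e2 ->
  let b := r u * snd e1 in let d := r u * snd e2 in
  fst e1 * fst e1 + fst e2 * fst e2 = 1 /\ b * b + d * d = 1 /\ fst e1 * b + fst e2 * d = 0.
Proof.
  intros H [F1 [F2 F3]].
  assert (M : forall e f, dot (tangent X u v e) (tangent X u v f) =
    fst e * fst f + r u * snd e * (r u * snd f)).
  { intros e f; unfold tangent; rewrite Du_revolve, Dv_revolve by trivial.
    unfold dot, addv, mulv, mkE3, cx, cy, cz; simpl.
    replace (_ + _) with (fst e * fst f * (sin (th u) * sin (th u) +
      cos (th u) * cos (th u) * (cos v * cos v + sin v * sin v)) +
      r u * snd e * (r u * snd f) * (cos v * cos v + sin v * sin v)) by ring.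
    rewrite !sin_mul_sin; ring. }
  rewrite M in F1, F2, F3; now apply orthonormal_transpose.
Qed.

Lemma mean_curvature_revolve u v e1 e2 : Rabs u < B -> orthonormal_frame X u v e1 e2 ->
  mean_curvature X u v e1 e2 = mulv (kappa u + sin (th u) / r u) (revolve_normal u v).
Proof.
  intros H F; destruct (frame_revolve u v e1 e2 H F) as [F1 [F2 _]].
  unfold mean_curvature; rewrite !second_form_revolve by trivial.
  assert (P := Pr u H).
  replace (kappa u + sin (th u) / r u) with (second_coef u e1 e1 + second_coef u e2 e2).
  - unfold addv, mulv, mkE3, cx, cy, cz; simpl; f_equal; [f_equal; ring|ring].
  - unfold second_coef.
    rewrite <- (Rmult_1_r (kappa u)) at 3; rewrite <- F1.
    rewrite <- (Rmult_1_r (sin (th u) / r u)); rewrite <- F2; field; lra.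
Qed.

Lemma normsq_A_xperp_revolve u v e1 e2 : Rabs u < B -> orthonormal_frame X u v e1 e2 ->
  normsq_A_xperp X u v e1 e2 = support_along u ^ 2 * (kappa u ^ 2 + (sin (th u) / r u) ^ 2).
Proof.
  intros H F; destruct (frame_revolve u v e1 e2 H F) as [F1 [F2 F3]].
  assert (P := Pr u H).
  assert (A : forall e f, A_xperp X u v e f =
    - support_along u * (kappa u * (fst e * fst f) + sin (th u) / r u * ((r u * snd e) * (r u * snd f)))).
  { intros e f; unfold A_xperp; rewrite xperp_revolve, second_form_revolve by trivial.
    rewrite dot_mulv, dot_revolve_normal; unfold second_coef; field; lra. }
  unfold normsq_A_xperp; rewrite !A.
  set (b := r u * snd e1) in *; set (d := r u * snd e2) in *; set (q := sin (th u) / r u).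
  clearbody b d q.
  (* The sum over the frame, regrouped by the products of the columns of the frame matrix, which
     [F1], [F2] and [F3] evaluate. *)
  replace (_ + _) with (support_along u ^ 2 *
    (kappa u ^ 2 * (fst e1 * fst e1 + fst e2 * fst e2) ^ 2 +
     2 * kappa u * q * (fst e1 * b + fst e2 * d) ^ 2 + q ^ 2 * (b * b + d * d) ^ 2)) by ring.
  rewrite F1, F2, F3; ring.
Qed.

Lemma dot_revolve u v : dot (X u v) (X u v) = r u ^ 2 + h u ^ 2.
Proof.
  unfold X, revolve, dot, mkE3, cx, cy, cz; simpl.
  replace (_ + _) with (r u * r u * (cos v * cos v + sin v * sin v) + h u * h u) by ring.
  rewrite sin_mul_sin; ring.
Qed.

End Revolve.

Lemma same_angle (v w : R) : cos v = cos w -> sin v = sin w -> exists k : Z, w = v + 2 * IZR k * PI.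
Proof.
  intros Hc Hs.
  assert (E : cos (w - v) = 1) by (rewrite cos_minus, Hc, Hs, sin_mul_sin; ring).
  replace (w - v) with (2 * ((w - v) / 2)) in E by field.
  rewrite cos_2a_sin in E.
  assert (S : sin ((w - v) / 2) = 0) by nra.
  apply sin_eq_0_0 in S; destruct S as [k Hk]; exists k; lra.
Qed.

(** * The annulus of a shooting root *)

Lemma pinching (c Q lam kap : R) : kap + lam = c * Q ->
  Q ^ 2 * (kap ^ 2 + lam ^ 2) - (1 + (1 - c * Q ^ 2) ^ 2) =
  2 * (Q * lam - 1) * (Q * lam + 1 - c * Q ^ 2).
Proof. intros H; replace kap with (c * Q - lam) by lra; ring. Qed.

Section Annulus.
Variables (d T : R) (r z th : R -> R -> R) (c a Rad tau : R).
Hypothesis HU : unit_profiles d T r z th.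
Hypothesis PT : 0 < T.
Hypothesis Hd : d <= / 2.
Hypothesis Pa : 0 < a.
Hypothesis Hm : Rabs (c * a ^ 2) < d.
Hypothesis Ht : 0 < tau < T.
Hypothesis Hit : a ^ 2 * unit_sqdist r z (c * a ^ 2) tau = Rad ^ 2.
Hypothesis Hq : unit_support r z th (c * a ^ 2) tau = 0.

Let m := c * a ^ 2.
Let S := rotational_annulus Rad c a.
Let ang u := th m (u / a).
Let curv u := / a * turn m (r m (u / a)) (z m (u / a)) (th m (u / a)).

Lemma halflen_annulus : halflen S = a * tau.
Proof. exact (shooting_length_scaled d T r z th HU PT c a Pa Hm Rad tau Ht Hit). Qed.

Lemma scaled_rect u : Rabs u < a * T -> rect d T m (u / a).
Proof.
  intros Hu; split; trivial; unfold Rdiv; rewrite Rabs_mult, (Rabs_pos_eq (/ a)).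
  - apply Rmult_lt_reg_r with a; trivial; rewrite Rmult_assoc, Rinv_l; lra.
  - left; now apply Rinv_0_lt_compat.
Qed.

Lemma strip_lt u v : strip S u v -> Rabs u < a * T.
Proof.
  unfold strip; rewrite halflen_annulus; intros H; eapply Rle_lt_trans; [exact H|].
  apply Rmult_lt_compat_l; lra.
Qed.

(** Evenness of [r] and oddness of [z] identify the reflected half with the unit profile at negative
    times, so the definition by [Rabs] and [sign] agrees with a smooth formula through the neck. At
    0, where [sign] is 0, [z] vanishes as well. *)
Lemma refl_eq u : Rabs u < a * T ->
  refl_rho c a u = a * r m (u / a) /\ refl_zed c a u = a * z m (u / a).
Proof.
  intros Hu; assert (Hr := scaled_rect u Hu).
  destruct (scaled_agree d T r z th HU PT c a Pa Hm (Rabs u)) as [E1 [E2 _]].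
  { split; [apply Rabs_pos|trivial]. }
  unfold refl_rho, refl_zed; rewrite E1, E2; fold m.
  destruct (Rle_dec 0 u) as [P|P].
  - rewrite Rabs_pos_eq by lra; split; trivial.
    destruct (Rle_lt_or_eq_dec 0 u P) as [Q|<-].
    + rewrite sign_eq_1 by trivial; ring.
    + rewrite sign_0; replace (0 / a) with 0 by (field; lra).
      rewrite (up_z0 _ _ _ _ _ HU) by trivial; ring.
  - rewrite Rabs_left by lra; replace (- u / a) with (- (u / a)) by (field; lra).
    rewrite sign_eq_m1, (up_even _ _ _ _ _ HU), (up_odd _ _ _ _ _ HU) by (trivial; lra).
    split; ring.
Qed.

Lemma is_derive_div u : is_derive (fun u => u / a) u (/ a).
Proof. auto_derive; trivial; field; lra. Qed.

Lemma is_derive_scaled_comp (f g : R -> R) u l : Rabs u < a * T ->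
  (forall u, Rabs u < a * T -> g u = a * f (u / a)) ->
  is_derive f (u / a) l -> is_derive g u l.
Proof.
  intros Hu E D; apply (is_derive_ext_loc (fun u => a * f (u / a))).
  - generalize (locally_Rabs_lt (a * T) u Hu); apply filter_imp; intros t Hx; symmetry; auto.
  - apply is_derive_eq with (a * (l * / a)); [|field; lra].
    apply (is_derive_scal (fun u => f (u / a))).
    apply (is_derive_Rcomp f (fun u => u / a)); trivial; apply is_derive_div.
Qed.

Lemma refl_rho_derive u : Rabs u < a * T -> is_derive (refl_rho c a) u (cos (ang u)).
Proof.
  intros Hu; apply (is_derive_scaled_comp (r m)); trivial.
  - intros; now apply refl_eq.
  - now apply (up_dr _ _ _ _ _ HU), scaled_rect.
Qed.

Lemma refl_zed_derive u : Rabs u < a * T -> is_derive (refl_zed c a) u (sin (ang u)).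
Proof.
  intros Hu; apply (is_derive_scaled_comp (z m)); trivial.
  - intros; now apply refl_eq.
  - now apply (up_dz _ _ _ _ _ HU), scaled_rect.
Qed.

Lemma ang_derive u : Rabs u < a * T -> is_derive ang u (curv u).
Proof.
  intros Hu; unfold curv; rewrite Rmult_comm.
  apply (is_derive_Rcomp (th m) (fun u => u / a)); [|apply is_derive_div].
  now apply (up_dth _ _ _ _ _ HU), scaled_rect.
Qed.

Lemma refl_rho_pos u : Rabs u < a * T -> 0 < refl_rho c a u.
Proof.
  intros Hu; destruct (refl_eq u Hu) as [-> _]; apply Rmult_lt_0_compat; trivial.
  now apply (up_r_pos _ _ _ _ _ HU), scaled_rect.
Qed.

Let support_at u := support_along (refl_rho c a) (refl_zed c a) ang u.

Lemma support_at_scaled u : Rabs u < a * T -> support_at u = a * unit_support r z th m (u / a).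
Proof.
  intros Hu; destruct (refl_eq u Hu) as [E1 E2]; unfold support_at, support_along; rewrite E1, E2.
  unfold unit_support, support, ang; ring.
Qed.

Lemma curv_sum u : Rabs u < a * T ->
  curv u + sin (ang u) / refl_rho c a u = c * support_at u.
Proof.
  intros Hu; rewrite support_at_scaled by trivial; destruct (refl_eq u Hu) as [-> _].
  assert (P := up_r_pos _ _ _ _ _ HU _ _ (scaled_rect u Hu)).
  unfold curv, turn, ang, unit_support, m in *; field; split; lra.
Qed.

Lemma unit_even t : rect d T m t -> unit_support r z th m (- t) = unit_support r z th m t /\
  sin (th m (- t)) = sin (th m t) /\ r m (- t) = r m t /\ unit_sqdist r z m (- t) = unit_sqdist r z m t.
Proof.
  intros H; unfold unit_support, support, unit_sqdist.
  rewrite (up_even _ _ _ _ _ HU), (up_odd _ _ _ _ _ HU), (up_flip _ _ _ _ _ HU) by trivial.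
  assert (E1 : sin (PI - th m t) = sin (th m t)) by apply sin_PI_x.
  assert (E2 : cos (PI - th m t) = - cos (th m t)).
  { rewrite cos_minus, cos_PI, sin_PI; ring. }
  rewrite E1, E2; split4; trivial; ring.
Qed.

(** It reduces the estimates to nonnegative arclength, where the monotonicity lemmas hold. *)
Lemma abs_eval t : rect d T m t -> unit_support r z th m t = unit_support r z th m (Rabs t) /\
  sin (th m t) = sin (th m (Rabs t)) /\ r m t = r m (Rabs t) /\ unit_sqdist r z m t = unit_sqdist r z m (Rabs t).
Proof.
  intros H; destruct (Rle_dec 0 t).
  - rewrite Rabs_pos_eq by lra; auto.
  - rewrite Rabs_left by lra; destruct (unit_even t H) as [E1 [E2 [E3 E4]]]; auto.
Qed.

Lemma strip_scaled u v : strip S u v -> rect d T m (u / a) /\ 0 <= Rabs (u / a) <= tau.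
Proof.
  intros H; split; [now apply scaled_rect, strip_lt with v|split; [apply Rabs_pos|]].
  unfold strip in H; rewrite halflen_annulus in H.
  unfold Rdiv; rewrite Rabs_mult, (Rabs_pos_eq (/ a)) by (left; now apply Rinv_0_lt_compat).
  apply Rmult_le_reg_r with a; trivial; rewrite Rmult_assoc, Rinv_l; lra.
Qed.

Lemma unit_support_range u v : strip S u v -> 0 <= unit_support r z th m (u / a) <= 1.
Proof.
  intros H; destruct (strip_scaled u v H) as [H1 H2].
  destruct (abs_eval _ H1) as [-> _]; set (t := Rabs (u / a)) in *.
  assert (S0 := unit_support_0 d T r z th HU m Hm).
  assert (Dec := fun x y => unit_support_decreasing d T r z th HU m x y Hm).
  destruct (proj1 H2) as [P0|<-]; [|lra].
  assert (X := Dec 0 t ltac:(lra) P0 ltac:(lra)).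
  destruct (proj2 H2) as [P1|P1].
  - assert (Y := Dec t tau ltac:(lra) P1 ltac:(lra)); fold m in Hq; lra.
  - rewrite P1 in *; fold m in Hq; lra.
Qed.

(** The product of support function and rotational curvature, [k = Q sin theta / rho], computed on
    the unit profile because it is invariant under scaling. *)
Definition slant u : R := unit_support r z th m (u / a) * sin (th m (u / a)) / r m (u / a).

Lemma slant_bounds u v : strip S u v ->
  (u = 0 -> slant u = 1) /\ (u <> 0 -> 0 <= slant u < 1).
Proof.
  intros H; assert (Q := unit_support_range u v H); destruct (strip_scaled u v H) as [H1 H2].
  assert (P := up_r_pos _ _ _ _ _ HU _ _ H1); assert (P' := up_sin_pos _ _ _ _ _ HU _ _ H1).
  split; intros Hu; unfold slant.
  - subst u; replace (0 / a) with 0 in * by (field; lra).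
    rewrite (unit_support_0 d T r z th HU), (up_th0 _ _ _ _ _ HU), (up_r0 _ _ _ _ _ HU), sin_PI2 by trivial.
    field.
  - destruct (abs_eval _ H1) as [E1 [E2 [E3 _]]]; rewrite E1, E2, E3 in *.
    set (t := Rabs (u / a)) in *.
    assert (P0 : 0 < t).
    { apply Rabs_pos_lt, Rmult_integral_contrapositive_currified; trivial.
      apply Rgt_not_eq; now apply Rinv_0_lt_compat. }
    split; [apply Rdiv_le_0_compat; trivial; apply Rmult_le_pos; lra|].
    apply Rmult_lt_reg_r with (r m t); trivial.
    unfold Rdiv; rewrite Rmult_assoc, Rinv_l, Rmult_1_r, Rmult_1_l by lra.
    assert (C := cos_th_pos d T r z th HU m t Hm ltac:(lra)).
    assert (Z := z_pos d T r z th HU m t Hm ltac:(lra)).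
    unfold unit_support, support.
    replace ((r m t * sin (th m t) - z m t * cos (th m t)) * sin (th m t)) with
      (r m t * (sin (th m t) * sin (th m t)) - z m t * (cos (th m t) * sin (th m t))) by ring.
    rewrite sin_mul_sin.
    assert (0 < r m t * (cos (th m t) * cos (th m t))) by (repeat apply Rmult_lt_0_compat; trivial).
    assert (0 < z m t * (cos (th m t) * sin (th m t))) by (repeat apply Rmult_lt_0_compat; trivial).
    lra.
Qed.

Lemma f_minimal_annulus : f_minimal c S.
Proof.
  intros u v e1 e2 Hs F; assert (Hu := strip_lt u v Hs).
  unfold S, rotational_annulus in *.
  rewrite (mean_curvature_revolve _ _ ang curv (a * T)), (xperp_revolve _ _ ang (a * T));
    trivial; auto using refl_rho_derive, refl_zed_derive, ang_derive, refl_rho_pos.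
  rewrite mulv_mulv, curv_sum by trivial; f_equal; unfold support_at; ring.
Qed.

Lemma unit_sqdist_range u v : strip S u v -> unit_sqdist r z m 0 <= unit_sqdist r z m (u / a) <= unit_sqdist r z m tau /\
  (unit_sqdist r z m (u / a) = unit_sqdist r z m 0 -> u = 0) /\
  (unit_sqdist r z m (u / a) = unit_sqdist r z m tau -> Rabs u = halflen S).
Proof.
  intros H; destruct (strip_scaled u v H) as [H1 H2].
  destruct (abs_eval _ H1) as [_ [_ [_ ->]]].
  assert (Ea : Rabs u = a * Rabs (u / a)).
  { rewrite <- (Rabs_pos_eq a) at 1 by lra; rewrite <- Rabs_mult; f_equal; field; lra. }
  rewrite halflen_annulus.
  set (t := Rabs (u / a)) in *.
  assert (Inc := fun x y => unit_sqdist_increasing d T r z th HU m x y Hm).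
  split; [split|split].
  - destruct (proj1 H2) as [P|<-]; [left; apply Inc|right]; trivial; lra.
  - destruct (proj2 H2) as [P| ->]; [left; apply Inc|right]; trivial; lra.
  - destruct (proj1 H2) as [P|P]; intros E.
    + assert (X := Inc 0 t ltac:(lra) P ltac:(lra)); lra.
    + rewrite <- P, Rmult_0_r in Ea.
      destruct (Req_dec u 0) as [|N]; trivial; apply Rabs_no_R0 in N; lra.
  - destruct (proj2 H2) as [P|P]; intros E.
    + assert (X := Inc t tau ltac:(lra) P ltac:(lra)); lra.
    + now rewrite Ea, P.
Qed.

Lemma dot_chart u v : strip S u v -> dot (chart S u v) (chart S u v) = a ^ 2 * unit_sqdist r z m (u / a).
Proof.
  intros H; unfold S, rotational_annulus; rewrite dot_revolve.
  destruct (refl_eq u (strip_lt u v H)) as [-> ->]; unfold unit_sqdist; ring.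
Qed.

Lemma minimum_circle_annulus u v : strip S u v -> (minimum_circle S (chart S u v) <-> u = 0).
Proof.
  intros H; assert (Pa2 : 0 < a ^ 2) by (apply pow_lt; trivial).
  assert (Z : 0 / a = 0) by (field; lra).
  split.
  - intros [_ Hmin].
    assert (H0 : strip S 0 v).
    { unfold strip; rewrite Rabs_R0, halflen_annulus; apply Rmult_le_pos; lra. }
    assert (E := Hmin (chart S 0 v) (ex_intro _ 0 (ex_intro _ v (conj H0 eq_refl)))).
    rewrite !dot_chart, Z in E by trivial; apply Rmult_le_reg_l in E; trivial.
    destruct (unit_sqdist_range u v H) as [[B1 _] [B2 _]]; apply B2; lra.
  - intros ->; split; [now exists 0, v|].
    intros q [u' [v' [Hs <-]]]; rewrite !dot_chart, Z by trivial.
    apply Rmult_le_compat_l; [lra|]; now apply (unit_sqdist_range u' v').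
Qed.

Lemma pinching_annulus u v e1 e2 : strip S u v -> orthonormal_frame (chart S) u v e1 e2 ->
  let w := xperp (chart S) u v in
  let lhs := normsq_A_xperp (chart S) u v e1 e2 in
  let rhs := 1 + (1 - c * dot w w) ^ 2 in
  lhs <= rhs /\ (lhs = rhs <-> minimum_circle S (chart S u v)).
Proof.
  intros Hs F w lhs rhs; assert (Hu := strip_lt u v Hs).
  assert (El : lhs = support_at u ^ 2 * (curv u ^ 2 + (sin (ang u) / refl_rho c a u) ^ 2)).
  { unfold lhs, S, rotational_annulus in *.
    apply (normsq_A_xperp_revolve _ _ ang curv (a * T)); trivial;
    auto using refl_rho_derive, refl_zed_derive, ang_derive, refl_rho_pos. }
  assert (Ew : dot w w = support_at u ^ 2).
  { unfold w, S, rotational_annulus.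
    rewrite (xperp_revolve _ _ ang (a * T)); trivial;
    auto using refl_rho_derive, refl_zed_derive, ang_derive, refl_rho_pos.
    rewrite dot_mulv, dot_revolve_normal; unfold support_at; ring. }
  assert (D := pinching c (support_at u) (sin (ang u) / refl_rho c a u) (curv u) (curv_sum u Hu)).
  assert (Es : support_at u * (sin (ang u) / refl_rho c a u) = slant u).
  { rewrite support_at_scaled by trivial; destruct (refl_eq u Hu) as [-> _].
    assert (P := up_r_pos _ _ _ _ _ HU _ _ (scaled_rect u Hu)).
    unfold slant, ang; field; split; lra. }
  rewrite <- El, <- Ew, Es in D; fold rhs in D.
  (* In the unit scale [c |w|^2] is [m Q^2], with [|m| < 1/2] and [0 <= Q <= 1]. Together with
     [slant >= 0] this makes the second factor of the pinching identity positive, so the sign is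
     that of [slant - 1]. *)
  assert (Bq : c * dot w w < 1).
  { rewrite Ew, support_at_scaled by trivial.
    replace (c * (a * unit_support r z th m (u / a)) ^ 2) with (m * unit_support r z th m (u / a) ^ 2)
      by (unfold m; ring).
    assert (B := unit_support_range u v Hs); set (q := unit_support r z th m (u / a)) in *.
    assert (Bm := Rle_abs m); assert (Bm' : Rabs m < d) by exact Hm.
    assert (0 <= q ^ 2 <= 1) by (split; [apply pow2_ge_0|simpl; nra]).
    nra. }
  rewrite (minimum_circle_annulus u v Hs).
  destruct (slant_bounds u v Hs) as [B0 B1].
  destruct (Req_dec u 0) as [E|N].
  - rewrite (B0 E) in D; split; [lra|]; split; [trivial|intros _; lra].
  - specialize (B1 N); assert (lhs < rhs) by nra; split; [lra|]; split; [lra|now intros].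
Qed.

Lemma non_flat_annulus : non_flat S.
Proof.
  (* The rotational direction at the neck: there [theta = PI / 2], and the coefficient of the second
     form is the neck radius. *)
  exists 0, 0, (0, 1), (0, 1).
  assert (H0 : strip S 0 0).
  { unfold strip; rewrite Rabs_R0, halflen_annulus; apply Rmult_le_pos; lra. }
  assert (Hu := strip_lt 0 0 H0).
  split; trivial; unfold S, rotational_annulus.
  rewrite (second_form_revolve _ _ ang curv (a * T)); trivial;
    auto using refl_rho_derive, refl_zed_derive, ang_derive, refl_rho_pos.
  assert (P := refl_rho_pos 0 Hu).
  assert (E : ang 0 = PI / 2).
  { unfold ang; replace (0 / a) with 0 by (field; lra); now apply (up_th0 _ _ _ _ _ HU). }
  intros E0; apply (f_equal cx) in E0.
  unfold mulv, second_coef, revolve_normal, zerov, mkE3, cx in E0; simpl in E0.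
  rewrite E, sin_PI2, cos_0 in E0; lra.
Qed.

Lemma free_boundary_annulus : free_boundary Rad S.
Proof.
  assert (Pa2 : 0 < a ^ 2) by (apply pow_lt; trivial).
  assert (Hit' : a ^ 2 * unit_sqdist r z m tau = Rad ^ 2) by exact Hit.
  assert (Bs : forall u v, Rabs u = halflen S -> strip S u v).
  { intros u v E; unfold strip; rewrite E; lra. }
  split; [|split].
  - intros p [u [v [Hs <-]]]; rewrite dot_chart, <- Hit' by trivial.
    apply Rmult_le_compat_l; [lra|]; now apply (unit_sqdist_range u v).
  - intros p; split.
    + intros [[u [v [Hs <-]]] E]; exists u, v; split; trivial.
      rewrite dot_chart, <- Hit' in E by trivial; apply Rmult_eq_reg_l in E; [|lra].
      now apply (unit_sqdist_range u v Hs).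
    + intros [u [v [E <-]]]; assert (Hs := Bs u v E); split; [now exists u, v|].
      rewrite dot_chart, <- Hit' by trivial; f_equal.
      destruct (abs_eval _ (proj1 (strip_scaled u v Hs))) as [_ [_ [_ ->]]]; f_equal.
      unfold Rdiv; rewrite Rabs_mult, E, halflen_annulus, (Rabs_pos_eq (/ a))
        by (left; now apply Rinv_0_lt_compat); field; lra.
  - intros u v E; assert (Hs := Bs u v E); assert (Hu := strip_lt u v Hs).
    unfold S, rotational_annulus.
    rewrite (unit_normal_revolve _ _ ang (a * T)); trivial;
      auto using refl_rho_derive, refl_zed_derive, ang_derive, refl_rho_pos.
    (* On the boundary [u / a] is [tau] or [- tau], where [Q] vanishes; the position vector is then
       tangent to the surface, which is orthogonality to the sphere. *)
    assert (X : support_at u = 0).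
    { rewrite support_at_scaled by trivial.
      destruct (abs_eval _ (proj1 (strip_scaled u v Hs))) as [-> _].
      replace (Rabs (u / a)) with tau; [unfold m; rewrite Hq; ring|].
      unfold Rdiv; rewrite Rabs_mult, E, halflen_annulus, (Rabs_pos_eq (/ a))
        by (left; now apply Rinv_0_lt_compat); field; lra. }
    assert (Y := dot_chart_revolve_normal (refl_rho c a) (refl_zed c a) ang (shooting_length Rad c a) u v).
    unfold support_at in X; rewrite X in Y.
    replace (dot _ _) with (dot (chart (revolve (refl_rho c a) (refl_zed c a) (shooting_length Rad c a)) u v)
      (revolve_normal ang u v)) by (unfold dot; ring).
    rewrite Y; ring.
Qed.

Lemma smooth2_near_of (D U : R -> R -> Prop) f : open2 U -> (forall x y, D x y -> U x y) ->
  smooth2 U f -> smooth2_near D f.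
Proof.
  intros HO HD Hf; exists U; split; [exact HO|split; [exact HD|]].
  intros x y H n; now apply (Ck_ex_diff_n n U).
Qed.

Lemma embedded_annulus : embedded S.
Proof.
  assert (PaT : 0 < a * tau) by (apply Rmult_lt_0_compat; lra).
  set (U (u v : R) := Rabs u < a * T).
  assert (OU : open2 U) by exact (open2_fst _ (Rabs_lt_open (a * T))).
  assert (Sf : forall f g k, smooth2 (rect d T) f ->
    (forall u, Rabs u < a * T -> g u = a * f m (u / a)) -> Ck k U (fun u _ => g u)).
  { intros f g k Hf E; apply (Ck_ext k U (fun u _ => a * f m (u / a))); trivial.
    - intros u v Hu; symmetry; now apply E.
    - apply Ck_mult; [apply Ck_const|].
      apply (Ck_comp k (rect d T) U f (fun _ _ => m) (fun u _ => u / a)).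
      + apply open2_rect.
      + intros u v Hu; now apply scaled_rect.
      + apply Hf.
      + apply Ck_const.
      + apply Ck_mult; [apply Ck_fst|apply Ck_const]. }
  assert (Sr : forall k, Ck k U (fun u _ => refl_rho c a u)).
  { intros k; apply (Sf r); [apply (up_smooth_r _ _ _ _ _ HU)|intros; now apply refl_eq]. }
  assert (Sz : forall k, Ck k U (fun u _ => refl_zed c a u)).
  { intros k; apply (Sf z); [apply (up_smooth_z _ _ _ _ _ HU)|intros; now apply refl_eq]. }
  assert (Hs : forall u v, strip S u v -> U u v) by (intros u v; apply strip_lt).
  split; [now rewrite halflen_annulus|split; [|split; [|split; [|split; [|split]]]]].
  - intros u v; unfold S, rotational_annulus; simpl.
    rewrite cos_plus, sin_plus, cos_2PI, sin_2PI; unfold mkE3; do 2 f_equal; ring.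
  - apply (smooth2_near_of _ U); trivial; intros k.
    apply (Ck_mult k U (fun u _ => refl_rho c a u) (fun _ v => cos v)); trivial; apply Ck_cos_sin.
  - apply (smooth2_near_of _ U); trivial; intros k.
    apply (Ck_mult k U (fun u _ => refl_rho c a u) (fun _ v => sin v)); trivial; apply Ck_cos_sin.
  - apply (smooth2_near_of _ U); trivial.
  - intros u v H; assert (Hu := Hs u v H); unfold S, rotational_annulus.
    rewrite (cross_revolve _ _ ang (a * T)); trivial;
      auto using refl_rho_derive, refl_zed_derive, ang_derive, refl_rho_pos.
    assert (P := refl_rho_pos u Hu); intros E.
    assert (N : dot (mulv (refl_rho c a u) (revolve_normal ang u v)) (mulv (refl_rho c a u) (revolve_normal ang u v)) = 0)
      by (rewrite E; unfold dot, zerov, mkE3, cx, cy, cz; simpl; ring).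
    rewrite dot_mulv, dot_revolve_normal in N; nra.
  - intros u v u' v' H H' E.
    assert (Hu := Hs u v H); assert (Hu' := Hs u' v' H').
    unfold S, rotational_annulus in E; simpl in E; injection E; intros E3 E2 E1.
    (* The height increases strictly along the whole generating curve and so determines [u]; since
       the radius is positive, the other two coordinates then determine the angle modulo [2 PI]. *)
    assert (Eu : u = u').
    { destruct (refl_eq u Hu) as [_ F1]; destruct (refl_eq u' Hu') as [_ F2].
      rewrite F1, F2 in E3; apply Rmult_eq_reg_l in E3; [|lra].
      destruct (scaled_rect u Hu) as [_ R1]; destruct (scaled_rect u' Hu') as [_ R2].
      apply Rabs_def2 in R1; apply Rabs_def2 in R2.
      assert (Et : u / a = u' / a).
      { destruct (Rtotal_order (u / a) (u' / a)) as [L|[L|L]]; trivial; exfalso.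
        - assert (X := z_increasing d T r z th HU m _ _ Hm (proj2 R1) L (proj1 R2)); lra.
        - assert (X := z_increasing d T r z th HU m _ _ Hm (proj2 R2) L (proj1 R1)); lra. }
      apply Rmult_eq_reg_r with (/ a); [exact Et|apply Rgt_not_eq; now apply Rinv_0_lt_compat]. }
    split; trivial; subst u'.
    assert (P := refl_rho_pos u Hu).
    apply same_angle; apply Rmult_eq_reg_l with (refl_rho c a u); trivial; lra.
Qed.

End Annulus.

(** * The critical catenoid and the family through it *)

Lemma sqrt_1_sinh (t : R) : sqrt (1 + sinh t ^ 2) = cosh t.
Proof.
  assert (E : exp t * exp (- t) = 1) by (rewrite <- exp_plus, Rplus_opp_r; apply exp_0).
  replace (1 + sinh t ^ 2) with (cosh t * cosh t).
  - apply sqrt_square; unfold cosh; generalize (exp_pos t) (exp_pos (- t)); lra.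
  - unfold sinh, cosh; replace 1 with (exp t * exp (- t)) by exact E; field.
Qed.

Lemma cosh_pos (t : R) : 0 < cosh t.
Proof. unfold cosh; generalize (exp_pos t) (exp_pos (- t)); lra. Qed.

(** * The unit catenoid in arclength *)

Section Catenoid.
Variables (d T : R) (r z th : R -> R -> R).
Hypothesis HU : unit_profiles d T r z th.

(** Here the equation [t tanh t = 1] appears: it is the vanishing of the support function of the
    catenoid, read at arclength [sinh t]. *)
Lemma unit_support_catenoid t : Rabs (sinh t) < T -> unit_support r z th 0 (sinh t) = 1 - t * tanh t.
Proof.
  intros Ht; destruct (up_cat _ _ _ _ _ HU _ Ht) as [E1 [E2 E3]].
  unfold unit_support, support; rewrite E1, E2, E3, arcsinh_sinh.
  rewrite sin_shift, cos_shift, cos_atan, sin_atan.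
  replace (1 + (sinh t)²) with (1 + sinh t ^ 2) by (unfold Rsqr; ring).
  rewrite sqrt_1_sinh; unfold tanh; assert (P := cosh_pos t); field; lra.
Qed.

Lemma unit_sqdist_catenoid t : Rabs (sinh t) < T -> unit_sqdist r z 0 (sinh t) = cosh t ^ 2 + t ^ 2.
Proof.
  intros Ht; destruct (up_cat _ _ _ _ _ HU _ Ht) as [E1 [E2 _]].
  unfold unit_sqdist; now rewrite E1, E2, arcsinh_sinh, sqrt_1_sinh.
Qed.

End Catenoid.

Lemma t_star_pos : 0 < t_star /\ t_star * tanh t_star = 1.
Proof. now apply t_star_spec. Qed.

Lemma sinh_pos t : 0 < t -> 0 < sinh t.
Proof. intros H; rewrite <- sinh_0; now apply sinh_lt. Qed.

Lemma open2_preimage (V W : R -> R -> Prop) g1 g2 : open2 V -> open2 W ->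
  Ck 0 V g1 -> Ck 0 V g2 -> open2 (fun x y => V x y /\ W (g1 x y) (g2 x y)).
Proof.
  intros HV HW [C1 _] [C2 _] x y [H1 H2].
  apply locally_2d_and; [now apply HV|].
  destruct (HW _ _ H2) as [e He].
  generalize (locally_2d_and _ _ _ _ (C1 x y H1 e) (C2 x y H1 e)).
  apply locally_2d_impl, locally_2d_forall; intros u v [B1 B2]; now apply He.
Qed.

Lemma smooth_on_of (J : R -> Prop) (D : R -> Prop) (f g : R -> R) : open J ->
  smooth2 (fun x _ => J x) (fun x _ => g x) -> (forall x, D x -> J x /\ g x = f x) ->
  smooth_on D f.
Proof.
  intros HJ Hg HD; exists J, g; split; [trivial|split; [trivial|]].
  intros x Hx n; now apply (Ck_ex_derive_n J n).
Qed.

Theorem theorem1p3 (Rad : R) (hRad : 0 < Rad) :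
  exists (eps : R) (a : R -> R) (Sigma : R -> annulus),
    0 < eps /\
    smooth_family Rad eps a /\
    (forall c, 0 <= c < eps ->
       0 < a c < Rad /\
       Sigma c = rotational_annulus Rad c (a c) /\
       embedded (Sigma c) /\
       f_minimal c (Sigma c) /\
       free_boundary Rad (Sigma c)) /\
    (* (i) *)
    (forall p, on_surface (Sigma 0) p <-> on_surface (critical_catenoid Rad) p) /\
    (* (ii) *)
    (forall c, 0 < c < eps -> non_flat (Sigma c)) /\
    (* (iii) *)
    (forall c, 0 <= c < eps ->
       forall u v e1 e2, strip (Sigma c) u v ->
         orthonormal_frame (chart (Sigma c)) u v e1 e2 ->
         let w := xperp (chart (Sigma c)) u v in
         let lhs := normsq_A_xperp (chart (Sigma c)) u v e1 e2 in
         let rhs := 1 + (1 - c * dot w w) ^ 2 in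
         lhs <= rhs /\
         (lhs = rhs <-> minimum_circle (Sigma c) (chart (Sigma c) u v))) /\
    (* (iv) *)
    (exists U : R -> Prop,
       locally (catenoid_neck Rad) U /\
       (forall b, U b -> 0 < b < Rad) /\
       forall c, 0 <= c < eps ->
         U (a c) /\ shooting_root Rad c (a c) /\
         forall b, U b -> shooting_root Rad c b -> b = a c).
Proof.
  destruct t_star_pos as [Pt Et].
  (* The arclength at which the unit catenoid has [Q = 0]. The margins 1 and 2 put [T1] past this
     zero, where [Q] is negative, and keep [T1] inside the window. *)
  set (s0 := sinh t_star).
  assert (Ps : 0 < s0) by now apply sinh_pos.
  set (T1 := s0 + 1); set (T := s0 + 2).
  assert (PT1 : 0 < T1 < T) by (unfold T1, T; lra).
  assert (PT : 0 < T) by lra.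
  destruct (unit_profiles_exist T PT) as [d0 [r [z [th [Hd0 HU0]]]]].
  assert (Z0 : Rabs 0 < d0) by (rewrite Rabs_R0; lra).
  assert (A0 : Rabs s0 < T) by (rewrite Rabs_pos_eq; unfold T; lra).
  assert (S0 : unit_support r z th 0 s0 = 0).
  { unfold s0; rewrite (unit_support_catenoid d0 T r z th HU0) by exact A0; lra. }
  assert (S1 : unit_support r z th 0 T1 < 0).
  { assert (X := unit_support_decreasing d0 T r z th HU0 0 s0 T1 Z0); unfold T1, T in *; lra. }
  (* [Q < 0] at [T1] is known on the catenoid; continuity in [m] extends it to a smaller range of
     [m], to which the profiles are then restricted. *)
  assert (Hd : exists d, 0 < d <= d0 /\ forall m, Rabs m < d -> unit_support r z th m T1 < 0).
  { assert (C : continuous (fun m => unit_support r z th m T1) 0).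
    { apply continuous_of_2d_fst, (Ck_cont 0 (rect d0 T)).
      - apply (smooth_unit_support d0 T r z th HU0).
      - apply (rect_nonneg d0 T 0 T1); trivial; lra. }
    assert (L : locally 0 (fun m => unit_support r z th m T1 < 0)).
    { apply (C (fun v => v < 0)); now apply (open_lt 0). }
    destruct L as [e He]; exists (Rmin d0 e).
    assert (Pe := cond_pos e).
    split; [split; [apply Rmin_pos; lra|apply Rmin_l]|].
    intros m Hm; apply He; unfold ball; simpl; unfold AbsRing_ball, abs, minus, plus, opp; simpl.
    replace (m + - 0) with m by ring; eapply Rlt_le_trans; [exact Hm|apply Rmin_r]. }
  destruct Hd as [d [Hd HT1]].
  assert (HU := unit_profiles_shrink d0 d T r z th (proj2 Hd) HU0); clear HU0.
  assert (Zd : Rabs 0 < d) by (rewrite Rabs_R0; lra).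
  destruct (unit_support_root d T T1 r z th PT1 HU HT1) as [sg [Hsg [Hsu Ssg]]].
  assert (Esg : sg 0 = s0).
  { symmetry; apply Hsu; trivial; unfold T; lra. }
  set (b0 := catenoid_neck Rad).
  set (q := sqrt (cosh t_star ^ 2 + t_star ^ 2)).
  assert (Pq2 : 1 < cosh t_star ^ 2 + t_star ^ 2).
  { rewrite <- (unit_sqdist_catenoid d T r z th HU) by exact A0; fold s0.
    rewrite <- (unit_sqdist_0 d T r z th HU 0 Zd); apply (unit_sqdist_increasing d T r z th HU); unfold T; lra. }
  assert (Pq : 1 < q) by (unfold q; rewrite <- sqrt_1; apply sqrt_lt_1; lra).
  assert (Eq : q ^ 2 = cosh t_star ^ 2 + t_star ^ 2) by (unfold q; apply pow2_sqrt; lra).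
  assert (Eb : b0 * q = Rad) by (unfold b0, catenoid_neck; fold q; field; lra).
  assert (Hb0 : 0 < b0 < Rad).
  { assert (0 < b0) by (unfold b0, catenoid_neck; fold q; apply Rdiv_lt_0_compat; lra).
    split; nra. }
  assert (G0 : gap r z sg Rad 0 b0 = 0).
  { unfold gap, exit_size; rewrite Rmult_0_l, Esg; unfold s0.
    rewrite (unit_sqdist_catenoid d T r z th HU) by exact A0; rewrite <- Eq, <- Eb; ring. }
  destruct (neck_family d T T1 r z th PT1 HU (proj1 Hd) sg Hsg Hsu Ssg Rad b0 Hb0 G0)
    as [eps [a [U [Peps [Ea0 [Sa [Ha [LU [HUb Hroot]]]]]]]]].
  exists eps, a, (fun c => rotational_annulus Rad c (a c)).
  assert (Rc : forall c, 0 <= c < eps -> Rabs c < eps) by (intros; rewrite Rabs_pos_eq; lra).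
  assert (Hd2 : d <= / 2) by lra.
  assert (Fact : forall c, Rabs c < eps -> 0 < a c /\ Rabs (c * a c ^ 2) < d /\
    0 < sg (c * a c ^ 2) < T /\ a c ^ 2 * unit_sqdist r z (c * a c ^ 2) (sg (c * a c ^ 2)) = Rad ^ 2 /\
    unit_support r z th (c * a c ^ 2) (sg (c * a c ^ 2)) = 0).
  { intros c Hc; destruct (Ha c Hc) as [H1 [H2 H3]]; destruct (Hsg _ H2) as [H4 H5].
    split; [lra|split; [trivial|split; [lra|split; trivial]]]. }
  assert (Len : forall c, Rabs c < eps -> shooting_length Rad c (a c) = a c * sg (c * a c ^ 2)).
  { intros c Hc; destruct (Fact c Hc) as [F1 [F2 [F3 [F4 F5]]]].
    apply (shooting_length_scaled d T r z th HU PT c (a c) F1 F2 Rad _ F3 F4). }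
  (* A two-sided interval, because smoothness on [0 <= c < eps] is defined by an extension to an
     open set around [c = 0]. *)
  set (J c := Rabs c < eps).
  assert (OJ : open J) by apply Rabs_lt_open.
  set (V (c s : R) := J c).
  assert (OV : open2 V) by exact (open2_fst J OJ).
  assert (Sm : smooth2 V (fun c _ => c * a c ^ 2)).
  { intros k; apply Ck_mult; [apply Ck_fst|apply (Ck_pow k V (fun c _ => a c)), Sa]. }
  assert (Sd : smooth2 V (fun c s => s / a c)).
  { intros k; unfold Rdiv; apply Ck_mult; [apply Ck_snd|].
    apply (Ck_inv k V (fun c _ => a c)); [|apply Sa].
    intros x w Hx; apply Rgt_not_eq, (Fact x Hx). }
  (* The open set of pairs [(c, s)] on which the scaled unit profiles are defined and smooth. *)
  set (W (c s : R) := V c s /\ rect d T (c * a c ^ 2) (s / a c)).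
  assert (OW : open2 W).
  { apply (open2_preimage V (rect d T) (fun c _ => c * a c ^ 2) (fun c s => s / a c));
      trivial; apply open2_rect. }
  assert (WV : forall c s, W c s -> V c s) by (intros c s H; exact (proj1 H)).
  assert (SW : forall f, smooth2 (rect d T) f -> smooth2 W (fun c s => f (c * a c ^ 2) (s / a c))).
  { intros f Hf k; apply (Ck_comp k (rect d T) W f (fun c _ => c * a c ^ 2) (fun c s => s / a c)).
    - apply open2_rect.
    - intros c s H; exact (proj2 H).
    - apply Hf.
    - apply (Ck_subset k V W _ WV), Sm.
    - apply (Ck_subset k V W _ WV), Sd. }
  assert (Saw : smooth2 W (fun c _ => a c)).
  { intros k; apply (Ck_subset k V W (fun c _ => a c) WV), Sa. }
  assert (InW : forall c s, 0 <= c < eps -> Rabs s <= shooting_length Rad c (a c) ->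
    W c s /\ Rabs s < a c * T).
  { intros c s Hc Hs; assert (Hc' := Rc c Hc); rewrite Len in Hs by trivial.
    destruct (Fact c Hc') as [F1 [F2 [F3 _]]].
    assert (X : Rabs s < a c * T).
    { eapply Rle_lt_trans; [exact Hs|]; apply Rmult_lt_compat_l; lra. }
    split; trivial; split; trivial.
    apply (scaled_rect d T c (a c)); trivial. }
  split; [trivial|split; [|split; [|split; [|split; [|split]]]]].
  - split; [|split; [|split; [|split]]].
    + apply (smooth_on_of J _ _ a OJ Sa); intros c Hc; split; [now apply Rc|reflexivity].
    + apply (smooth_on_of J _ _ (fun c => a c * sg (c * a c ^ 2)) OJ).
      * intros k; apply (Ck_mult k V (fun c _ => a c) (fun c _ => sg (c * a c ^ 2))); [apply Sa|].
        apply (Ck_comp k (fun m _ => Rabs m < d) V (fun m _ => sg m)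
                 (fun c _ => c * a c ^ 2) (fun c _ => c)).
        -- exact (open2_fst _ (Rabs_lt_open d)).
        -- intros x w Hx; now apply (Fact x Hx).
        -- apply Ssg.
        -- apply Sm.
        -- apply Ck_fst.
      * intros c Hc; split; [now apply Rc|]; symmetry; apply Len; auto.
    (* The smooth extension is the scaled unit profile, which [refl_rho] matches as long as [|s|]
       does not exceed the length. *)
    + exists (fun c s => a c * r (c * a c ^ 2) (s / a c)); split.
      * apply (smooth2_near_of _ W); trivial.
        -- intros c s [Hc Hs]; now apply InW.
        -- intros k; apply Ck_mult; [apply Saw|apply SW, (up_smooth_r _ _ _ _ _ HU)].
      * intros c s [Hc Hs]; destruct (InW c s Hc Hs) as [_ X].
        destruct (Fact c (Rc c Hc)) as [F1 [F2 _]].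
        symmetry; apply (refl_eq d T r z th c (a c) HU PT F1 F2 s X).
    + exists (fun c s => a c * z (c * a c ^ 2) (s / a c)); split.
      * apply (smooth2_near_of _ W); trivial.
        -- intros c s [Hc Hs]; now apply InW.
        -- intros k; apply Ck_mult; [apply Saw|apply SW, (up_smooth_z _ _ _ _ _ HU)].
      * intros c s [Hc Hs]; destruct (InW c s Hc Hs) as [_ X].
        destruct (Fact c (Rc c Hc)) as [F1 [F2 _]].
        symmetry; apply (refl_eq d T r z th c (a c) HU PT F1 F2 s X).
    + exists (fun c s => th (c * a c ^ 2) (s / a c)); split.
      * apply (smooth2_near_of _ W); trivial.
        -- intros c s [Hc Hs]; apply InW; trivial; rewrite Rabs_pos_eq; lra.
        -- intros k; apply SW, (up_smooth_th _ _ _ _ _ HU).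
      * intros c s [Hc Hs]; destruct (InW c s Hc) as [_ X]; [rewrite Rabs_pos_eq; lra|].
        destruct (Fact c (Rc c Hc)) as [F1 [F2 _]]; rewrite Rabs_pos_eq in X by lra.
        symmetry; apply (scaled_agree d T r z th HU PT c (a c) F1 F2 s); lra.
  - intros c Hc; destruct (Fact c (Rc c Hc)) as [F1 [F2 [F3 [F4 F5]]]].
    split; [now apply Ha, Rc|split; [reflexivity|split; [|split]]].
    + now apply (embedded_annulus d T r z th c (a c) Rad (sg (c * a c ^ 2))).
    + now apply (f_minimal_annulus d T r z th c (a c) Rad (sg (c * a c ^ 2))).
    + now apply (free_boundary_annulus d T r z th c (a c) Rad (sg (c * a c ^ 2))).
  - assert (Z : Rabs 0 < eps) by (rewrite Rabs_R0; lra).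
    destruct (Fact 0 Z) as [F1 [F2 [F3 [F4 F5]]]].
    rewrite Ea0 in *.
    assert (H0 := refl_eq d T r z th 0 b0 HU PT F1 F2); rewrite Rmult_0_l in *.
    rewrite Esg in *.
    assert (HL : halflen (rotational_annulus Rad 0 b0) = b0 * s0).
    { simpl; rewrite <- Ea0 at 1; rewrite Len, Ea0, Rmult_0_l, Esg by trivial; reflexivity. }
    (* The annulus is parametrized by arclength and the critical catenoid by [t]; the substitution
       [u = b0 sinh t] identifies the two charts, and [b0 s0] corresponds to [t_star]. *)
    assert (Eq0 : forall t, Rabs (b0 * sinh t) < b0 * T -> forall v,
      chart (rotational_annulus Rad 0 b0) (b0 * sinh t) v = chart (critical_catenoid Rad) t v).
    { intros t Ht v; destruct (H0 _ Ht) as [E1 E2]; simpl; rewrite E1, E2.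
      replace (b0 * sinh t / b0) with (sinh t) by (field; lra).
      destruct (up_cat _ _ _ _ _ HU (sinh t)) as [C1 [C2 _]].
      { rewrite Rabs_mult, (Rabs_pos_eq b0) in Ht by lra; apply Rmult_lt_reg_l with b0; lra. }
      now rewrite C1, C2, arcsinh_sinh, sqrt_1_sinh. }
    assert (AbsS : forall t, Rabs (sinh t) = sinh (Rabs t)).
    { intros t; destruct (Rle_dec 0 t) as [P|P].
      - rewrite !Rabs_pos_eq; trivial; destruct (Rle_lt_or_eq_dec 0 t P) as [Q|<-];
          [left; now apply sinh_pos|rewrite sinh_0; lra].
      - assert (X := sinh_pos (- t) ltac:(lra)).
        assert (Y : sinh (- t) = - sinh t) by (unfold sinh; rewrite Ropp_involutive; field).
        rewrite (Rabs_left t), Rabs_left by lra; lra. }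
    intros p; split.
    + intros [u [v [Hs <-]]]; unfold strip in Hs; rewrite HL in Hs.
      exists (arcsinh (u / b0)), v.
      assert (Eu : u = b0 * sinh (arcsinh (u / b0))) by (rewrite sinh_arcsinh; field; lra).
      set (t := arcsinh (u / b0)) in *; rewrite Eu in Hs |- *.
      rewrite Rabs_mult, (Rabs_pos_eq b0) in Hs by lra.
      apply Rmult_le_reg_l in Hs; [|lra].
      split.
      * unfold strip; simpl; rewrite AbsS in Hs; apply Rnot_lt_le; intros N.
        apply sinh_lt in N; unfold s0 in Hs; lra.
      * symmetry; apply Eq0; rewrite Rabs_mult, (Rabs_pos_eq b0) by lra.
        apply Rmult_lt_compat_l; unfold T; lra.
    + intros [t [v [Hs <-]]]; unfold strip in Hs; simpl in Hs.
      exists (b0 * sinh t), v.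
      assert (B : Rabs (sinh t) <= s0).
      { rewrite AbsS; destruct Hs as [N|N]; [left; now apply sinh_lt|right; now rewrite N]. }
      split.
      * unfold strip; rewrite HL, Rabs_mult, (Rabs_pos_eq b0) by lra.
        apply Rmult_le_compat_l; lra.
      * apply Eq0; rewrite Rabs_mult, (Rabs_pos_eq b0) by lra.
        apply Rmult_lt_compat_l; unfold T; lra.
  - intros c Hc; destruct (Fact c (Rc c ltac:(lra))) as [F1 [F2 [F3 [F4 F5]]]].
    now apply (non_flat_annulus d T r z th c (a c) Rad (sg (c * a c ^ 2))).
  - intros c Hc; destruct (Fact c (Rc c Hc)) as [F1 [F2 [F3 [F4 F5]]]].
    now apply (pinching_annulus d T r z th c (a c) Rad (sg (c * a c ^ 2))).
  - exists U; split; [trivial|split; [trivial|]]; intros c Hc; apply Hroot; auto.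
Qed.
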